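(* Let $K$ be a field with $\mathrm{char}\,K\neq 2$. Every even-trigonalizable algebraic supergroup $\mathbb{G}$ over $K$ has a normal chain of closed super-subgroups $$\mathbb{G}_0 \lhd \mathbb{G}_1\lhd \cdots\lhd \mathbb{G}_t=\mathbb{G}, \quad t \ge 0$$ (each $\mathbb{G}_{i-1}$ normal in $\mathbb{G}_i$) such that $\mathbb{G}_0$ is a trigonalizable algebraic group (in particular purely even), and each factor $\mathbb{G}_i/\mathbb{G}_{i-1}$, $0<i\le t$, is isomorphic to $\mathsf{G}_a^-$, to $\mathsf{G}_m$, or to $\mu_n$ for some $n>1$.
   Context: ''Super'' means $\mathbb{Z}_2$-graded. $\mathsf{SAlg}_K$ is the category of super-commutative superalgebras over $K$ (homogeneous elements satisfy $ab=(-1)^{|a||b|}ba$; morphisms preserve parity). An affine supergroup $\mathbb{G}$ is a representable group-valued functor on $\mathsf{SAlg}_K$; it is represented by a super-commutative Hopf superalgebra $K[\mathbb{G}]$. It is an algebraic supergroup if $K[\mathbb{G}]$ is finitely generated as an algebra. Affine/algebraic groups mean affine (algebraic) group schemes over $K$, not necessarily smooth; an affine group $G$ is regarded as the affine supergroup $R\mapsto G(R_0)$ (''purely even'' supergroups are exactly these). $\mathbb{G}_{ev}$ is the affine group represented by the Hopf algebra $K[\mathbb{G}]/(K[\mathbb{G}]_1)$, where $(K[\mathbb{G}]_1)$ is the ideal generated by the odd component. Closed super-subgroups correspond to quotient Hopf superalgebras of $K[\mathbb{G}]$. For a normal closed super-subgroup $\mathbb{N}$ of $\mathbb{G}$, the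 quotient $\mathbb{G}/\mathbb{N}$ is the affine supergroup represented by the unique Hopf super-subalgebra $B\subset K[\mathbb{G}]$ with $K[\mathbb{G}]/B^+K[\mathbb{G}]=K[\mathbb{N}]$, where $B^+=\mathrm{Ker}\,\varepsilon_B$. An algebraic group $G$ is trigonalizable if every simple $G$-module is one-dimensional. An algebraic supergroup $\mathbb{G}$ is even-trigonalizable if $\mathbb{G}_{ev}$ is trigonalizable. $\mathsf{G}_m$ is the multiplicative group, $\mu_n$ the group scheme of $n$-th roots of unity. $\mathsf{G}_a^-$ is the algebraic supergroup represented by the exterior algebra $\wedge(z)=K[z]/(z^2)$ on one odd primitive element $z\neq 0$; thus $\mathsf{G}_a^-(R)$ is the additive group $R_1$. *)

(* Defs.v *)
From HB Require Import structures.
From mathcomp Require Import all_boot all_order all_algebra.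
From mathcomp Require Import sesquilinear generic_quotient boolp.

Set Implicit Arguments.
Unset Strict Implicit.
Unset Printing Implicit Defensive.

Import GRing.Theory.
Local Open Scope ring_scope.
Local Open Scope quotient_scope.

(* [homog b] is the component of parity [b] ([false] = even, [true] = odd).
   An [algType] is nonzero; leaving out the zero superalgebra is harmless, as
   it has exactly one point in any representable functor and never represents
   a group-valued functor. *)
Record superalg (K : fieldType) := Superalg {
  superalg_alg :> algType K;
  homog : bool -> {pred superalg_alg};
  homog_submod : forall b, submod_closed (homog b);
  homog_decomp : forall a, exists a0 a1,
    [/\ a0 \in homog false, a1 \in homog true & a = a0 + a1];
  homog_direct : forall a, a \in homog false -> a \in homog true -> a = 0;
  homog1 : 1 \in homog false;
  homogM : forall b c x y,
    x \in homog b -> y \in homog c -> x * y \in homog (b (+) c);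
  supercomm : forall b c x y,
    x \in homog b -> y \in homog c -> x * y = (-1) ^+ (b && c) * (y * x)
}.

Arguments homog {K} s b.
Arguments homog_submod {K} s b.

Record smor (K : fieldType) (A B : superalg K) := Smor {
  smor_fun :> {lrmorphism A -> B};
  smor_homog : forall b x, x \in homog A b -> smor_fun x \in homog B b
}.

Lemma smorP (K : fieldType) (A B : superalg K) (f g : smor A B) :
  f =1 g -> f = g.
Proof.
case: f g => [[f cf] pf] [[g cg] pg] /= /funext fg; case: _ / fg in cg pg *.
suff e : cf = cg by case: _ / e in pg *; congr Smor; exact: Prop_irrelevance.
case: cf cg {pf pg} => [[a1] [b1] [c1]] [[a2] [b2] [c2]].
by congr (GRing.LRMorphism.Class _ _ _); congr (_ _); exact: Prop_irrelevance.
Qed.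

Definition smor_id (K : fieldType) (A : superalg K) : smor A A :=
  @Smor K A A idfun (fun b x xA => xA).

Definition smor_comp (K : fieldType) (A B C : superalg K)
    (g : smor B C) (f : smor A B) : smor A C :=
  @Smor K A C (g \o f) (fun b x xA => smor_homog g (smor_homog f xA)).

Definition purely_even (K : fieldType) (A : superalg K) : Prop :=
  forall a, a \in homog A true -> a = 0.

Definition base_homog (K : fieldType) (b : bool) : {pred K^o} :=
  if b then pred1 0 else predT.
Arguments base_homog K b : clear implicits.

Lemma base_homog_submod (K : fieldType) b : submod_closed (base_homog K b).
Proof.
case: b; split=> //= [|c u v]; rewrite !inE //.
by move=> /eqP -> /eqP ->; rewrite scaler0 addr0.
Qed.

Lemma base_homog_decomp (K : fieldType) (a : K^o) : exists a0 a1,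
  [/\ a0 \in base_homog K false, a1 \in base_homog K true & a = a0 + a1].
Proof. by exists a, 0; rewrite !inE addr0. Qed.

Lemma base_homog_direct (K : fieldType) (a : K^o) :
  a \in base_homog K false -> a \in base_homog K true -> a = 0.
Proof. by move=> _ /eqP. Qed.

Lemma base_homogM (K : fieldType) b c (x y : K^o) :
  x \in base_homog K b -> y \in base_homog K c ->
  x * y \in base_homog K (b (+) c).
Proof.
case: b; case: c => //=; rewrite !inE; first by move=> /eqP->; rewrite mul0r.
by move=> _ /eqP->; rewrite mulr0.
Qed.

Lemma base_supercomm (K : fieldType) b c (x y : K^o) :
  x \in base_homog K b -> y \in base_homog K c ->
  x * y = (-1) ^+ (b && c) * (y * x).
Proof.
case: b; case: c; rewrite /= ?expr0 ?mul1r 1?[x * y]mulrC //.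
by rewrite !inE => _ /eqP->; rewrite mul0r mulr0.
Qed.

Definition base_superalg (K : fieldType) : superalg K :=
  @Superalg K K^o (base_homog K) (@base_homog_submod K) (@base_homog_decomp K)
    (@base_homog_direct K) isT (@base_homogM K) (@base_supercomm K).

Record sfunctor (K : fieldType) := SFunctor {
  pts :> superalg K -> Type;
  fmap : forall R S, smor R S -> pts R -> pts S;
  fmap_id : forall R x, fmap (smor_id R) x = x;
  fmap_comp : forall R S T (g : smor S T) (f : smor R S) x,
    fmap (smor_comp g f) x = fmap g (fmap f x)
}.

Record group_structure (K : fieldType) (F : sfunctor K) := GroupStructure {
  gmul : forall R, F R -> F R -> F R;
  gone : forall R, F R;
  ginv : forall R, F R -> F R;
  gmulA : forall R, associative (@gmul R);
  gmul1 : forall R, left_id (@gone R) (@gmul R);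
  gmulV : forall R, left_inverse (@gone R) (@ginv R) (@gmul R);
  gmul_nat : forall R S (f : smor R S) x y,
    fmap f (@gmul R x y) = @gmul S (fmap f x) (fmap f y)
}.

Record group_functor (K : fieldType) := GroupFunctor {
  gf_functor :> sfunctor K;
  gf_group :> group_structure gf_functor
}.

Definition group_functor_iso (K : fieldType) (F G : group_functor K) : Prop :=
  exists theta : forall R, F R -> G R,
    [/\ forall R, bijective (theta R),
        forall R S (f : smor R S) x, theta S (fmap f x) = fmap f (theta R x)
      & forall R x y, theta R (gmul F x y) = gmul G (theta R x) (theta R y)].

Definition hom_functor (K : fieldType) (A : superalg K) : sfunctor K.
Proof.
refine (@SFunctor K (smor A) (fun R S f x => smor_comp f x) _ _).
- by move=> R x; apply: smorP.
- by move=> R S T g f x; apply: smorP.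
Defined.

(* A representable group-valued functor, given by a representing superalgebra
   [coord] and a group structure on the functor it represents; by Yoneda this
   is the same as a Hopf superalgebra structure on [coord]. *)
Record supergroup (K : fieldType) := Supergroup {
  coord : superalg K;
  sg_group : group_structure (hom_functor coord)
}.

Definition supergroup_functor (K : fieldType) (G : supergroup K) :=
  GroupFunctor (sg_group G).
Coercion supergroup_functor : supergroup >-> group_functor.

Definition counit (K : fieldType) (G : supergroup K) :
  smor (coord G) (base_superalg K) := gone G (base_superalg K).

Definition algebraic (K : fieldType) (G : supergroup K) : Prop :=
  exists s : seq (coord G), forall P : {pred coord G},
    subalg_closed P -> {subset s <= P} -> forall a, a \in P.

(* Affine groups, regarded as supergroups via R |-> G(R_0). *)
Definition affine_group (K : fieldType) (G : supergroup K) : Prop :=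
  purely_even (coord G).

(* [f : K[H] -> K[G]] is the comorphism of a homomorphism G -> H. *)
Definition hopf_morphism (K : fieldType) (G H : supergroup K)
    (f : smor (coord H) (coord G)) : Prop :=
  forall R (x y : G R),
    smor_comp (gmul G x y) f = gmul H (smor_comp x f) (smor_comp y f).

(* A closed super-subgroup: a quotient Hopf superalgebra of the coordinate
   superalgebra of the ambient supergroup. *)
Record closed_subgroup (K : fieldType) (N G : supergroup K) := ClosedSubgroup {
  restr :> smor (coord G) (coord N);
  restr_hopf : hopf_morphism restr;
  restr_surj : forall b, exists a, restr a = b
}.

Definition sub_pts (K : fieldType) (N G : supergroup K)
    (j : closed_subgroup N G) (R : superalg K) (x : G R) : Prop :=
  exists n : N R, x = smor_comp n j.

Definition normal_subgroup (K : fieldType) (N G : supergroup K)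
    (j : closed_subgroup N G) : Prop :=
  forall R (g x : G R),
    sub_pts j x -> sub_pts j (gmul G (gmul G g x) (ginv G g)).

(* K[Q] is (isomorphic via [f] to) a Hopf super-subalgebra B of K[G] with
   K[G] / B^+ K[G] = K[N]. *)
Definition is_quotient (K : fieldType) (N G : supergroup K)
    (j : closed_subgroup N G) (Q : supergroup K) : Prop :=
  exists f : smor (coord Q) (coord G),
    [/\ hopf_morphism f, injective f
      & forall a, j a = 0 <->
          exists s : seq (coord Q * coord G),
            (forall p, p \in s -> counit Q p.1 = 0) /\
            a = \sum_(p <- s) f p.1 * p.2].

(* [E], embedded by [j], is the purely even part G_ev: its coordinate algebra
   is the quotient of K[G] by the ideal generated by the odd component. *)
Definition is_even_part (K : fieldType) (E G : supergroup K)
    (j : closed_subgroup E G) : Prop :=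
  forall a, j a = 0 <->
    exists s : seq (coord G * coord G * coord G),
      (forall p, p \in s -> p.1.2 \in homog (coord G) true) /\
      a = \sum_(p <- s) p.1.1 * p.1.2 * p.2.

Section Examples.
Variable K : fieldType.
Implicit Types R S T : superalg K.

Definition ga_pts R := {x : R | x \in homog R true}.

Definition ga_map R S (f : smor R S) (x : ga_pts R) : ga_pts S :=
  exist _ (f (val x)) (smor_homog f (valP x)).

Definition ga_functor : sfunctor K.
Proof.
by refine (@SFunctor K ga_pts ga_map _ _) => *; apply: val_inj.
Defined.

Lemma homogD R b x y :
  x \in homog R b -> y \in homog R b -> x + y \in homog R b.
Proof.
by move=> xb yb; have := (homog_submod R b).2 1 x y xb yb; rewrite scale1r.
Qed.

Lemma homog0 R b : 0 \in homog R b.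
Proof. exact: (homog_submod R b).1. Qed.

Lemma homogN R b x : x \in homog R b -> - x \in homog R b.
Proof.
move=> xb; have := (homog_submod R b).2 (-1) x 0 xb (homog0 R b).
by rewrite scaleN1r addr0.
Qed.

Definition ga_add R (x y : ga_pts R) : ga_pts R :=
  exist _ (val x + val y) (homogD (valP x) (valP y)).

Definition ga_opp R (x : ga_pts R) : ga_pts R :=
  exist _ (- val x) (homogN (valP x)).

Definition Ga_minus : group_functor K.
Proof.
refine (@GroupFunctor K ga_functor (@GroupStructure K ga_functor
  ga_add (fun R => exist _ 0 (homog0 R true)) ga_opp _ _ _ _)).
- by move=> R x y z; apply: val_inj; rewrite /= addrA.
- by move=> R x; apply: val_inj; rewrite /= add0r.
- by move=> R x; apply: val_inj; rewrite /= addNr.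
- by move=> R S f x y; apply: val_inj; rewrite /= rmorphD.
Defined.

(* Units of R_0, as pairs of an element and its inverse. *)
Definition gm_pred R : {pred R * R} := fun p =>
  [&& p.1 \in homog R false, p.2 \in homog R false,
      p.1 * p.2 == 1 & p.2 * p.1 == 1].

Definition gm_pts R := {p : R * R | gm_pred p}.

Definition gm_exist R p (h : gm_pred p) : gm_pts R :=
  exist (fun p => is_true (gm_pred p)) p h.

Lemma gm_map_subproof R S (f : smor R S) (x : gm_pts R) :
  gm_pred (f (val x).1, f (val x).2).
Proof.
case: x => -[x y] /= /and4P[x0 y0 /eqP xy /eqP yx].
by apply/and4P; rewrite /= !smor_homog // -!rmorphM xy yx rmorph1 eqxx.
Qed.

Definition gm_map R S (f : smor R S) (x : gm_pts R) : gm_pts S :=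
  gm_exist (gm_map_subproof f x).

Definition gm_functor : sfunctor K.
Proof.
by refine (@SFunctor K gm_pts gm_map _ _) => *; apply: val_inj => //=;
  rewrite -surjective_pairing.
Defined.

Lemma gm_mul_subproof R (x y : gm_pts R) :
  gm_pred ((val x).1 * (val y).1, (val y).2 * (val x).2).
Proof.
case: x y => -[x x'] /= /and4P[x0 x'0 /eqP xx' /eqP x'x].
case=> -[y y'] /= /and4P[y0 y'0 /eqP yy' /eqP y'y].
apply/and4P; rewrite /= !(homogM (b := false) (c := false)) //.
rewrite mulrA -(mulrA x) yy' mulr1 xx' mulrA -(mulrA y') x'x mulr1 y'y.
by rewrite !eqxx.
Qed.

Definition gm_mul R (x y : gm_pts R) : gm_pts R :=
  gm_exist (gm_mul_subproof x y).

Lemma gm_one_subproof R : gm_pred (1 : R, 1 : R).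
Proof. by apply/and4P; rewrite /= homog1 mulr1 eqxx. Qed.

Lemma gm_inv_subproof R (x : gm_pts R) : gm_pred ((val x).2, (val x).1).
Proof. by case: x => -[x y] /= /and4P[? ? ? ?]; apply/and4P. Qed.

Definition gm_inv R (x : gm_pts R) : gm_pts R := gm_exist (gm_inv_subproof x).

Definition Gm : group_functor K.
Proof.
refine (@GroupFunctor K gm_functor (@GroupStructure K gm_functor
  gm_mul (fun R => gm_exist (gm_one_subproof R)) gm_inv _ _ _ _)).
- by move=> R x y z; apply: val_inj; rewrite /= !mulrA.
- by move=> R [[x y] ?]; apply: val_inj; rewrite /= mul1r mulr1.
- move=> R [[x y] p]; apply: val_inj => /=.
  by case/and4P: p => /= _ _ _ /eqP->.
- by move=> R S f x y; apply: val_inj; rewrite /= !rmorphM.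
Defined.

Variable n : nat.

Definition mu_pts R := {x : gm_pts R | (val x).1 ^+ n == 1}.

Definition mu_exist R (x : gm_pts R) (h : (val x).1 ^+ n == 1) : mu_pts R :=
  exist (fun x : gm_pts R => is_true ((val x).1 ^+ n == 1)) x h.

Lemma mu_map_subproof R S (f : smor R S) (x : mu_pts R) :
  (val (gm_map f (val x))).1 ^+ n == 1.
Proof. by rewrite /= -rmorphXn (eqP (valP x)) rmorph1. Qed.

Definition mu_map R S (f : smor R S) (x : mu_pts R) : mu_pts S :=
  mu_exist (mu_map_subproof f x).

Definition mu_functor : sfunctor K.
Proof.
refine (@SFunctor K mu_pts mu_map _ _) => *; apply: val_inj => /=.
- exact: (fmap_id (s := gm_functor)).
- exact: (fmap_comp (s := gm_functor)).
Defined.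

Lemma gm_comm R (x y : gm_pts R) : GRing.comm (val x).1 (val y).1.
Proof.
have /and4P[x0 _ _ _] := valP x; have /and4P[y0 _ _ _] := valP y.
by rewrite /GRing.comm (supercomm x0 y0) mul1r.
Qed.

Lemma mu_mul_subproof R (x y : mu_pts R) :
  (val (gm_mul (val x) (val y))).1 ^+ n == 1.
Proof.
rewrite /= exprMn_comm; last exact: gm_comm.
by rewrite (eqP (valP x)) (eqP (valP y)) mulr1.
Qed.

Definition mu_mul R (x y : mu_pts R) : mu_pts R :=
  mu_exist (mu_mul_subproof x y).

Lemma mu_one_subproof R : (val (gone Gm R)).1 ^+ n == 1.
Proof. by rewrite /= expr1n. Qed.

Lemma mu_inv_subproof R (x : mu_pts R) : (val (gm_inv (val x))).1 ^+ n == 1.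
Proof.
case: x => -[[x y] /= p] xn /=.
have /and4P[/= _ _ /eqP xy /eqP yx] := p.
have : (x * y) ^+ n == 1 by rewrite xy expr1n.
by rewrite exprMn_comm ?(eqP xn) ?mul1r // /GRing.comm xy yx.
Qed.

Definition mu_inv R (x : mu_pts R) : mu_pts R := mu_exist (mu_inv_subproof x).

Definition mu : group_functor K.
Proof.
refine (@GroupFunctor K mu_functor (@GroupStructure K mu_functor
  mu_mul (fun R => mu_exist (mu_one_subproof R)) mu_inv _ _ _ _)).
- by move=> R x y z; apply: val_inj; exact: (gmulA Gm).
- by move=> R x; apply: val_inj; exact: (gmul1 Gm).
- by move=> R x; apply: val_inj; exact: (gmulV Gm).
- by move=> R S f x y; apply: val_inj; exact: (gmul_nat Gm).
Defined.

End Examples.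

(* A finite list of pairs stands for the sum of the corresponding pure tensors;
   two lists are identified when no bilinear map separates them. *)
Section Tensor.
Variables (K : fieldType) (V W : lmodType K).

Definition tsum (U : lmodType K) (beta : V -> W -> U) (s : seq (V * W)) : U :=
  \sum_(p <- s) beta p.1 p.2.

Definition tensor_eqv (s t : seq (V * W)) : bool :=
  `[< forall (U : lmodType K) (beta : {bilinear V -> W -> U}),
        tsum beta s = tsum beta t >].

Lemma tensor_eqv_refl : reflexive tensor_eqv.
Proof. by move=> s; apply/asboolP. Qed.

Lemma tensor_eqv_sym : symmetric tensor_eqv.
Proof. by move=> s t; apply/asbool_equiv_eq; split=> h U beta; rewrite h. Qed.

Lemma tensor_eqv_trans : transitive tensor_eqv.
Proof.
by move=> s t u /asboolP h /asboolP k; apply/asboolP => U beta; rewrite h k.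
Qed.

Canonical tensor_equiv :=
  EquivRel tensor_eqv tensor_eqv_refl tensor_eqv_sym tensor_eqv_trans.

Definition tensor : Type := {eq_quot tensor_equiv}.

HB.instance Definition _ := Choice.on tensor.
HB.instance Definition _ := EqQuotient.on tensor.

Definition tensor_lift (U : lmodType K) (beta : V -> W -> U) (t : tensor) : U :=
  tsum beta (repr t).

Lemma tensor_lift_pi (U : lmodType K) (beta : {bilinear V -> W -> U}) s :
  tensor_lift beta (\pi_tensor s) = tsum beta s.
Proof.
have /eqquotP/asboolP : \pi_tensor (repr (\pi_tensor s)) = \pi_tensor s
  by rewrite reprK.
exact.
Qed.

Lemma tensorP (t u : tensor) :
  (forall (U : lmodType K) (beta : {bilinear V -> W -> U}),
     tensor_lift beta t = tensor_lift beta u) -> t = u.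
Proof. by move=> h; rewrite -[t]reprK -[u]reprK; apply/eqquotP/asboolP. Qed.

Definition tensor0 : tensor := \pi_tensor [::].
Definition tensor_add (t u : tensor) : tensor := \pi_tensor (repr t ++ repr u).
Definition tensor_scale (c : K) (t : tensor) : tensor :=
  \pi_tensor [seq (c *: p.1, p.2) | p <- repr t].
Definition tensor_opp : tensor -> tensor := tensor_scale (-1).

Definition pure (v : V) (w : W) : tensor := \pi_tensor [:: (v, w)].

Lemma lift0 (U : lmodType K) (beta : {bilinear V -> W -> U}) :
  tensor_lift beta tensor0 = 0.
Proof. by rewrite tensor_lift_pi /tsum big_nil. Qed.

Lemma lift_add (U : lmodType K) (beta : {bilinear V -> W -> U}) t u :
  tensor_lift beta (tensor_add t u) = tensor_lift beta t + tensor_lift beta u.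
Proof. by rewrite tensor_lift_pi /tsum big_cat. Qed.

Lemma lift_scale (U : lmodType K) (beta : {bilinear V -> W -> U}) c t :
  tensor_lift beta (tensor_scale c t) = c *: tensor_lift beta t.
Proof.
rewrite tensor_lift_pi /tsum big_map scaler_sumr.
by apply: eq_bigr => p _; rewrite linearZl_LR.
Qed.

Lemma lift_pure (U : lmodType K) (beta : {bilinear V -> W -> U}) v w :
  tensor_lift beta (pure v w) = beta v w.
Proof. by rewrite tensor_lift_pi /tsum big_seq1. Qed.

Lemma tensor_addA : associative tensor_add.
Proof. by move=> *; apply: tensorP => *; rewrite !lift_add addrA. Qed.

Lemma tensor_addC : commutative tensor_add.
Proof. by move=> *; apply: tensorP => *; rewrite !lift_add addrC. Qed.

Lemma tensor_add0 : left_id tensor0 tensor_add.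
Proof. by move=> *; apply: tensorP => *; rewrite lift_add lift0 add0r. Qed.

Lemma tensor_addN : left_inverse tensor0 tensor_opp tensor_add.
Proof.
move=> *; apply: tensorP => *.
by rewrite lift_add lift_scale scaleN1r addNr lift0.
Qed.

HB.instance Definition _ := GRing.isZmodule.Build tensor
  tensor_addA tensor_addC tensor_add0 tensor_addN.

Lemma tensor_scaleA a b t :
  tensor_scale a (tensor_scale b t) = tensor_scale (a * b) t.
Proof. by apply: tensorP => *; rewrite !lift_scale scalerA. Qed.

Lemma tensor_scale1 : left_id 1 tensor_scale.
Proof. by move=> *; apply: tensorP => *; rewrite lift_scale scale1r. Qed.

Lemma tensor_scaleDr : right_distributive tensor_scale +%R.
Proof.
by move=> *; apply: tensorP => *; rewrite !(lift_scale, lift_add) scalerDr.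
Qed.

Lemma tensor_scaleDl t : {morph tensor_scale^~ t : a b / a + b}.
Proof.
by move=> *; apply: tensorP => *; rewrite !(lift_scale, lift_add) scalerDl.
Qed.

HB.instance Definition _ := GRing.Zmodule_isLmodule.Build K tensor
  tensor_scaleA tensor_scale1 tensor_scaleDr tensor_scaleDl.

End Tensor.

(* id (x) g, for linear g (the lift is only meaningful along bilinear maps). *)
Definition tensor_mapr (K : fieldType) (V W W' : lmodType K) (g : W -> W')
    (t : tensor V W) : tensor V W' :=
  tensor_lift (fun v w => pure v (g w)) t.

(* G-modules as linear representations: R-linear actions of G(R) on V (x) R,
   natural in R. Only used for purely even G; the action is then determined by
   the universal point of G in the commutative algebra K[G], so that letting R
   run over all superalgebras or over commutative algebras is the same. *)
Record gmodule (K : fieldType) (G : supergroup K) := GModule {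
  gm_space :> lmodType K;
  gm_act : forall R : superalg K,
    G R -> {linear tensor gm_space R -> tensor gm_space R};
  gm_actZ : forall R (g : G R) (r : R) t,
    gm_act g (tensor_mapr ( *%R^~ r) t) = tensor_mapr ( *%R^~ r) (gm_act g t);
  gm_act1 : forall R t, gm_act (gone G R) t = t;
  gm_actM : forall R (g h : G R) t,
    gm_act (gmul G g h) t = gm_act g (gm_act h t);
  gm_act_nat : forall R S (f : smor R S) (g : G R) t,
    gm_act (fmap f g) (tensor_mapr f t) = tensor_mapr f (gm_act g t)
}.

(* The image of U (x) W in V (x) W. *)
Definition in_tensor_sub (K : fieldType) (V W : lmodType K) (U : {pred V})
    (t : tensor V W) : Prop :=
  exists s : seq (V * W),
    (forall p, p \in s -> p.1 \in U) /\ t = \sum_(p <- s) pure p.1 p.2.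

Definition submodule (K : fieldType) (G : supergroup K) (V : gmodule G)
    (U : {pred V}) : Prop :=
  submod_closed U /\
  forall R (g : G R) t, in_tensor_sub U t -> in_tensor_sub U (gm_act V g t).

Definition simple_module (K : fieldType) (G : supergroup K) (V : gmodule G) :
    Prop :=
  (exists v : V, v != 0) /\
  forall U : {pred V}, submodule U ->
    (forall v, v \in U -> v = 0) \/ (forall v, v \in U).

Definition one_dimensional (K : fieldType) (V : lmodType K) : Prop :=
  exists2 v : V, v != 0 & forall w, exists c : K, w = c *: v.

Definition trigonalizable_group (K : fieldType) (G : supergroup K) : Prop :=
  [/\ affine_group G, algebraic G
    & forall V : gmodule G, simple_module V -> one_dimensional V].

Definition even_trigonalizable (K : fieldType) (G : supergroup K) : Prop :=
  exists (E : supergroup K) (j : closed_subgroup E G),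
    is_even_part j /\ trigonalizable_group E.

(* Main.v *)
(* Let A = K[G], pi : A -> K[G_ev], and let d be the dimension of the odd
   cotangent space A_1 / A_0^+ A_1.  If d = 0 then G = G_ev.  If d > 0, the
   matrix of G_ev acting on this space has an eigenvector f because G_ev is
   trigonalizable.  A Taylor expansion along the odd derivations D_i identifies
   A with pi(A) (x) /\(K^d), so there is an odd z with pi D_i z = f_i and
   no higher Taylor coefficients.  The brackets [D_i, D_j] of odd derivations
   act on the eigenvector through a symmetric matrix q, which vanishes by
   [x, [x, x]] = 0 and the Jacobi identity; hence D_i z = f_i exactly and
   Delta z = 1 (x) z + z (x) g with g group-like.  Then g = 1 cuts out a normal
   subgroup with quotient G_m or mu_n (or g = 1 already), and z = 0 cuts out of
   it a normal subgroup with quotient G_a^- and smaller d. *)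
Require Import Defs.
From mathcomp Require Import all_boot ssralg.
From HB Require Import structures.
From mathcomp Require Import all_order all_algebra.
From mathcomp Require Import sesquilinear generic_quotient boolp classical_sets.

Set Implicit Arguments.
Unset Strict Implicit.
Unset Printing Implicit Defensive.

Import GRing.Theory.
Local Open Scope ring_scope.
Local Open Scope quotient_scope.

(** * Linear functionals and tensors *)

(** The induction passes to closed subgroups, and a module of a subgroup need not extend to the
    ambient group, so trigonalizability in terms of modules is awkward to carry along. It is
    replaced by a statement on finite matrices over K[G_ev] ([pointed]), inherited by closed
    subgroups because matrix entries lift along surjections of coordinate algebras, and turned back
    into modules only at the bottom of the chain. The eigenvector alone yields an odd element that
    is correct to first order. Its higher Taylor coefficients can be prescribed only along
    increasing words of derivations; all other words differ from these by brackets, and that is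
    where q must vanish. Characteristic 2 is excluded in that argument as well as in z^2 = 0; in
    characteristic 3 the Jacobi identity says nothing on the diagonal of q. A group-like g other
    than 1 has to be removed before z because z is primitive only modulo g - 1. That step need not
    lower d, but z keeps a nonzero odd derivative on the subgroup g = 1, so the two steps together
    do. Throughout, functionals replace Sweedler notation: identities between tensors are tested on
    functionals. *)

Definition linclosed (K : fieldType) (V : lmodType K) (U : V -> Prop) :=
  U 0 /\ forall a u v, U u -> U v -> U (a *: u + v).

Section LinClosed.
Variables (K : fieldType) (V : lmodType K) (U : V -> Prop).
Hypothesis U_lin : linclosed U.

Lemma linclosedD u v : U u -> U v -> U (u + v).
Proof. by move=> hu hv; rewrite -[u]scale1r; apply: U_lin.2. Qed.

Lemma linclosedZ a u : U u -> U (a *: u).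
Proof. by move=> hu; rewrite -[_ *: _]addr0; apply: U_lin.2 => //; apply: U_lin.1. Qed.

Lemma linclosedN u : U u -> U (- u).
Proof. by rewrite -scaleN1r; apply: linclosedZ. Qed.

Lemma linclosedB u v : U u -> U v -> U (u - v).
Proof. by move=> hu hv; apply: linclosedD => //; apply: linclosedN. Qed.

Lemma linclosed_sum (I : Type) (r : seq I) (P : pred I) (F : I -> V) :
  (forall i, P i -> U (F i)) -> U (\sum_(i <- r | P i) F i).
Proof. by move=> h; elim/big_ind: _ => //; [exact: U_lin.1 | exact: linclosedD]. Qed.

Lemma linclosed_sum_seq (I : eqType) (r : seq I) (F : I -> V) :
  (forall i, i \in r -> U (F i)) -> U (\sum_(i <- r) F i).
Proof. by move=> h; rewrite big_seq; apply: linclosed_sum. Qed.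

End LinClosed.

Section Separation.
Local Open Scope classical_set_scope.
Local Open Scope ring_scope.

(** By Zorn there is a largest subspace X containing U and avoiding v. Maximality forces every w to
    lie in X + K v, and [lam w] is the coefficient of v. *)
Lemma functional_sep (K : fieldType) (V : lmodType K) (U : V -> Prop) (v : V) :
  linclosed U -> ~ U v ->
  exists lam : {scalar V}, lam v = 1 /\ forall u, U u -> lam u = 0.
Proof.
move=> [U0 Ulin] nUv.
(* Neither 0 in X nor U inside X is required, since the union of the empty chain is empty; a maximal
   X absorbs U afterwards ([XU]). *)
pose P : set (set V) := fun X =>
  (forall a u w, X u -> X w -> X (a *: u + w)) /\
  forall x u, X x -> U u -> x + u <> v.
have [F FP tot|X [[Xlin Xv] Xmax]] := @Zorn_bigcup V P.
  split=> [a u w [X FX Xu] [Y FY Yw]|x u [X FX Xx]].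
  - have [XY|YX] := tot X Y FX FY.
      by exists Y => //; apply: (FP _ FY).1 => //; apply: XY.
    by exists X => //; apply: (FP _ FX).1 => //; apply: YX.
  - exact: (FP _ FX).2.
have UD u w : U u -> U w -> U (u + w) by move=> *; rewrite -[u]scale1r; apply: Ulin.
have maxX (B : set V) : X `<=` B -> P B -> B `<=` X.
  by move=> XB PB; apply: contrapT => nBX; apply: (Xmax B).
have XU : [set y | exists x u, [/\ X x \/ x = 0, U u & y = x + u]] `<=` X.
  apply: maxX => [x Xx|].
    by exists x, 0; rewrite addr0; split=> //; left.
  split=> [a _ _ [x [u [hx hu ->]]] [y [w [hy hw ->]]]|_ w [x [u [hx hu ->]]] hw].
    exists (a *: x + y), (a *: u + w); split; last by rewrite scalerDr addrACA.
      case: hx => [hx|->]; case: hy => [hy|->].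
      - by left; apply: Xlin.
      - by left; rewrite addr0; have := Xlin (a - 1) x x hx hx; rewrite scalerBl scale1r subrK.
      - by left; rewrite scaler0 add0r.
      - by right; rewrite scaler0 addr0.
    exact: Ulin.
  case: hx => [hx|->]; first by rewrite -addrA; apply: Xv => //; apply: UD.
  by rewrite add0r => e; apply: nUv; rewrite -e; apply: UD.
have X_U u : U u -> X u.
  by move=> hu; apply: XU; exists 0, u; rewrite add0r; split=> //; right.
have X0 : X 0 by apply: X_U.
have XZ a x : X x -> X (a *: x) by move=> hx; rewrite -[_ *: _]addr0; apply: Xlin.
have nXv : ~ X v by move=> hv; apply: (Xv v 0) => //; rewrite addr0.
have ex w : exists a, X (w - a *: v).
  pose B : set V := fun y => exists x b, X x /\ y = x + b *: w.
  have [PB|nPB] := pselect (P B).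
    exists 0; rewrite scale0r subr0; apply: (maxX B) => // [x Xx|].
      by exists x, 0; rewrite scale0r addr0.
    by exists 0, 1; rewrite add0r scale1r.
  have [x [b [hx e]]] : exists x b, X x /\ x + b *: w = v.
    apply: contrapT => nex; apply: nPB; split.
      move=> a _ _ [x [b [hx ->]]] [y [c [hy ->]]].
      exists (a *: x + y), (a * b + c); split; first exact: Xlin.
      by rewrite scalerDr scalerDl scalerA addrACA.
    move=> _ u [x [b [hx ->]]] hu e; apply: nex; exists (x + u), b.
    rewrite -e addrAC; split=> //; rewrite -[x]scale1r; apply: Xlin => //.
    exact: X_U.
  have b0 : b != 0.
    by apply/eqP => b0; apply: nXv; rewrite -e b0 scale0r addr0.
  exists b^-1; rewrite -e scalerDr scalerA mulVf // scale1r opprD addrCA subrr.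
  by rewrite addr0 -scalerN -scaleN1r scalerA; apply: XZ.
pose lam w := sval (cid (ex w)).
have lamP w : X (w - lam w *: v) by rewrite /lam; case: cid.
have lamU w a : X (w - a *: v) -> lam w = a.
  move=> h; apply/eqP; rewrite -subr_eq0; apply/eqP; apply: contrapT => /eqP ne.
  apply: nXv; have := Xlin (-1) _ _ (lamP w) h.
  rewrite scaleN1r opprB addrA subrK -scalerBl => /(XZ (lam w - a)^-1).
  by rewrite scalerA mulVf // scale1r.
have lamL : linear_for *%R lam.
  move=> a u w; apply: lamU; rewrite scalerDl opprD addrACA -scalerA -scalerBr.
  exact: Xlin.
pose lamM := GRing.isLinear.Build K V K *%R lam lamL.
pose lamH : {scalar V} := HB.pack lam lamM.
exists lamH; split=> [|u hu]; rewrite /lamH /=; apply: lamU.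
  by rewrite scale1r subrr.
by rewrite scale0r subr0; apply: X_U.
Qed.

End Separation.

Lemma functional_eq (K : fieldType) (V : lmodType K) (u v : V) :
  (forall lam : {scalar V}, lam u = lam v) -> u = v.
Proof.
move=> h; apply/eqP; rewrite -subr_eq0; apply/eqP; apply: contrapT => /eqP ne.
have [||lam [h1 _]] := @functional_sep K V (fun w => w = 0) (u - v).
- by split=> // a x y -> ->; rewrite scaler0 addr0.
- exact/eqP.
by move: h1; rewrite linearB h subrr => /esym/eqP; rewrite oner_eq0.
Qed.

Section Tensors.
Variables (K : fieldType) (V W : lmodType K).
Implicit Types (U : lmodType K) (t : tensor V W).

(** Bilinearity as a property of a plain function, so that lambda-terms can be lifted to tensors
    without packing a structure each time. *)
Definition bilin U (beta : V -> W -> U) :=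
  (forall w, linear (beta^~ w)) /\ (forall v, linear (beta v)).

Lemma bilinP U (beta : V -> W -> U) : bilin beta ->
  exists b : {bilinear V -> W -> U}, b =2 beta.
Proof.
move=> h; pose m := bilinear_isBilinear.Build K V W U *:%R *:%R beta h.
by exists (HB.pack_for {bilinear V -> W -> U} beta m).
Qed.

Lemma tlift_eq U (beta gamma : V -> W -> U) t :
  (forall v w, beta v w = gamma v w) -> tensor_lift beta t = tensor_lift gamma t.
Proof. by move=> e; apply: eq_bigr => p _; apply: e. Qed.

Lemma tlift_pure U (beta : V -> W -> U) v w :
  bilin beta -> tensor_lift beta (pure v w) = beta v w.
Proof.
move=> /bilinP[b e]; rewrite -(tlift_eq _ e) -e; exact: lift_pure.
Qed.

Lemma tlift_linear U (beta : V -> W -> U) : bilin beta -> linear (tensor_lift beta).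
Proof.
move=> /bilinP[b e] a s t; rewrite -!(tlift_eq _ e).
by rewrite [LHS](lift_add b (tensor_scale a s) t) (lift_scale b).
Qed.

Lemma tlift0 U (beta : V -> W -> U) : bilin beta -> tensor_lift beta 0 = 0.
Proof. move=> /bilinP[b e]; rewrite -(tlift_eq _ e). exact: (Defs.lift0 b). Qed.

Lemma tliftD U (beta : V -> W -> U) s t : bilin beta ->
  tensor_lift beta (s + t) = tensor_lift beta s + tensor_lift beta t.
Proof. by move=> h; have := tlift_linear h 1 s t; rewrite !scale1r. Qed.

Lemma tliftZ U (beta : V -> W -> U) a t : bilin beta ->
  tensor_lift beta (a *: t) = a *: tensor_lift beta t.
Proof. by move=> h; have := tlift_linear h a t 0; rewrite tlift0 // !addr0. Qed.

Lemma tlift_sum U (beta : V -> W -> U) (I : Type) (r : seq I) (F : I -> tensor V W) :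
  bilin beta ->
  tensor_lift beta (\sum_(i <- r) F i) = \sum_(i <- r) tensor_lift beta (F i).
Proof.
move=> h; elim: r => [|i r IH]; first by rewrite !big_nil tlift0.
by rewrite !big_cons tliftD // IH.
Qed.

Lemma pure_bilin : bilin (@pure K V W).
Proof.
split=> [w|v] a x y; apply: tensorP => U b;
rewrite [RHS](lift_add b (tensor_scale a _) _) (lift_scale b) !lift_pure.
  exact: linearPl.
exact: linearPr.
Qed.

Lemma pureDl v v' w : pure (v + v') w = pure v w + pure v' w :> tensor V W.
Proof. by have := pure_bilin.1 w 1 v v'; rewrite !scale1r. Qed.

Lemma pureDr v w w' : pure v (w + w') = pure v w + pure v w' :> tensor V W.
Proof. by have := pure_bilin.2 v 1 w w'; rewrite !scale1r. Qed.

Lemma pure0l w : pure 0 w = 0 :> tensor V W.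
Proof. by apply: (addrI (pure 0 w)); rewrite -pureDl !addr0. Qed.

Lemma pure0r v : pure v 0 = 0 :> tensor V W.
Proof. by apply: (addrI (pure v 0)); rewrite -pureDr !addr0. Qed.

Lemma pureZl a v w : pure (a *: v) w = a *: pure v w :> tensor V W.
Proof. by have := pure_bilin.1 w a v 0; rewrite pure0l !addr0. Qed.

Lemma pureZr a v w : pure v (a *: w) = a *: pure v w :> tensor V W.
Proof. by have := pure_bilin.2 v a w 0; rewrite pure0r !addr0. Qed.

Lemma tensorE t : t = \sum_(p <- repr t) pure p.1 p.2.
Proof.
apply: tensorP => U b.
have bb : bilin b by split=> [w|v] a x y; [exact: linearPl | exact: linearPr].
by rewrite tlift_sum //; apply: eq_bigr => p _; rewrite lift_pure.
Qed.

Lemma tensor_ind (P : tensor V W -> Prop) :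
  P 0 -> (forall s t, P s -> P t -> P (s + t)) -> (forall v w, P (pure v w)) ->
  forall t, P t.
Proof. by move=> P0 PD Pp t; rewrite [t]tensorE; elim/big_ind: _. Qed.

Lemma scaleV_bilin (lam : {scalar V}) : bilin (fun v w => lam v *: w).
Proof.
split=> [w|v] a x y /=; first by rewrite linearP scalerDl scalerA.
by rewrite scalerDr !scalerA mulrC.
Qed.

Lemma scaleW_bilin (lam : {scalar W}) : bilin (fun v w => lam w *: v).
Proof.
split=> [w|v] a x y /=; last by rewrite linearP scalerDl scalerA.
by rewrite scalerDr !scalerA mulrC.
Qed.

(** Induction on the number of pure tensors. If the first left factor depends on the others, it is
    absorbed into them; otherwise a functional that is 1 on it and 0 on the others shows that its
    right factor vanishes. *)
Lemma tensor_sepl t :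
  (forall lam : {scalar V}, tensor_lift (fun v w => lam v *: w) t = 0) -> t = 0.
Proof.
rewrite [t]tensorE; move: (repr t) => {t} s.
move en : (size s) => n; elim: n s en => [|n IH] [|[v0 w0] s] //=.
  by move=> _ _; rewrite big_nil.
move=> [en] h.
pose U (v : V) := exists al : nat -> K, v = \sum_(i < size s) al i *: (nth (0, 0) s i).1.
have [[al e]|nU] := pselect (U v0).
  set s' := [seq ((nth (0, 0) s i).1, (nth (0, 0) s i).2 + al i *: w0)
              | i <- iota 0 (size s)].
  have es : \sum_(p <- (v0, w0) :: s) pure p.1 p.2 =
            \sum_(p <- s') pure p.1 p.2 :> tensor V W.
    rewrite big_cons /= big_map -[X in iota 0 X]subn0.
    rewrite -/(index_iota 0 (size s)) big_mkord e.
    under [RHS]eq_bigr do rewrite pureDr pureZr -pureZl.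
    rewrite big_split /= addrC; congr (_ + _).
      elim/big_ind2: _ => //; first by rewrite pure0l.
      by move=> ? ? ? ? <- <-; rewrite pureDl.
    by rewrite (big_nth (0, 0)) big_mkord.
  rewrite es; apply: IH; first by rewrite size_map size_iota.
  by move=> lam; rewrite -es.
have [|lam [l1 l0]] := functional_sep _ nU.
  split; first by exists (fun=> 0); rewrite big1 // => i _; rewrite scale0r.
  move=> a _ _ [al ->] [be ->]; exists (fun i => a * al i + be i).
  rewrite scaler_sumr -big_split /=; apply: eq_bigr => i _.
  by rewrite scalerDl scalerA.
have w00 : w0 = 0.
  have := h lam; rewrite tlift_sum; last exact: scaleV_bilin.
  rewrite big_cons tlift_pure /=; last exact: scaleV_bilin.
  rewrite l1 scale1r (big_nth (0, 0)) big_mkord big1 ?addr0 // => i _.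
  rewrite tlift_pure; last exact: scaleV_bilin.
  rewrite l0 ?scale0r //; exists (fun j : nat => (j == i :> nat)%:R).
  rewrite (bigD1 i) //= eqxx scale1r big1 ?addr0 // => j /negbTE.
  by rewrite -val_eqE /= => ->; rewrite scale0r.
rewrite big_cons /= w00 pure0r add0r; apply: IH => // lam'.
by have := h lam'; rewrite big_cons /= w00 pure0r add0r.
Qed.

Lemma functionals_bilin (lam : {scalar V}) (mu : {scalar W}) :
  bilin (fun v w => lam v * mu w : K^o).
Proof.
split=> [w|v] a x y; rewrite linearP; first by rewrite mulrDl /= -mulrA.
by rewrite mulrDr /= mulrCA.
Qed.

(** Pairs of functionals separate tensors. Identities between coproducts are proved through this
    test, which turns them into identities between the operators [D] and [L]. *)
Lemma tensor_eqP (s t : tensor V W) :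
  (forall (lam : {scalar V}) (mu : {scalar W}),
     tensor_lift (fun v w => lam v * mu w : K^o) s =
     tensor_lift (fun v w => lam v * mu w : K^o) t) -> s = t.
Proof.
have bb := functionals_bilin; move=> h; apply/eqP; rewrite -subr_eq0; apply/eqP; apply: tensor_sepl => lam.
apply: functional_eq => mu; rewrite linear0.
suff -> r : mu (tensor_lift (fun v w => lam v *: w) r) =
    tensor_lift (fun v w => lam v * mu w : K^o) r.
  by rewrite tliftD // -scaleN1r tliftZ // h scaleN1r subrr.
elim/tensor_ind: r => [|s' t' IHs IHt|v w].
- by rewrite !tlift0 ?linear0 //; apply: scaleV_bilin.
- by rewrite !tliftD ?linearD ?IHs ?IHt //; apply: scaleV_bilin.
- by rewrite !tlift_pure //; [rewrite linearZ | exact: scaleV_bilin].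
Qed.

End Tensors.

(** * Parity projections *)

Section Parity.
Variables (K : fieldType) (A : superalg K).
Implicit Types (a x y : A) (b c : bool).

Lemma homogZ b k x : x \in homog A b -> k *: x \in homog A b.
Proof.
by move=> xb; have := (homog_submod A b).2 k x 0 xb (homog0 A b); rewrite addr0.
Qed.

Lemma homogB b x y : x \in homog A b -> y \in homog A b -> x - y \in homog A b.
Proof. by move=> hx hy; apply: homogD => //; apply: homogN. Qed.

Lemma prP a : exists p : A * A,
  [/\ p.1 \in homog A false, p.2 \in homog A true & a = p.1 + p.2].
Proof. by have [a0 [a1 [h0 h1 e]]] := homog_decomp a; exists (a0, a1). Qed.

Fact parity_key : unit. Proof. by []. Qed.

(** The components come from a choice in [homog_decomp]; the lock keeps that choice folded, and
    [pr_uniq] is the computation rule. *)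
Definition pr b : A -> A := locked_with parity_key
  (fun a => let p := sval (cid (prP a)) in if b then p.2 else p.1).

Lemma pr_homog b a : pr b a \in homog A b.
Proof. by rewrite /pr !unlock; case: cid => p /= [h0 h1 _]; case: b. Qed.

Lemma pr_sum a : pr false a + pr true a = a.
Proof. by rewrite /pr !unlock; case: cid => p /= [_ _ ->]. Qed.

Lemma pr_uniq a x y : x \in homog A false -> y \in homog A true -> x + y = a ->
  pr false a = x /\ pr true a = y.
Proof.
move=> hx hy e.
have e' : pr false a - x = y - pr true a.
  by apply/eqP; rewrite subr_eq addrAC eq_sym subr_eq addrC e pr_sum.
have h0 : pr false a - x = 0.
  apply: homog_direct; first by apply: homogB => //; apply: pr_homog.
  by rewrite e'; apply: homogB => //; apply: pr_homog.
split; first exact: subr0_eq h0.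
by apply/esym/subr0_eq; rewrite -e'.
Qed.

Lemma pr_linear b : linear (pr b).
Proof.
move=> k x y.
have [h0 h1] : pr false (k *: x + y) = k *: pr false x + pr false y /\
    pr true (k *: x + y) = k *: pr true x + pr true y.
  apply: pr_uniq; first by apply: homogD; [apply: homogZ|]; apply: pr_homog.
    by apply: homogD; [apply: homogZ|]; apply: pr_homog.
  by rewrite addrACA -scalerDr !pr_sum.
by case: b.
Qed.
HB.instance Definition _ b := GRing.isLinear.Build K A A *:%R (pr b) (pr_linear b).

Lemma prB b : {morph pr b : x y / x - y}.
Proof. exact: raddfB. Qed.

Lemma prD b : {morph pr b : x y / x + y}.
Proof. exact: raddfD. Qed.

Lemma prZ b k x : pr b (k *: x) = k *: pr b x.
Proof. exact: linearZ. Qed.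

Lemma pr_id b x : x \in homog A b -> pr b x = x.
Proof.
case: b => hx.
  by have [] := @pr_uniq x 0 x (homog0 A false) hx (add0r x).
by have [] := @pr_uniq x x 0 hx (homog0 A true) (addr0 x).
Qed.

Lemma pr_off b x : x \in homog A (~~ b) -> pr b x = 0.
Proof.
case: b => hx.
  by have [] := @pr_uniq x x 0 hx (homog0 A true) (addr0 x).
by have [] := @pr_uniq x 0 x (homog0 A false) hx (add0r x).
Qed.

Lemma pr_homogE b c x : x \in homog A c -> pr b x = if b == c then x else 0.
Proof.
case: eqP => [<-|/eqP]; first exact: pr_id.
by move=> ne hx; apply: pr_off; case: b c ne hx => [] [].
Qed.

Lemma pr_pr b c x : pr b (pr c x) = if b == c then pr c x else 0.
Proof. exact/pr_homogE/pr_homog. Qed.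

Lemma pr0M x y : pr false (x * y) = pr false x * pr false y + pr true x * pr true y.
Proof.
have [//|||//] := @pr_uniq (x * y)
  (pr false x * pr false y + pr true x * pr true y)
  (pr false x * pr true y + pr true x * pr false y).
- apply: homogD; first exact: (homogM (pr_homog false x) (pr_homog false y)).
  exact: (homogM (pr_homog true x) (pr_homog true y)).
- apply: homogD; first exact: (homogM (pr_homog false x) (pr_homog true y)).
  exact: (homogM (pr_homog true x) (pr_homog false y)).
by rewrite addrACA -mulrDr pr_sum [pr true x * _ + _]addrC -mulrDr pr_sum -mulrDl pr_sum.
Qed.

Lemma pr1M x y : pr true (x * y) = pr false x * pr true y + pr true x * pr false y.
Proof.
apply: (addrI (pr false (x * y))); rewrite pr_sum pr0M addrACA -mulrDr pr_sum.
by rewrite [pr true x * _ + _]addrC -mulrDr pr_sum -mulrDl pr_sum.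
Qed.

(** The parity involution. It lets sign rules be stated for elements that are not homogeneous, as in
    [odd_sg]. *)
Definition sg : A -> A := locked_with parity_key (fun a => pr false a - pr true a).

Lemma sgE a : sg a = pr false a - pr true a.
Proof. by rewrite /sg unlock. Qed.

Lemma sg_linear : linear sg.
Proof. by move=> k x y; rewrite !sgE !(pr_linear _ k x y) scalerBr opprD addrACA. Qed.
HB.instance Definition _ := GRing.isLinear.Build K A A *:%R sg sg_linear.

Lemma sg_homog b x : x \in homog A b -> sg x = (-1) ^+ b *: x.
Proof.
move=> hx; rewrite !sgE !(pr_homogE _ hx); case: b hx => hx /=.
  by rewrite sub0r expr1 scaleN1r.
by rewrite subr0 expr0 scale1r.
Qed.

Lemma sg_homogP b x : x \in homog A b -> sg x \in homog A b.
Proof. by move=> hx; rewrite (sg_homog hx) homogZ. Qed.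

Lemma sgK : involutive sg.
Proof.
move=> x; rewrite !sgE !prB !pr_pr /= subr0 sub0r opprK; exact: pr_sum.
Qed.

Lemma even_comm x y : x \in homog A false -> x * y = y * x.
Proof.
move=> hx; rewrite -[y]pr_sum mulrDl mulrDr.
rewrite (supercomm hx (pr_homog false y)) (supercomm hx (pr_homog true y)).
by rewrite !expr0 !mul1r.
Qed.

Lemma odd_sg x y : x \in homog A true -> x * y = sg y * x.
Proof.
move=> hx; rewrite sgE -{1}[y]pr_sum mulrDr mulrBl.
rewrite (supercomm hx (pr_homog false y)) (supercomm hx (pr_homog true y)).
by rewrite expr0 expr1 mul1r mulN1r.
Qed.

Lemma sg1 : sg 1 = 1.
Proof. by rewrite (sg_homog (homog1 A)) scale1r. Qed.

End Parity.

Section SmorTheory.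
Variables (K : fieldType) (A B : superalg K) (f : smor A B).

Lemma smorM x y : f (x * y) = f x * f y. Proof. exact: rmorphM. Qed.
Lemma smor1 : f 1 = 1. Proof. exact: rmorph1. Qed.
Lemma smor0 : f 0 = 0. Proof. exact: raddf0. Qed.
Lemma smorD x y : f (x + y) = f x + f y. Proof. exact: raddfD. Qed.
Lemma smorB x y : f (x - y) = f x - f y. Proof. exact: raddfB. Qed.
Lemma smorN x : f (- x) = - f x. Proof. exact: raddfN. Qed.
Lemma smorZ k x : f (k *: x) = k *: f x. Proof. exact: linearZ. Qed.
Lemma smorX x n : f (x ^+ n) = f x ^+ n. Proof. exact: rmorphXn. Qed.
Lemma smor_sum (I : Type) (r : seq I) (P : pred I) (F : I -> A) :
  f (\sum_(i <- r | P i) F i) = \sum_(i <- r | P i) f (F i).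
Proof. exact: raddf_sum. Qed.

Lemma smor_pr b a : f (pr b a) = pr b (f a).
Proof.
rewrite -{2}[a]pr_sum smorD prD.
have h c := smor_homog f (pr_homog c a).
by rewrite !(pr_homogE _ (h _)); case: b; rewrite ?add0r ?addr0.
Qed.

End SmorTheory.

(** * The tensor product of superalgebras *)

Lemma tlift_par (K : fieldType) (V W X U : lmodType K) (t : tensor V W)
    (beta : X -> V -> W -> U) :
  (forall v w, linear (fun x => beta x v w)) ->
  linear (fun x => tensor_lift (beta x) t).
Proof.
move=> h k x y; rewrite /tensor_lift /tsum scaler_sumr -big_split /=.
by apply: eq_bigr => p _; apply: h.
Qed.

Lemma mulr_signE (K : fieldType) (B : algType K) (b : bool) (x : B) :
  (-1) ^+ b * x = (-1) ^+ b *: x.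
Proof. by rewrite mulr_sign scaler_sign. Qed.

Section TensorAlgebra.
Variables (K : fieldType) (A R : superalg K).

Lemma tensor_hind (P : tensor A R -> Prop) :
  P 0 -> (forall s t, P s -> P t -> P (s + t)) ->
  (forall b c a r, a \in homog A b -> r \in homog R c -> P (pure a r)) ->
  forall t, P t.
Proof.
move=> P0 PD Pp; apply: tensor_ind => // a r.
rewrite -[a]pr_sum -[r]pr_sum !(pureDl, pureDr).
by do !apply: (PD); apply: (Pp); apply: pr_homog.
Qed.

(** The Koszul sign rule without homogeneity: the odd part of a' passes r at the price of [sg]. This
    form is bilinear by construction, whereas a sign read off from parities is not defined on all
    pairs. *)
Definition tmul_pure (a : A) (r : R) (a' : A) (r' : R) : tensor A R :=
  pure (a * pr false a') (r * r') + pure (a * pr true a') (sg r * r').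

Definition tmul (t u : tensor A R) : tensor A R :=
  tensor_lift (fun a r => tensor_lift (tmul_pure a r) u) t.

Let tmul_pure_bilin a r : bilin (tmul_pure a r).
Proof.
split=> [r'|a'] k x y; rewrite /tmul_pure.
  by rewrite !pr_linear !mulrDr -!scalerAr !pureDl !pureZl scalerDr addrACA.
by rewrite !mulrDr -!scalerAr !pureDr !pureZr scalerDr addrACA.
Qed.

Let tmul_bilin u : bilin (fun a r => tensor_lift (tmul_pure a r) u).
Proof.
split=> [r|a]; apply: tlift_par => a' r' k x y; rewrite /tmul_pure.
  by rewrite !mulrDl -!scalerAl !pureDl !pureZl scalerDr addrACA.
by rewrite sg_linear !mulrDl -!scalerAl !pureDr !pureZr scalerDr addrACA.
Qed.

Lemma tmulDl : left_distributive tmul +%R.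
Proof. by move=> s t u; rewrite /tmul tliftD //; apply: tmul_bilin. Qed.

Lemma tmulDr : right_distributive tmul +%R.
Proof.
move=> s t u; rewrite /tmul /tensor_lift /tsum -big_split /=.
by apply: eq_bigr => p _; apply: tliftD; apply: tmul_pure_bilin.
Qed.

Lemma tmulZl k s t : tmul (k *: s) t = k *: tmul s t.
Proof. by rewrite /tmul tliftZ //; apply: tmul_bilin. Qed.

Lemma tmulZr k s t : tmul s (k *: t) = k *: tmul s t.
Proof.
rewrite /tmul /tensor_lift /tsum scaler_sumr.
by apply: eq_bigr => p _; apply: tliftZ; apply: tmul_pure_bilin.
Qed.

Lemma tmul0l t : tmul 0 t = 0.
Proof. exact: tlift0 (tmul_bilin t). Qed.

Lemma tmul0r t : tmul t 0 = 0.
Proof. by apply: (addrI (tmul t 0)); rewrite -tmulDr !addr0. Qed.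

Lemma tmulE a r a' r' : tmul (pure a r) (pure a' r') = tmul_pure a r a' r'.
Proof. by rewrite /tmul !tlift_pure. Qed.

Lemma tmulH b c a r a' r' : r \in homog R b -> a' \in homog A c ->
  tmul (pure a r) (pure a' r') = (-1) ^+ (b && c) *: pure (a * a') (r * r').
Proof.
move=> hr ha; rewrite tmulE /tmul_pure !(pr_homogE _ ha) (sg_homog hr).
case: c ha => ha /=.
  by rewrite andbT mulr0 pure0l add0r -scalerAl pureZr.
by rewrite andbF mulr0 pure0l addr0 expr0 scale1r.
Qed.

Lemma tmulA : associative tmul.
Proof.
move=> s t u.
elim/tensor_hind: s => [|s s' IH IH'|b c x p hx hp].
- by rewrite !tmul0l.
- by rewrite !tmulDl IH IH'.
elim/tensor_hind: t => [|t t' IH IH'|b' c' y q hy hq].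
- by rewrite !(tmul0l, tmul0r).
- by rewrite !(tmulDl, tmulDr) IH IH'.
elim/tensor_hind: u => [|t t' IH IH'|b'' c'' z r hz hr].
- by rewrite !(tmul0l, tmul0r).
- by rewrite !(tmulDl, tmulDr) IH IH'.
rewrite (tmulH _ _ hq hz) (tmulH _ _ hp hy) tmulZl tmulZr.
rewrite (tmulH _ _ hp (homogM hy hz)) (tmulH _ _ (homogM hp hq) hz) !mulrA.
by rewrite !scalerA -!signr_addb; congr ((-1) ^+ nat_of_bool _ *: _);
  case: c c' b' b'' {hp hq hy hz} => [] [] [] [].
Qed.

Lemma tmul1l : left_id (pure 1 1) tmul.
Proof.
move=> t; elim/tensor_hind: t => [|t t' IH IH'|b c x p hx hp].
- by rewrite !tmul0r.
- by rewrite tmulDr IH IH'.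
by rewrite (tmulH _ _ (homog1 R) hx) scale1r !mul1r.
Qed.

Lemma tmul1r : right_id (pure 1 1) tmul.
Proof.
move=> t; elim/tensor_hind: t => [|t t' IH IH'|b c x p hx hp].
- by rewrite !tmul0l.
- by rewrite tmulDl IH IH'.
by rewrite (tmulH _ _ hp (homog1 A)) andbF scale1r !mulr1.
Qed.

Lemma tmul_nz : pure 1 1 != 0 :> tensor A R.
Proof.
apply/eqP => e.
have sep (B : superalg K) : exists lam : {scalar B}, lam 1 = 1.
  have [||lam [h _]] := @functional_sep K B (fun x => x = 0) 1.
  - by split=> // k x y -> ->; rewrite scaler0 addr0.
  - by apply/eqP; rewrite oner_eq0.
  by exists lam.
have [lam l1] := sep A; have := congr1 (tensor_lift (fun v w => lam v *: w)) e.
rewrite tlift_pure ?tlift0; try exact: scaleV_bilin.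
by rewrite l1 scale1r; apply/eqP; rewrite oner_eq0.
Qed.

Definition talg : Type := tensor A R.
HB.instance Definition _ := GRing.Lmodule.on talg.
HB.instance Definition _ := GRing.Zmodule_isNzRing.Build talg
  tmulA tmul1l tmul1r tmulDl tmulDr tmul_nz.
HB.instance Definition _ := GRing.Lmodule_isLalgebra.Build K talg
  (fun k s t => esym (tmulZl k s t)).
HB.instance Definition _ := GRing.Lalgebra_isAlgebra.Build K talg
  (fun k s t => esym (tmulZr k s t)).

Definition tpr b (t : tensor A R) : tensor A R :=
  tensor_lift (fun a r => pure (pr false a) (pr b r) + pure (pr true a) (pr (~~ b) r)) t.

Let tpr_bilin b : bilin (fun (a : A) (r : R) =>
  pure (pr false a) (pr b r) + pure (pr true a) (pr (~~ b) r)).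
Proof.
split=> [r|a] k x y; rewrite !pr_linear.
  by rewrite !pureDl !pureZl scalerDr addrACA.
by rewrite !pureDr !pureZr scalerDr addrACA.
Qed.

Let tpr_linear b : linear (tpr b).
Proof. exact/tlift_linear/tpr_bilin. Qed.

Lemma tprH b c d a r : a \in homog A c -> r \in homog R d ->
  tpr b (pure a r) = if b == c (+) d then pure a r else 0.
Proof.
move=> ha hr; rewrite /tpr tlift_pure; last exact: tpr_bilin.
rewrite !(pr_homogE _ ha) !(pr_homogE _ hr).
by case: b c d {ha hr} => [] [] [] /=; rewrite ?(pure0l, pure0r) ?addr0 ?add0r.
Qed.

Lemma tprD b s t : tpr b (s + t) = tpr b s + tpr b t.
Proof. by have := tpr_linear b 1 s t; rewrite !scale1r. Qed.

Lemma tpr0 b : tpr b 0 = 0.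
Proof. exact/tlift0/tpr_bilin. Qed.

Lemma tpr_tpr b c t : tpr b (tpr c t) = if b == c then tpr c t else 0.
Proof.
elim/tensor_hind: t => [|s t IH IH'|d e x p hx hp].
- by rewrite !tpr0; case: ifP.
- by rewrite !tprD IH IH'; case: ifP; rewrite ?addr0.
rewrite (tprH c hx hp); case: (c =P d (+) e) => [->|_]; first by rewrite (tprH _ hx hp).
by rewrite tpr0; case: ifP.
Qed.

Definition thomog b : {pred talg} := [pred t | tpr b t == t].

Lemma thomog_submod b : submod_closed (thomog b).
Proof.
split=> [|k s t]; rewrite !inE ?tpr0 // => /eqP hs /eqP ht.
by rewrite tpr_linear hs ht.
Qed.

Lemma tpr_thomog b t : tpr b t \in thomog b.
Proof. by rewrite inE tpr_tpr eqxx. Qed.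

Lemma tpr_sum t : tpr false t + tpr true t = t.
Proof.
elim/tensor_hind: t => [|s t IH IH'|d e x p hx hp].
- by rewrite !tpr0 addr0.
- by rewrite !tprD addrACA IH IH'.
by rewrite !(tprH _ hx hp); case: (d (+) e); rewrite ?addr0 ?add0r.
Qed.

Lemma thomog_decomp (t : talg) : exists a0 a1,
  [/\ a0 \in thomog false, a1 \in thomog true & t = a0 + a1].
Proof.
exists (tpr false t), (tpr true t); split; rewrite ?tpr_thomog //.
by rewrite -{1}[t]tpr_sum.
Qed.

Lemma thomog_direct t : t \in thomog false -> t \in thomog true -> t = 0.
Proof. by rewrite !inE => /eqP <- /eqP <-; rewrite tpr_tpr. Qed.

Lemma thomog_pure b c a r : a \in homog A b -> r \in homog R c ->
  pure a r \in thomog (b (+) c).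
Proof. by move=> ha hr; rewrite inE (tprH _ ha hr) eqxx. Qed.

Lemma thomog_ind b (P : tensor A R -> Prop) :
  P 0 -> (forall s t, P s -> P t -> P (s + t)) ->
  (forall c d a r, c (+) d = b -> a \in homog A c -> r \in homog R d -> P (pure a r)) ->
  forall t, t \in thomog b -> P t.
Proof.
move=> P0 PD Pp t; rewrite inE => /eqP <-.
elim/tensor_hind: t => [|s t IH IH'|d e x p hx hp].
- by rewrite tpr0.
- by rewrite tprD; apply: PD.
rewrite (tprH _ hx hp); case: eqP => // e'; exact: (Pp d e).
Qed.

Lemma thomogM b c (x y : talg) :
  x \in thomog b -> y \in thomog c -> x * y \in thomog (b (+) c).
Proof.
have h0 := thomog_submod (b (+) c).
move=> hx hy; elim/thomog_ind: x / hx => [|s t IH IH'|d e x p db hx hp].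
- by rewrite mul0r; apply: h0.1.
- by rewrite mulrDl -[_ * _]scale1r; apply: h0.2.
elim/thomog_ind: y / hy => [|s t IH IH'|d' e' y q dc hy hq].
- by rewrite mulr0; apply: h0.1.
- by rewrite mulrDr -[_ * _]scale1r; apply: h0.2.
rewrite [_ * _](tmulH _ _ hp hy) -[_ *: _]addr0; apply: h0.2; last exact: h0.1.
rewrite -db -dc addbACA; apply: thomog_pure; exact: homogM.
Qed.

Lemma tsupercomm b c (x y : talg) : x \in thomog b -> y \in thomog c ->
  x * y = (-1) ^+ (b && c) * (y * x).
Proof.
move=> hx hy; elim/thomog_ind: x / hx => [|s t IH IH'|d e x p db hx hp].
- by rewrite mul0r !mulr0.
- by rewrite mulrDl mulrDr IH IH' mulrDr.
elim/thomog_ind: y / hy => [|s t IH IH'|d' e' y q dc hy hq].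
- by rewrite mul0r !mulr0.
- by rewrite mulrDl mulrDr IH IH' mulrDr.
rewrite [_ * _](tmulH _ _ hp hy) [X in _ = _ * X](tmulH _ _ hq hx).
rewrite (supercomm hx hy) (supercomm hp hq) !mulr_signE.
rewrite pureZl pureZr !scalerA -!signr_addb -db -dc.
by congr ((-1) ^+ nat_of_bool _ *: _);
  case: d e d' e' {hx hp hy hq db dc} => [] [] [] [].
Qed.

Definition tsuper : superalg K :=
  @Superalg K talg thomog thomog_submod thomog_decomp thomog_direct
    (thomog_pure (homog1 A) (homog1 R)) thomogM tsupercomm.

End TensorAlgebra.

(** * Group-valued functors *)

Section GroupStructureTheory.
Variables (K : fieldType) (F : sfunctor K) (g : group_structure F).
Implicit Types R S : superalg K.

Lemma gmul_inj R (x : F R) : injective (gmul g x).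
Proof.
move=> y z e; rewrite -[y](gmul1 g) -[z](gmul1 g) -(gmulV g x) -!gmulA.
by rewrite e.
Qed.

Lemma gmulgV R (x : F R) : gmul g x (ginv g x) = gone g R.
Proof.
set y := ginv g x.
rewrite -[LHS](gmul1 g) -{1}(gmulV g y) -gmulA (gmulA g y) gmulV gmul1.
exact: gmulV.
Qed.

Lemma gmulg1 R (x : F R) : gmul g x (gone g R) = x.
Proof. by rewrite -(gmulV g x) gmulA gmulgV gmul1. Qed.

Lemma gone_uniq R (x : F R) : gmul g x x = x -> x = gone g R.
Proof. by move=> e; apply: (@gmul_inj _ x); rewrite e gmulg1. Qed.

Lemma ginv_uniq R (x y : F R) : gmul g x y = gone g R -> y = ginv g x.
Proof. by move=> e; apply: (@gmul_inj _ x); rewrite e gmulgV. Qed.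

Lemma ginvM R (x y : F R) : ginv g (gmul g x y) = gmul g (ginv g y) (ginv g x).
Proof.
apply/esym/ginv_uniq; rewrite -gmulA (gmulA g y) gmulgV gmul1; exact: gmulgV.
Qed.

Lemma gone_nat R S (f : smor R S) : fmap f (gone g R) = gone g S.
Proof. by apply: gone_uniq; rewrite -gmul_nat gmul1. Qed.

Lemma ginv_nat R S (f : smor R S) x : fmap f (ginv g x) = ginv g (fmap f x).
Proof. by apply: ginv_uniq; rewrite -gmul_nat gmulgV gone_nat. Qed.

End GroupStructureTheory.

Section Pullback.
Variables (K : fieldType) (C : superalg K) (F : group_functor K).
Variable theta : forall R, smor C R -> F R.
Hypothesis theta_nat : forall R S (f : smor R S) x,
  theta (smor_comp f x) = fmap f (theta x).
Hypothesis theta_inj : forall R, injective (@theta R).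
Hypothesis thetaM : forall R (x y : smor C R),
  exists z, theta z = gmul F (theta x) (theta y).
Hypothesis theta1 : forall R, exists z : smor C R, theta z = gone F R.
Hypothesis thetaV : forall R (x : smor C R), exists z, theta z = ginv F (theta x).

(** The image of [theta] is a subgroup of each F(R), so the operations can be chosen, and all laws
    and naturality are checked after applying the injective [theta]. It serves both for closed
    subgroups, with [theta] composition with a quotient map, and for the factors, with [theta] a
    bijection onto the points of a known group. *)
Lemma pullback_group : exists g : group_structure (hom_functor C),
  forall R (x y : smor C R), theta (gmul g x y) = gmul F (theta x) (theta y).
Proof.
pose mulC R (x y : hom_functor C R) : hom_functor C R := sval (cid (thetaM x y)).
pose oneC R : hom_functor C R := sval (cid (@theta1 R)).
pose invC R (x : hom_functor C R) : hom_functor C R := sval (cid (thetaV x)).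
have mE R x y : theta (@mulC R x y) = gmul F (theta x) (theta y).
  by rewrite /mulC; case: cid.
have oE R : theta (oneC R) = gone F R by rewrite /oneC; case: cid.
have iE R x : theta (@invC R x) = ginv F (theta x) by rewrite /invC; case: cid.
have mA R : associative (@mulC R) by move=> x y z; apply: theta_inj; rewrite !mE gmulA.
have m1 R : left_id (oneC R) (@mulC R).
  by move=> x; apply: theta_inj; rewrite mE oE gmul1.
have mV R : left_inverse (oneC R) (@invC R) (@mulC R).
  by move=> x; apply: theta_inj; rewrite mE oE iE gmulV.
have mN R S (f : smor R S) x y :
    fmap f (mulC R x y) = mulC S (fmap f x) (fmap f y).
  by apply: theta_inj; rewrite mE !theta_nat mE gmul_nat.
by exists (GroupStructure mA m1 mV mN).
Qed.

End Pullback.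

(** * Building morphisms and quotients of superalgebras *)

Section MkSmor.
Variables (K : fieldType) (A B : superalg K) (f : A -> B).
Hypotheses (f_lin : linear f) (f1 : f 1 = 1) (fM : {morph f : x y / x * y}).
Hypothesis f_homog : forall b x, x \in homog A b -> f x \in homog B b.

Definition mk_lrmorphism : {lrmorphism A -> B} :=
  HB.pack_for {lrmorphism A -> B} f
    (GRing.isLinear.Build K A B *:%R f f_lin)
    (GRing.isMonoidMorphism.Build A B f (conj f1 fM)).

Definition mk_smor : smor A B := @Smor K A B mk_lrmorphism f_homog.

End MkSmor.

(** A morphism may be described by writing an element in terms of generators and copying the
    expression. By linearity, independence of the chosen expression reduces to the single condition
    at 0. *)
Lemma smor_graph (K : fieldType) (A B : superalg K) (Gam : A -> B -> Prop) :
  (forall a, exists b, Gam a b) -> (forall b, Gam 0 b -> b = 0) ->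
  (forall k a a' b b', Gam a b -> Gam a' b' -> Gam (k *: a + a') (k *: b + b')) ->
  Gam 1 1 -> (forall a a' b b', Gam a b -> Gam a' b' -> Gam (a * a') (b * b')) ->
  (forall c a b, a \in homog A c -> Gam a b -> b \in homog B c) ->
  exists f : smor A B, forall a b, Gam a b -> f a = b.
Proof.
move=> tot G0 Glin G1 GM Ghom.
pose f a := sval (cid (tot a)); have fP a : Gam a (f a) by rewrite /f; case: cid.
have fE a b : Gam a b -> f a = b.
  move=> h; apply/eqP; rewrite -subr_eq0; apply/eqP/G0.
  by have := Glin (-1) _ _ _ _ h (fP a); rewrite !scaleN1r addNr addrC.
have fl : linear f by move=> k x y; apply/fE/Glin.
have f1 : f 1 = 1 by apply: fE.
have fM : {morph f : x y / x * y} by move=> x y; apply/fE/GM.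
have fh b x : x \in homog A b -> f x \in homog B b by move=> hx; apply: Ghom (fP x).
by exists (mk_smor fl f1 fM fh).
Qed.

Lemma smor_factor (K : fieldType) (A B C : superalg K) (r : smor A B) (f : smor A C) :
  (forall b, exists a, r a = b) -> (forall a, r a = 0 -> f a = 0) ->
  exists f' : smor B C, smor_comp f' r = f.
Proof.
move=> r_surj rf.
have [|||||| g gE] := @smor_graph K B C (fun b c => exists a, r a = b /\ f a = c).
- by move=> b; have [a <-] := r_surj b; exists (f a), a.
- by move=> c [a [ra <-]]; apply: rf.
- by move=> k _ _ _ _ [a [<- <-]] [a' [<- <-]]; exists (k *: a + a');
    rewrite !smorD !smorZ.
- by exists 1; rewrite !smor1.
- by move=> _ _ _ _ [a [<- <-]] [a' [<- <-]]; exists (a * a'); rewrite !smorM.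
- move=> c b y hb [a [ra fa]]; have e : f (a - pr c a) = 0.
    by apply: rf; rewrite smorB smor_pr ra pr_id // subrr.
  by rewrite -fa -[a](subrK (pr c a)) smorD e add0r; apply/smor_homog/pr_homog.
by exists g; apply: smorP => a; apply: gE; exists a.
Qed.

Section Quotient.
Variables (K : fieldType) (A : superalg K).

(** [sideal_pr] makes the quotient graded, and properness is needed because an [algType] is
    nonzero. *)
Record sideal := Sideal {
  sideal_mem :> A -> Prop;
  sideal_lin : linclosed sideal_mem;
  sideal_mull : forall a x, sideal_mem x -> sideal_mem (a * x);
  sideal_mulr : forall a x, sideal_mem x -> sideal_mem (x * a);
  sideal_pr : forall b x, sideal_mem x -> sideal_mem (pr b x);
  sideal_proper : ~ sideal_mem 1
}.

Variable J : sideal.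

Definition sideal_eqv (x y : A) : bool := `[< J (x - y) >].

Lemma sideal_eqv_refl : reflexive sideal_eqv.
Proof. by move=> x; apply/asboolP; rewrite subrr; apply: (sideal_lin J).1. Qed.

Lemma sideal_eqv_sym : symmetric sideal_eqv.
Proof.
by move=> x y; apply/asbool_equiv_eq; split=> /(linclosedN (sideal_lin J));
  rewrite opprB.
Qed.

Lemma sideal_eqv_trans : transitive sideal_eqv.
Proof.
move=> y x z /asboolP h /asboolP k; apply/asboolP.
by rewrite -[x](subrK y) -addrA; exact: (linclosedD (sideal_lin J) h k).
Qed.

Canonical sideal_equiv :=
  EquivRel sideal_eqv sideal_eqv_refl sideal_eqv_sym sideal_eqv_trans.

Definition qalg : Type := {eq_quot sideal_equiv}.
HB.instance Definition _ := Choice.on qalg.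
HB.instance Definition _ := EqQuotient.on qalg.

Definition qproj (x : A) : qalg := \pi_qalg x.

Lemma qproj_eq x y : qproj x = qproj y <-> J (x - y).
Proof. by split=> [/eqquotP/asboolP|h] //; apply/eqquotP/asboolP. Qed.

Lemma qreprK (u : qalg) : qproj (repr u) = u.
Proof. exact: reprK. Qed.

Lemma qreprJ x : J (repr (qproj x) - x).
Proof. by apply/qproj_eq; rewrite qreprK. Qed.

Definition qadd (u v : qalg) := qproj (repr u + repr v).
Definition qopp (u : qalg) := qproj (- repr u).
Definition qscale k (u : qalg) := qproj (k *: repr u).
Definition qmul (u v : qalg) := qproj (repr u * repr v).

Lemma qaddE x y : qadd (qproj x) (qproj y) = qproj (x + y).
Proof.
apply/qproj_eq; rewrite opprD addrACA.
exact: (linclosedD (sideal_lin J) (qreprJ x) (qreprJ y)).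
Qed.

Lemma qoppE x : qopp (qproj x) = qproj (- x).
Proof. by apply/qproj_eq; rewrite -opprD; exact: (linclosedN (sideal_lin J) (qreprJ x)). Qed.

Lemma qscaleE k x : qscale k (qproj x) = qproj (k *: x).
Proof. by apply/qproj_eq; rewrite -scalerBr; exact: (linclosedZ (sideal_lin J) k (qreprJ x)). Qed.

Lemma qmulE x y : qmul (qproj x) (qproj y) = qproj (x * y).
Proof.
apply/qproj_eq; rewrite -[_ * _](subrK (repr (qproj x) * y)) -mulrBr -addrA -mulrBl.
by apply: (linclosedD (sideal_lin J)); [apply: sideal_mull | apply: sideal_mulr];
  apply: qreprJ.
Qed.

Lemma qind (P : qalg -> Prop) : (forall x, P (qproj x)) -> forall u, P u.
Proof. by move=> h u; rewrite -[u]qreprK. Qed.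

Lemma qaddA : associative qadd.
Proof.
by elim/qind=> x; elim/qind=> y; elim/qind=> z; rewrite !qaddE addrA.
Qed.
Lemma qaddC : commutative qadd.
Proof. by elim/qind=> x; elim/qind=> y; rewrite !qaddE addrC. Qed.
Lemma qadd0 : left_id (qproj 0) qadd.
Proof. by elim/qind=> x; rewrite qaddE add0r. Qed.
Lemma qaddN : left_inverse (qproj 0) qopp qadd.
Proof. by elim/qind=> x; rewrite qoppE qaddE addNr. Qed.
HB.instance Definition _ := GRing.isZmodule.Build qalg qaddA qaddC qadd0 qaddN.

Lemma qscaleA a b t : qscale a (qscale b t) = qscale (a * b) t.
Proof. by elim/qind: t => x; rewrite !qscaleE scalerA. Qed.
Lemma qscale1 : left_id 1 qscale.
Proof. by elim/qind=> x; rewrite qscaleE scale1r. Qed.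
Lemma qscaleDr : right_distributive qscale qadd.
Proof. by move=> a; elim/qind=> x; elim/qind=> y; rewrite !(qscaleE, qaddE) scalerDr. Qed.
Lemma qscaleDl t : {morph qscale^~ t : a b / a + b >-> qadd a b}.
Proof. by elim/qind: t => x a b; rewrite !(qscaleE, qaddE) scalerDl. Qed.
HB.instance Definition _ := GRing.Zmodule_isLmodule.Build K qalg
  qscaleA qscale1 qscaleDr qscaleDl.

Lemma qmulA : associative qmul.
Proof. by elim/qind=> x; elim/qind=> y; elim/qind=> z; rewrite !qmulE mulrA. Qed.
Lemma qmul1l : left_id (qproj 1) qmul.
Proof. by elim/qind=> x; rewrite qmulE mul1r. Qed.
Lemma qmul1r : right_id (qproj 1) qmul.
Proof. by elim/qind=> x; rewrite qmulE mulr1. Qed.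
Lemma qmulDl : left_distributive qmul qadd.
Proof.
by elim/qind=> x; elim/qind=> y; elim/qind=> z; rewrite !(qmulE, qaddE) mulrDl.
Qed.
Lemma qmulDr : right_distributive qmul qadd.
Proof.
by elim/qind=> x; elim/qind=> y; elim/qind=> z; rewrite !(qmulE, qaddE) mulrDr.
Qed.
Lemma q1_neq0 : qproj 1 != qproj 0.
Proof. by apply/eqP => /qproj_eq; rewrite subr0; apply: sideal_proper. Qed.
HB.instance Definition _ := GRing.Zmodule_isNzRing.Build qalg
  qmulA qmul1l qmul1r qmulDl qmulDr q1_neq0.

Lemma qscaleAl k u v : qscale k (qmul u v) = qmul (qscale k u) v.
Proof.
by elim/qind: u => x; elim/qind: v => y; rewrite !(qmulE, qscaleE) scalerAl.
Qed.
HB.instance Definition _ := GRing.Lmodule_isLalgebra.Build K qalg qscaleAl.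

Lemma qscaleAr k u v : qscale k (qmul u v) = qmul u (qscale k v).
Proof.
by elim/qind: u => x; elim/qind: v => y; rewrite !(qmulE, qscaleE) scalerAr.
Qed.
HB.instance Definition _ := GRing.Lalgebra_isAlgebra.Build K qalg qscaleAr.

Definition qhomog b : {pred qalg} := [pred u | `[< J (pr (~~ b) (repr u)) >]].

Lemma qhomogP b u :
  reflect (exists2 x, x \in homog A b & u = qproj x) (u \in qhomog b).
Proof.
apply: (iffP (asboolP _)) => [h|[x hx ->]].
  exists (pr b (repr u)); first exact: pr_homog.
  rewrite -[LHS]qreprK; apply/qproj_eq.
  by case: b h => /= h; rewrite -{1}[repr u]pr_sum ?addrK // addrC addKr.
have := sideal_pr (~~ b) (qreprJ x); rewrite prB.
by rewrite (pr_homogE (~~ b) hx); case: b {hx}; rewrite subr0.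
Qed.

Lemma qhomog_submod b : submod_closed (qhomog b).
Proof.
split=> [|k u v /qhomogP[x hx ->] /qhomogP[y hy ->]]; apply/qhomogP.
  by exists 0 => //; apply: homog0.
exists (k *: x + y); first by apply: homogD => //; apply: homogZ.
by rewrite [k *: _]qscaleE [LHS]qaddE.
Qed.

Lemma qhomog_decomp u : exists a0 a1,
  [/\ a0 \in qhomog false, a1 \in qhomog true & u = a0 + a1].
Proof.
elim/qind: u => x; exists (qproj (pr false x)), (qproj (pr true x)); split.
- by apply/qhomogP; exists (pr false x) => //; apply: pr_homog.
- by apply/qhomogP; exists (pr true x) => //; apply: pr_homog.
- by rewrite [RHS]qaddE pr_sum.
Qed.

Lemma qhomog_direct u : u \in qhomog false -> u \in qhomog true -> u = 0.
Proof.
move=> /asboolP h0 /asboolP h1; rewrite -[u]qreprK; apply/qproj_eq.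
by rewrite subr0 -[repr u]pr_sum; exact: (linclosedD (sideal_lin J) h1 h0).
Qed.

Lemma qhomogM b c (x y : qalg) :
  x \in qhomog b -> y \in qhomog c -> x * y \in qhomog (b (+) c).
Proof.
move=> /qhomogP[x' hx ->] /qhomogP[y' hy ->]; apply/qhomogP.
by exists (x' * y'); [apply: homogM | rewrite [LHS]qmulE].
Qed.

Lemma qsupercomm b c (x y : qalg) : x \in qhomog b -> y \in qhomog c ->
  x * y = (-1) ^+ (b && c) * (y * x).
Proof.
move=> /qhomogP[x' hx ->] /qhomogP[y' hy ->]; rewrite mulr_signE.
rewrite [LHS]qmulE [X in _ = _ *: X]qmulE [RHS]qscaleE (supercomm hx hy).
by rewrite mulr_signE.
Qed.

Lemma qhomog1 : 1 \in qhomog false.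
Proof. by apply/qhomogP; exists 1 => //; apply: homog1. Qed.

Definition qsuper : superalg K := Superalg qhomog_submod qhomog_decomp
  qhomog_direct qhomog1 qhomogM qsupercomm.

Lemma qproj_linear : linear (qproj : A -> qsuper).
Proof. by move=> k x y; rewrite -qaddE -qscaleE. Qed.

Lemma qproj_mul : {morph (qproj : A -> qsuper) : x y / x * y}.
Proof. by move=> x y; rewrite -qmulE. Qed.

Lemma qproj_homog b x : x \in homog A b -> qproj x \in homog qsuper b.
Proof. by move=> hx; apply/qhomogP; exists x. Qed.

Definition qmor : smor A qsuper :=
  mk_smor qproj_linear (erefl : qproj 1 = 1 :> qsuper) qproj_mul qproj_homog.

Lemma qmor_ker x : qmor x = 0 <-> J x.
Proof. by rewrite -[J x]/(J x) -{2}[x]subr0; exact: qproj_eq. Qed.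

Lemma qmor_surj u : exists x, qmor x = u.
Proof. by exists (repr u); apply: qreprK. Qed.

End Quotient.

(** * Translation operators on the coordinate algebra *)

Lemma lin_tlift (K : fieldType) (V W U U' : lmodType K) (f : U -> U')
    (beta : V -> W -> U) (t : tensor V W) : linear f ->
  f (tensor_lift beta t) = tensor_lift (fun v w => f (beta v w)) t.
Proof.
move=> fl; pose fL := HB.pack_for {linear U -> U'} f (GRing.isLinear.Build K U U' *:%R f fl).
exact: (raddf_sum fL).
Qed.

Section TensorMorphisms.
Variables (K : fieldType) (A R : superalg K).

Lemma pureM1 (a a' : A) (r' : R) :
  (pure a 1 : tsuper A R) * pure a' r' = pure (a * a') r'.
Proof.
rewrite [LHS]tmulE /tmul_pure sg1 !mul1r -pureDl -mulrDr; congr (pure (_ * _) _).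
exact: pr_sum.
Qed.

Lemma pureMr1 (a : A) (r r' : R) :
  (pure a r : tsuper A R) * pure 1 r' = pure a (r * r').
Proof.
rewrite [LHS]tmulE /tmul_pure (pr_id (homog1 A)).
by rewrite (pr_off (b := true) (homog1 A)) mulr0 pure0l addr0 mulr1.
Qed.

Lemma tinl_linear : linear (fun a : A => pure a 1 : tsuper A R).
Proof. by move=> k x y; rewrite pureDl pureZl. Qed.

Lemma tinr_linear : linear (fun r : R => pure 1 r : tsuper A R).
Proof. by move=> k x y; rewrite pureDr pureZr. Qed.

Lemma tinl_mul : {morph (fun a : A => pure a 1 : tsuper A R) : x y / x * y}.
Proof. by move=> x y; rewrite /= pureM1. Qed.

Lemma tinr_mul : {morph (fun r : R => pure 1 r : tsuper A R) : x y / x * y}.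
Proof. by move=> x y; rewrite /= pureMr1. Qed.

Lemma tinl_homog b (x : A) : x \in homog A b -> (pure x 1 : tsuper A R) \in homog (tsuper A R) b.
Proof. by move=> hx; rewrite -[b]addbF; apply: thomog_pure hx (homog1 R). Qed.

Lemma tinr_homog b (x : R) : x \in homog R b -> (pure 1 x : tsuper A R) \in homog (tsuper A R) b.
Proof. by move=> hx; rewrite -[b]addFb; apply: thomog_pure (homog1 A) hx. Qed.

Definition tinl : smor A (tsuper A R) :=
  mk_smor tinl_linear (erefl _) tinl_mul tinl_homog.

Definition tinr : smor R (tsuper A R) :=
  mk_smor tinr_linear (erefl _) tinr_mul tinr_homog.

Section Pairing.
Variables (S : superalg K) (p : smor A S) (q : smor R S).

Definition tpair_fun (t : tsuper A R) : S := tensor_lift (fun a r => p a * q r) t.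

Lemma tpair_bilin : bilin (fun a r => p a * q r).
Proof.
split=> [r|a] k x y.
  by rewrite smorD smorZ mulrDl -scalerAl.
by rewrite smorD smorZ mulrDr -scalerAr.
Qed.

Lemma tpair_linear : linear tpair_fun.
Proof. exact/tlift_linear/tpair_bilin. Qed.

Lemma tpair1 : tpair_fun 1 = 1.
Proof. by rewrite /tpair_fun [LHS]tlift_pure ?smor1 ?mulr1 //; exact: tpair_bilin. Qed.

Lemma tpair0 : tpair_fun 0 = 0.
Proof. exact/tlift0/tpair_bilin. Qed.

Lemma tpairD s t : tpair_fun (s + t) = tpair_fun s + tpair_fun t.
Proof. exact/tliftD/tpair_bilin. Qed.

Lemma tpair_mul : {morph tpair_fun : x y / x * y}.
Proof.
move=> s t.
elim/tensor_hind: s => [|s s' IH IH'|b c x u hx hu].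
- by rewrite mul0r tpair0 mul0r.
- by rewrite mulrDl !tpairD IH IH' mulrDl.
elim/tensor_hind: t => [|t t' IH IH'|b' c' y v hy hv].
- by rewrite mulr0 tpair0 mulr0.
- by rewrite mulrDr !tpairD IH IH' mulrDr.
rewrite [_ * _](tmulH _ _ hu hy) {1}/tpair_fun tliftZ; last exact: tpair_bilin.
rewrite /tpair_fun !tlift_pure; try exact: tpair_bilin.
rewrite !smorM -!mulrA scalerAr; congr (_ * _).
rewrite !mulrA (supercomm (smor_homog q hu) (smor_homog p hy)).
by rewrite -!mulrA mulr_signE.
Qed.

Lemma tpair_homog b x : x \in homog (tsuper A R) b -> tpair_fun x \in homog S b.
Proof.
move=> hx; elim/thomog_ind: x / hx => [|s t IH IH'|c d a r db ha hr].
- by rewrite tpair0 homog0.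
- by rewrite tpairD homogD.
rewrite /tpair_fun tlift_pure; last exact: tpair_bilin.
by rewrite -db; apply: homogM; apply: smor_homog.
Qed.

(** The universal property of the coproduct: two points with values in S are one morphism out of the
    tensor product. Super-commutativity of S is what makes it multiplicative. *)
Definition tpair : smor (tsuper A R) S :=
  mk_smor tpair_linear tpair1 tpair_mul tpair_homog.

Lemma tpair_l : smor_comp tpair tinl = p.
Proof.
apply: smorP => a; rewrite [LHS]tlift_pure ?smor1 ?mulr1 //; exact: tpair_bilin.
Qed.

Lemma tpair_r : smor_comp tpair tinr = q.
Proof.
apply: smorP => a; rewrite [LHS]tlift_pure ?smor1 ?mul1r //; exact: tpair_bilin.
Qed.

End Pairing.
End TensorMorphisms.

Section UnitMorphism.
Variables (K : fieldType) (R : superalg K).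

Lemma unit_linear : linear (fun k : base_superalg K => (k : K)%:A : R).
Proof. by move=> k x y; rewrite scalerDl scalerA. Qed.

Lemma unit_mul : {morph (fun k : base_superalg K => (k : K)%:A : R) : x y / x * y}.
Proof. by move=> x y; rewrite -scalerAl mul1r scalerA. Qed.

Lemma unit_homog b (x : base_superalg K) :
  x \in homog (base_superalg K) b -> (x : K)%:A \in homog R b.
Proof.
case: b => [/eqP ->|_]; first by rewrite scale0r homog0.
exact/homogZ/homog1.
Qed.

Definition unit_smor : smor (base_superalg K) R :=
  mk_smor unit_linear (scale1r 1) unit_mul unit_homog.
End UnitMorphism.

Section Comultiplication.
Variables (K : fieldType) (G : supergroup K).
Local Notation A := (Defs.coord G).

Fact hopf_key : unit. Proof. by []. Qed.

(** Yoneda: the product of the two universal points of G over K[G] (x) K[G]. The value on any pair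
    of points follows by naturality ([gmulE]). *)
Definition comul : smor A (tsuper A A) :=
  locked_with hopf_key (gmul G (tinl A A : G _) (tinr A A : G _)).

Definition eps : A -> K := locked_with hopf_key (counit G : A -> K).

Lemma epsE a : eps a = counit G a. Proof. by rewrite /eps unlock. Qed.

Lemma eps_linear : linear_for *%R eps.
Proof. by move=> k x y; rewrite !epsE; exact: (linearP (counit G)). Qed.
HB.instance Definition _ := GRing.isLinear.Build K A K *%R eps eps_linear.

Lemma eps_mul : monoid_morphism eps.
Proof. by split=> [|x y]; rewrite !epsE; [exact: (smor1 (counit G)) | exact: (smorM (counit G))]. Qed.
HB.instance Definition _ := GRing.isMonoidMorphism.Build A K eps eps_mul.

Lemma eps_odd a : a \in homog A true -> eps a = 0.
Proof. by rewrite epsE => /(smor_homog (counit G)) /eqP. Qed.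

Lemma eps_pr1 a : eps (pr true a) = 0.
Proof. exact/eps_odd/pr_homog. Qed.

Lemma eps_pr0 a : eps (pr false a) = eps a.
Proof. by rewrite -[in RHS](pr_sum a) raddfD /= eps_pr1 addr0. Qed.

Lemma eps_sg a : eps (sg a) = eps a.
Proof. by rewrite sgE raddfB /= eps_pr1 eps_pr0 subr0. Qed.

Lemma gmulE (R : superalg K) (p q : smor A R) (a : A) :
  (gmul G (p : G R) (q : G R) : smor A R) a =
  tensor_lift (fun x y => p x * q y) (comul a).
Proof.
have := gmul_nat G (tpair p q) (tinl A A : G _) (tinr A A : G _).
by rewrite /comul unlock /= tpair_l tpair_r => <-.
Qed.

Lemma goneE (R : superalg K) (a : A) : (gone G R : smor A R) a = (eps a)%:A.
Proof. by rewrite epsE; have <- := gone_nat G (unit_smor R). Qed.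

(* [D u = (id (x) u) o Delta] and [L u = (u (x) id) o Delta].  An operator that
   commutes with every [L v] is [D] of its composite with the counit ([linvE]);
   coassociativity is used through this fact only. *)
Definition rgt (u : A -> K) (t : tensor A A) : A := tensor_lift (fun x y => u y *: x) t.
Definition lft (u : A -> K) (t : tensor A A) : A := tensor_lift (fun x y => u x *: y) t.
Definition D (u : A -> K) (a : A) : A := rgt u (comul a).
Definition L (u : A -> K) (a : A) : A := lft u (comul a).

Lemma comul_linear : linear comul. Proof. exact: (linearP comul). Qed.

Section OperatorLinear.
Variable u : {scalar A}.

Lemma rgt_linear : linear (rgt u).
Proof. exact/tlift_linear/scaleW_bilin. Qed.
Lemma lft_linear : linear (lft u).
Proof. exact/tlift_linear/scaleV_bilin. Qed.
HB.instance Definition _ := GRing.isLinear.Build K (tensor A A) A *:%R (rgt u) rgt_linear.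
HB.instance Definition _ := GRing.isLinear.Build K (tensor A A) A *:%R (lft u) lft_linear.

Lemma D_linear : linear (D u).
Proof. by move=> k x y; rewrite /D comul_linear rgt_linear. Qed.
Lemma L_linear : linear (L u).
Proof. by move=> k x y; rewrite /L comul_linear lft_linear. Qed.
HB.instance Definition _ := GRing.isLinear.Build K A A *:%R (D u) D_linear.
HB.instance Definition _ := GRing.isLinear.Build K A A *:%R (L u) L_linear.

Lemma rgt_pure a b : rgt u (pure a b) = u b *: a.
Proof. exact/tlift_pure/scaleW_bilin. Qed.
Lemma lft_pure a b : lft u (pure a b) = u a *: b.
Proof. exact/tlift_pure/scaleV_bilin. Qed.

End OperatorLinear.

Lemma rgt_lft (u v : {scalar A}) t : v (rgt u t) = u (lft v t).
Proof.
elim/tensor_ind: t => [|s t IH IH'|x y].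
- by rewrite !linear0.
- by rewrite !raddfD /= IH IH'.
by rewrite rgt_pure lft_pure !linearZ /= mulrC.
Qed.

Lemma D_L (u v : {scalar A}) a : v (D u a) = u (L v a).
Proof. exact: rgt_lft. Qed.

Lemma D_eps a : D eps a = a.
Proof.
have := congr1 (fun f : smor A A => f a) (gmulg1 G (smor_id A : G _)).
rewrite gmulE /= => {2}<-; apply: tlift_eq => x y.
by rewrite goneE -scalerAr mulr1.
Qed.

Lemma L_eps a : L eps a = a.
Proof.
have := congr1 (fun f : smor A A => f a) (gmul1 G (smor_id A : G _)).
rewrite gmulE /= => {2}<-; apply: tlift_eq => x y.
by rewrite goneE -scalerAl mul1r.
Qed.

Lemma eps_D (u : {scalar A}) a : eps (D u a) = u a.
Proof. by rewrite D_L L_eps. Qed.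

Lemma eps_L (u : {scalar A}) a : eps (L u a) = u a.
Proof. by rewrite -D_L D_eps. Qed.

Lemma D1 (u : {scalar A}) : D u 1 = u 1 *: 1.
Proof. by rewrite /D smor1 [LHS]rgt_pure. Qed.

Lemma L1 (u : {scalar A}) : L u 1 = u 1 *: 1.
Proof. by rewrite /L smor1 [LHS]lft_pure. Qed.

(** Associativity of G for the three universal points over the triple tensor product. *)
Lemma comul_coassoc (a : A) :
  tensor_lift (fun x y => pure (comul x : tsuper A A) y) (comul a) =
  tensor_lift (fun x y =>
    tensor_lift (fun b c => pure (pure x b : tsuper A A) c) (comul y)) (comul a)
  :> tensor (tsuper A A) A.
Proof.
pose B2 := tsuper A A; pose B3 := tsuper B2 A.
pose j1 : G B3 := smor_comp (tinl B2 A) (tinl A A).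
pose j2 : G B3 := smor_comp (tinl B2 A) (tinr A A).
pose j3 : G B3 := tinr B2 A.
have := congr1 (fun f : smor A B3 => f a) (gmulA G j1 j2 j3).
rewrite !gmulE => /esym e; apply: etrans (etrans e _); apply: tlift_eq => x y.
  have <- := gmul_nat G (tinl B2 A) (tinl A A : G _) (tinr A A : G _).
  rewrite /comul unlock.
  by rewrite /= [RHS]pureM1 mulr1.
rewrite gmulE (lin_tlift (f := fun t : B3 => j1 x * t)).
  apply: tlift_eq => b c; rewrite /= !pureM1 !mulr1.
  by congr (pure _ _); rewrite [LHS]pureM1 mulr1.
by move=> k s t; rewrite mulrDr -scalerAr.
Qed.

(** Both sides contract the outer factors of the twofold coproduct, the first one with [v] and the
    last one with [u], and leave the middle factor. *)
Lemma DL_comm (u v : {scalar A}) a : D u (L v a) = L v (D u a).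
Proof.
pose T (t : tensor (tsuper A A) A) : A := tensor_lift (fun s y => u y *: lft v s) t.
have Tb : bilin (fun (s : tsuper A A) y => u y *: lft v s).
  split=> [y|s] k x z; first by rewrite lft_linear scalerDr !scalerA mulrC.
  by rewrite linearP scalerDl scalerA.
have Tl : linear T by exact: tlift_linear.
have := congr1 T (comul_coassoc a).
rewrite !(lin_tlift _ _ Tl) => e; symmetry.
transitivity (tensor_lift (fun x y => T (pure (comul x : tsuper A A) y)) (comul a)).
  rewrite /D /rgt (lin_tlift _ _ (L_linear v)); apply: tlift_eq => x y.
  by rewrite /T tlift_pure // -[LHS]/(L v _) linearZ.
rewrite e /L /lft (lin_tlift _ _ (D_linear u)); apply: tlift_eq => x y.
rewrite (lin_tlift _ _ Tl) linearZ /=.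
rewrite /D /rgt (lin_tlift (f := *:%R (v x))).
  by apply: tlift_eq => b c; rewrite /T tlift_pure // lft_pure !scalerA mulrC.
by move=> k b c; rewrite scalerDr !scalerA mulrC.
Qed.

Definition linv (O : A -> A) := forall (v : {scalar A}) a, O (L v a) = L v (O a).

Lemma linvE (O : {linear A -> A}) : linv O -> O =1 D (eps \o O).
Proof.
move=> h a; apply: functional_eq => v.
by rewrite (D_L (eps \o O) v) /= h eps_L.
Qed.

Lemma linv_D (u : {scalar A}) : linv (D u). Proof. by move=> v a; apply: DL_comm. Qed.

Lemma linv_comp O O' : linv O -> linv O' -> linv (O \o O').
Proof. by move=> h h' v a; rewrite /= h' h. Qed.

Lemma linv_eq (O O' : {linear A -> A}) : linv O -> linv O' ->
  (forall a, eps (O a) = eps (O' a)) -> O =1 O'.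
Proof.
move=> h h' e a; rewrite (linvE h) (linvE h').
by apply: tlift_eq => x y; rewrite /= e.
Qed.

Lemma D_parity (u : {scalar A}) b c a : (forall x, x \in homog A (~~ c) -> u x = 0) ->
  a \in homog A b -> D u a \in homog A (b (+) c).
Proof.
move=> hu /(smor_homog comul) ha; rewrite /D.
elim/thomog_ind: (comul a) / ha => [|s t IH IH'|d e x y <- hx hy].
- by rewrite linear0 homog0.
- by rewrite raddfD homogD.
rewrite rgt_pure; have [<-|ne] := eqVneq e c; first by rewrite addbK homogZ.
by rewrite hu ?scale0r ?homog0 //; case: e c hy ne {hu} => [] [].
Qed.

Lemma L_parity (u : {scalar A}) b c a : (forall x, x \in homog A (~~ c) -> u x = 0) ->
  a \in homog A b -> L u a \in homog A (b (+) c).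
Proof.
move=> hu /(smor_homog comul) ha; rewrite /L.
elim/thomog_ind: (comul a) / ha => [|s t IH IH'|d e x y <- hx hy].
- by rewrite linear0 homog0.
- by rewrite raddfD homogD.
rewrite lft_pure; have [<-|ne] := eqVneq d c; first by rewrite addbAC addbb addFb homogZ.
by rewrite hu ?scale0r ?homog0 //; case: d c hx ne {hu} => [] [].
Qed.

Lemma tlift_functionals (u v : {scalar A}) a :
  tensor_lift (fun x y => u x * v y : K^o) (comul a) = u (D v a).
Proof.
rewrite /D /rgt (lin_tlift (f := u : A -> K^o)); last exact: linearP.
by apply: tlift_eq => x y; rewrite linearZ mulrC.
Qed.

Lemma D_comp (u v : {scalar A}) a : D u (D v a) = D (u \o D v) a.
Proof.
apply: (@linv_eq (D u \o D v) (D (u \o D v))).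
- by apply: linv_comp; apply: linv_D.
- exact: linv_D.
- by move=> b; rewrite /= !eps_D.
Qed.

Record odd_der (x : A -> K) : Prop := OddDer {
  od_even : forall a, a \in homog A false -> x a = 0;
  od_mul : forall a b, x (a * b) = x a * eps b + eps a * x b
}.

Section OddDerivations.
Variables (x : {scalar A}) (xd : odd_der x).

Lemma od_sg a : x (sg a) = - x a.
Proof.
rewrite sgE raddfB /= (od_even xd (pr_homog false a)) sub0r; congr (- _).
by rewrite -{2}[a]pr_sum raddfD /= (od_even xd (pr_homog _ _)) add0r.
Qed.

Lemma od_pr1 a : x (pr true a) = x a.
Proof. by rewrite -{2}[a]pr_sum raddfD /= (od_even xd (pr_homog _ _)) add0r. Qed.

Lemma od_D_homog b a : a \in homog A b -> D x a \in homog A (~~ b).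
Proof. by move=> ha; rewrite -addbT; apply: D_parity => //; apply: od_even. Qed.

Lemma od_L_homog b a : a \in homog A b -> L x a \in homog A (~~ b).
Proof. by move=> ha; rewrite -addbT; apply: L_parity => //; apply: od_even. Qed.

Lemma od_1 : x 1 = 0.
Proof. exact: (od_even xd (homog1 A)). Qed.

Lemma rgtM (s t : tsuper A A) :
  rgt x (s * t) = rgt eps s * rgt x t + rgt x s * sg (rgt eps t).
Proof.
elim/tensor_ind: s => [|s s' IH IH'|a b].
- by rewrite mul0r !linear0 !mul0r addr0.
- by rewrite mulrDl !raddfD /= IH IH' !mulrDl addrACA.
elim/tensor_ind: t => [|t t' IH IH'|a' b'].
- by rewrite mulr0 !linear0 !mulr0 addr0.
- by rewrite mulrDr !raddfD /= IH IH' !mulrDr addrACA.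
rewrite [_ * _]tmulE /tmul_pure raddfD /= !rgt_pure !(od_mul xd) eps_sg od_sg.
rewrite mulNr [sg (_ *: _)]linearZ /= sgE -!scalerAl -!scalerAr !scalerA.
rewrite -{3}[a']pr_sum mulrDr mulrBr scalerBr !scalerDr !scalerDl scaleNr.
by rewrite addrACA addrC.
Qed.

Lemma lftM (s t : tsuper A A) :
  lft x (s * t) = lft x s * lft eps t + sg (lft eps s) * lft x t.
Proof.
elim/tensor_ind: s => [|s s' IH IH'|a b].
- by rewrite mul0r !linear0 !mul0r addr0.
- by rewrite mulrDl !raddfD /= IH IH' !mulrDl addrACA.
elim/tensor_ind: t => [|t t' IH IH'|a' b'].
- by rewrite mulr0 !linear0 !mulr0 addr0.
- by rewrite mulrDr !raddfD /= IH IH' !mulrDr addrACA.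
rewrite [_ * _]tmulE /tmul_pure raddfD /= !lft_pure !(od_mul xd) eps_pr0 eps_pr1.
rewrite od_pr1 (od_even xd (pr_homog false a')) !mulr0 addr0 add0r.
by rewrite [sg (_ *: _)]linearZ /= -!scalerAl -!scalerAr !scalerA.
Qed.

(** [D x] contracts the right tensor factor, so x has to pass b and the sign falls on the second
    argument. For [L x] it falls on the first. *)
Lemma od_DM a b : D x (a * b) = a * D x b + D x a * sg b.
Proof. by rewrite /D smorM rgtM -!/(D _ _) !D_eps. Qed.

Lemma od_LM a b : L x (a * b) = L x a * b + sg a * L x b.
Proof. by rewrite /L smorM lftM -!/(L _ _) !L_eps. Qed.

End OddDerivations.
End Comultiplication.

(** * Powers of the ideal generated by the odd part *)

Section Span.
Variables (K : fieldType) (V : lmodType K) (S : V -> Prop).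

(** The intersection of all subspaces containing S. Membership is itself the induction principle: it
    is used by instantiating U with the property to prove, whose linearity usually comes from
    [lin_pre]. *)
Definition span_of (v : V) := forall U, linclosed U -> (forall s, S s -> U s) -> U v.

Lemma span_lin : linclosed span_of.
Proof.
split=> [U hU _|a u v hu hv U hU hS]; first exact: hU.1.
by apply: hU.2; [apply: hu | apply: hv].
Qed.

Lemma span_mem s : S s -> span_of s.
Proof. by move=> hs U _; apply. Qed.

End Span.

Section OddIdeal.
Variables (K : fieldType) (A : superalg K).
Implicit Types a b p q : A.

Fixpoint Ip (m : nat) : A -> Prop :=
  if m is m'.+1
  then span_of (fun a => exists p q, [/\ Ip m' p, q \in homog A true & a = p * q])
  else fun=> True.

Lemma Ip_lin m : linclosed (Ip m).
Proof. by case: m => [|m] //; apply: span_lin. Qed.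

Lemma Ip_mem m p q : Ip m p -> q \in homog A true -> Ip m.+1 (p * q).
Proof. by move=> hp hq; apply: span_mem; exists p, q. Qed.

Lemma lin_pre (V W : lmodType K) (f : V -> W) (U : W -> Prop) :
  linear f -> linclosed U -> linclosed (fun v => U (f v)).
Proof.
move=> fl hU; split; last by move=> k u v hu hv; rewrite fl; apply: hU.2.
have -> : f 0 = 0; last exact: hU.1.
by have := fl (-1) 0 0; rewrite scaler0 addr0 scaleN1r addNr.
Qed.

Lemma mulrl_linear a : linear (fun b => a * b).
Proof. by move=> k x y; rewrite mulrDr scalerAr. Qed.

Lemma mulrr_linear a : linear (fun b => b * a).
Proof. by move=> k x y; rewrite mulrDl scalerAl. Qed.

Lemma Ip_mull m a b : Ip m a -> Ip m (b * a).
Proof.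
elim: m a => [//|m IH] a h; apply: (h (fun a => Ip m.+1 (b * a))).
  exact: (lin_pre (mulrl_linear b) (Ip_lin m.+1)).
by move=> _ [p [q [hp hq ->]]]; rewrite mulrA; apply: Ip_mem => //; apply: IH.
Qed.

Lemma Ip_mulr m a b : Ip m a -> Ip m (a * b).
Proof.
elim: m a b => [//|m IH] a b h; apply: (h (fun a => Ip m.+1 (a * b))).
  exact: (lin_pre (mulrr_linear b) (Ip_lin m.+1)).
move=> _ [p [q [hp hq ->]]]; rewrite -mulrA (odd_sg _ hq) mulrA.
by apply: Ip_mem => //; apply: IH.
Qed.

Lemma Ip_odd a : a \in homog A true -> Ip 1 a.
Proof. by move=> ha; rewrite -[a]mul1r; apply: Ip_mem. Qed.

Lemma IpS m a : Ip m.+1 a -> Ip m a.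
Proof.
by move=> h; apply: (h (Ip m)); [apply: Ip_lin | move=> _ [p [q [hp hq ->]]]; apply: Ip_mulr].
Qed.

Lemma Ip_le m n a : (m <= n)%N -> Ip n a -> Ip m a.
Proof.
by move=> /subnK <-; elim: (n - m)%N => [//|k IH] h; apply/IH/IpS.
Qed.

Lemma IpM m n a b : Ip m a -> Ip n b -> Ip (m + n) (a * b).
Proof.
move=> ha; elim: n b => [|n IH] b; first by rewrite addn0 => _; apply: Ip_mulr.
move=> h; apply: (h (fun b => Ip (m + n.+1) (a * b))).
  exact: (lin_pre (mulrl_linear a) (Ip_lin _)).
by move=> _ [p [q [hp hq ->]]]; rewrite addnS mulrA; apply: Ip_mem => //; apply: IH.
Qed.

End OddIdeal.

Lemma smor_Ip (K : fieldType) (A B : superalg K) (f : smor A B) m a :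
  Ip m a -> Ip m (f a).
Proof.
elim: m a => [//|m IH] a h; apply: (h (fun a => Ip m.+1 (f a))).
  by apply: (lin_pre _ (Ip_lin B m.+1)) => k x y; rewrite smorD smorZ.
by move=> _ [p [q [hp hq ->]]]; rewrite smorM; apply: Ip_mem;
  [apply: IH | apply: smor_homog].
Qed.

Lemma purely_even_Ip1 (K : fieldType) (B : superalg K) (b : B) :
  purely_even B -> Ip 1 b -> b = 0.
Proof.
move=> pe h; apply: (h (fun b => b = 0)); first by split=> // k u v -> ->; rewrite scaler0 addr0.
by move=> _ [p [q [_ /pe -> ->]]]; rewrite mulr0.
Qed.

Lemma purely_even_comm (K : fieldType) (B : superalg K) (x y : B) :
  purely_even B -> x * y = y * x.
Proof.
move=> pe; apply: even_comm; rewrite -[x]pr_sum (pe (pr true x)) ?pr_homog //.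
by rewrite addr0 pr_homog.
Qed.

Section Translations.
Variables (K : fieldType) (G : supergroup K).
Local Notation A := (Defs.coord G).

Lemma Ip_D (x : {scalar A}) m a : odd_der x -> Ip m.+1 a -> Ip m (D x a).
Proof.
move=> xd; elim: m a => [//|m IH] a h; apply: (h (fun a => Ip m.+1 (D x a))).
  exact: (lin_pre (D_linear x) (Ip_lin _ _)).
move=> _ [p [q [hp hq ->]]]; rewrite od_DM //; apply: (linclosedD (Ip_lin _ m.+1)).
  exact: Ip_mulr.
by apply: Ip_mem; [apply: IH | apply: sg_homogP].
Qed.

End Translations.

(** * Odd cotangent space and odd derivations at the identity *)

Section Cotangent.
Variables (K : fieldType) (G : supergroup K).
Local Notation A := (Defs.coord G).

Definition cot0 : A -> Prop := span_of (fun a => exists b c,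
  [/\ b \in homog A false, eps b = 0, c \in homog A true & a = b * c]).

Definition odd_gen d (w : 'I_d -> A) :=
  (forall i, w i \in homog A true) /\
  forall a, a \in homog A true ->
    exists al : 'I_d -> K, cot0 (a - \sum_i al i *: w i).

(** This bounds the dimension of the odd cotangent space by d. Minimality of d is always a separate
    hypothesis, and only then is a generating family a basis. *)
Definition odd_rank d := exists w : 'I_d -> A, odd_gen w.

Lemma cot0_lin : linclosed cot0. Proof. exact: span_lin. Qed.

Lemma od_cot0 (x : A -> K) a : linear_for *%R x -> odd_der x -> cot0 a -> x a = 0.
Proof.
move=> xl xd h; apply: (h (fun a => x a = 0)) => [|_ [b [c [hb eb hc ->]]]].
  split; first by have := xl (-1) 0 0; rewrite scaler0 addr0 mulN1r addNr.
  by move=> k u v eu ev; rewrite xl eu ev mulr0 addr0.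
by rewrite (od_mul xd) eb (od_even xd hb) !mul0r addr0.
Qed.

(** For c even and e odd, c e differs from (eps c) e by an element of A_0^+ A_1. A linear form that
    kills A_0 and A_0^+ A_1 therefore satisfies the Leibniz rule. *)
Lemma od_build (x : {scalar A}) : (forall a, a \in homog A false -> x a = 0) ->
  (forall a, cot0 a -> x a = 0) -> odd_der x.
Proof.
move=> xe xc; split=> // a b.
have x1 c : x c = x (pr true c).
  by rewrite -{1}[c]pr_sum raddfD /= xe ?pr_homog // add0r.
have key c e : c \in homog A false -> e \in homog A true -> x (c * e) = eps c * x e.
  move=> hc he; apply/eqP; rewrite -subr_eq0 -linearZ -raddfB /=; apply/eqP/xc.
  apply: span_mem; exists (c - (eps c)%:A), e; split=> //.
  - by apply: homogB => //; apply/homogZ/homog1.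
  - by rewrite raddfB /= linearZ rmorph1 /= mulr1 subrr.
  - by rewrite mulrBl -scalerAl mul1r.
rewrite x1 pr1M raddfD /= key ?pr_homog // eps_pr0 -x1 addrC; congr (_ + _).
by rewrite -(even_comm _ (pr_homog false b)) key ?pr_homog // eps_pr0 -x1 mulrC.
Qed.

Lemma odd_gen_minimal d (w : 'I_d.+1 -> A) i : odd_gen w ->
  (exists al : 'I_d -> K, cot0 (w i - \sum_j al j *: w (lift i j))) ->
  odd_gen (w \o lift i).
Proof.
move=> [wo wg] [al hi]; split=> [j|a /wg[be hbe]]; first exact: wo.
exists (fun j => be (lift i j) + be i * al j).
have := cot0_lin.2 (be i) _ _ hi hbe.
congr cot0; rewrite (bigD1_ord i) //= scalerBr [LHS]addrC -addrA; congr (_ + _).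
rewrite opprD addrACA addNr add0r -opprD; congr (- _).
rewrite scaler_sumr -big_split /=.
by apply: eq_bigr => j _; rewrite scalerDl scalerA.
Qed.

(** Minimality of d keeps each w_i out of the span of the other w_j and A_0^+ A_1. A functional
    separates it from that span enlarged by all even elements, and [od_build] makes this functional
    a derivation. *)
Lemma dual_odd_ders d (w : 'I_d -> A) : odd_gen w ->
  (forall e, (e < d)%N -> ~ odd_rank e) ->
  exists x : 'I_d -> {scalar A}, (forall i, odd_der (x i)) /\
    forall i j, x i (w j) = (i == j)%:R.
Proof.
case: d w => [|d] w gw dmin; first by exists (fun=> (@eps K G : {scalar A})); split=> - [].
have ex i : exists x : {scalar A}, odd_der x /\ forall j, x (w j) = (i == j)%:R.
  pose U a := exists al : 'I_d -> K, cot0 (pr true a - \sum_j al j *: w (lift i j)).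
  have U_lin : linclosed U.
    split; first by exists (fun=> 0); rewrite linear0 sub0r big1 ?oppr0 => [|j _];
      [exact: cot0_lin.1 | rewrite scale0r].
    move=> k a b [al ha] [be hb]; exists (fun j => k * al j + be j).
    have := cot0_lin.2 k _ _ ha hb; congr cot0.
    rewrite linearP scalerBr addrACA -opprD; congr (_ - _).
    rewrite scaler_sumr -big_split; apply: eq_bigr => j _.
    by rewrite scalerDl scalerA.
  have [||x [x1 x0]] := @functional_sep K A U (w i) => //.
    rewrite /U (pr_id (gw.1 i)) => h; apply: (dmin d) => //.
    by exists (w \o lift i); apply: odd_gen_minimal.
  exists x; split.
    apply: od_build => a ha; apply: x0.
      exists (fun=> 0); rewrite (pr_off (b := true) ha) sub0r big1 ?oppr0 => [|j _];
        [exact: cot0_lin.1 | by rewrite scale0r].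
    exists (fun=> 0); rewrite big1 ?subr0 => [|j _]; last by rewrite scale0r.
    apply: (ha (fun a => cot0 (pr true a))).
      exact: (lin_pre (@pr_linear _ _ true) cot0_lin).
    move=> _ [b [c [hb eb hc ->]]]; rewrite pr_id ?(homogM hb hc) //.
    by apply: span_mem; exists b, c.
  move=> j; case: (unliftP i j) => [k ->|->]; last by rewrite eqxx.
  rewrite (negbTE (neq_lift i k)); apply: x0; exists (fun l => (l == k)%:R).
  rewrite (bigD1 k) //= eqxx scale1r big1 => [|l /negbTE ->]; last by rewrite scale0r.
  rewrite addr0 pr_id ?subrr; [exact: cot0_lin.1 | exact: gw.1].
exists (fun i => sval (cid (ex i))); split=> i; first by case: cid => ? [].
by move=> j; case: cid => ? [].
Qed.

Section DualBasis.
Variables (d : nat) (w : 'I_d -> A) (x : 'I_d -> {scalar A}).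
Hypotheses (gw : odd_gen w) (xd : forall i, odd_der (x i)).
Hypothesis xw : forall i j, x i (w j) = (i == j)%:R.

Lemma od_expand (y : {scalar A}) a : odd_der y -> y a = \sum_j y (w j) * x j a.
Proof.
move=> yd; have od1 (u : {scalar A}) : odd_der u -> u a = u (pr true a).
  by move=> ud; rewrite od_pr1.
have [al hal] := gw.2 _ (pr_homog true a).
have key (u : {scalar A}) : odd_der u -> u a = \sum_j al j * u (w j).
  move=> ud; rewrite od1 //; apply/eqP; rewrite -subr_eq0; apply/eqP.
  rewrite -[RHS](od_cot0 (@linearP _ _ _ _ u) ud hal) raddfB /=.
  by congr (_ - _); rewrite (raddf_sum u) /=; apply: eq_bigr => j _; rewrite linearZ.
rewrite key //; apply: eq_bigr => j _; rewrite mulrC (key (x j)) //.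
rewrite (bigD1 j) //= xw eqxx mulr1 big1 ?addr0 // => k /negbTE ne.
by rewrite xw eq_sym ne mulr0.
Qed.

End DualBasis.
End Cotangent.

(** * Coinvariant odd coordinates *)

Section Coinvariants.
Variables (K : fieldType) (G : supergroup K).
Local Notation A := (Defs.coord G).
Local Notation AA := (tsuper A A).

(** The function of two points (x, y) obtained by evaluating at x^-1 y; in Sweedler form a goes to
    S(a_(1)) (x) a_(2). *)
Definition kappa : smor A AA :=
  gmul G (ginv G (tinl A A : G _)) (tinr A A : G _).

Definition antipode : smor A A := ginv G (smor_id A : G A).

Lemma kappaE a : kappa a = tensor_lift (fun x y => pure (antipode x) y) (comul G a) :> tensor A A.
Proof.
have e : ginv G (tinl A A : G AA) = smor_comp (tinl A A) antipode.
  have := ginv_nat G (tinl A A) (smor_id A : G A); rewrite /= => ->.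
  by rewrite (_ : smor_comp (tinl A A) (smor_id A) = tinl A A) //; apply: smorP.
rewrite /kappa gmulE; apply: tlift_eq => x y.
by rewrite e /= pureM1 mulr1.
Qed.

Lemma mul_kappa a : tpair (smor_id A) (smor_id A) (kappa a) = (eps a)%:A.
Proof.
have := gmul_nat G (tpair (smor_id A) (smor_id A)) (ginv G (tinl A A : G _)) (tinr A A : G _).
rewrite -/kappa ginv_nat /= tpair_l tpair_r => /(congr1 (fun f : smor A A => f a)) /= ->.
by rewrite gmulV goneE.
Qed.

Lemma mul_kappa_inl a :
  tensor_lift (fun x y => tinl A A x * kappa y) (comul G a) = pure 1 a :> tensor A A.
Proof.
have -> : pure 1 a = tinr A A a :> tensor A A by [].
have e : gmul G (tinl A A : G AA) (kappa : G AA) = (tinr A A : G AA).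
  by rewrite /kappa gmulA gmulgV gmul1.
by rewrite -[in RHS]e gmulE.
Qed.

Definition Phi (t : tensor A A) : A :=
  tensor_lift (fun x y => pr false x * pr true y) t.

Lemma Phi_bilin : bilin (fun x y : A => pr false x * pr true y).
Proof.
split=> [y|x] k u v.
  by rewrite pr_linear mulrDl -scalerAl.
by rewrite pr_linear mulrDr -scalerAr.
Qed.

Lemma Phi_linear : linear Phi. Proof. exact/tlift_linear/Phi_bilin. Qed.

Lemma Phi_pure x y : Phi (pure x y) = pr false x * pr true y.
Proof. exact/tlift_pure/Phi_bilin. Qed.

Lemma Phi0 : Phi 0 = 0. Proof. exact/tlift0/Phi_bilin. Qed.
Lemma PhiD s t : Phi (s + t) = Phi s + Phi t. Proof. exact/tliftD/Phi_bilin. Qed.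
Lemma PhiZ k t : Phi (k *: t) = k *: Phi t. Proof. exact/tliftZ/Phi_bilin. Qed.

Lemma Phi_odd t : Phi t \in homog A true.
Proof.
elim/tensor_ind: t => [|s t|x y]; first by rewrite Phi0 homog0.
  by rewrite PhiD; apply: homogD.
by rewrite Phi_pure; apply: (homogM (pr_homog false x) (pr_homog true y)).
Qed.

(* [coinv a = S(a_(1))_0 * (a_(2))_1]: it agrees with [a] to first order and
   has constant derivatives along the even part ([pi_D_coinv]). *)
Definition coinv a := Phi (kappa a).

Lemma coinv_linear : linear coinv.
Proof. by move=> k x y; rewrite /coinv smorD smorZ Phi_linear. Qed.

HB.instance Definition _ := GRing.isLinear.Build K A A *:%R coinv coinv_linear.

Lemma coinvB x y : coinv (x - y) = coinv x - coinv y. Proof. exact: raddfB. Qed.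

Lemma coinv_sum (I : finType) (k : I -> K) (F : I -> A) :
  coinv (\sum_i k i *: F i) = \sum_i k i *: coinv (F i).
Proof. by rewrite raddf_sum; apply: eq_bigr => i _; apply: linearZ. Qed.

Lemma coinv_odd a : coinv a \in homog A true. Proof. exact: Phi_odd. Qed.

Lemma coinv_even a : a \in homog A false -> coinv a = 0.
Proof.
move=> /(smor_homog kappa) h; rewrite /coinv.
elim/thomog_ind: (kappa a) / h => [|s t hs ht|c d x y e hx hy].
- exact: Phi0.
- by rewrite PhiD hs ht addr0.
by rewrite Phi_pure !(pr_homogE _ hx) !(pr_homogE _ hy); case: c d e {hx hy} => [] [] //= _;
  rewrite ?mul0r ?mulr0.
Qed.

Lemma Ip_triple (a b c : A) :
  a \in homog A true -> b \in homog A true -> Ip 2 (a * b * c).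
Proof. by move=> ha hb; apply: Ip_mulr; apply: Ip_mem => //; apply: Ip_odd. Qed.

(** An even t has only even (x) even and odd (x) odd terms. The latter contribute two odd factors,
    hence an element of I^2, and for the former the product of the two legs can be pulled out. *)
Lemma Phi_mul (t u : AA) : t \in homog AA false ->
  Ip 2 (Phi (t * u) - tpair (smor_id A) (smor_id A) t * Phi u).
Proof.
have Il := @Ip_lin _ A 2; pose m := tpair (smor_id A) (smor_id A).
have split4 (a b c d : A) : a + b - (c + d) = (a - c) + (b - d).
  by rewrite opprD addrACA.
elim/thomog_ind => [|s s' IH IH'|b c x y e hx hy].
- by rewrite mul0r Phi0 smor0 mul0r subrr; apply: Il.1.
- by rewrite mulrDl PhiD smorD mulrDl split4; apply: (linclosedD Il).
elim/tensor_hind: u => [|u u' IH IH'|b' c' x' y' hx' hy'].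
- by rewrite mulr0 Phi0 mulr0 subrr; apply: Il.1.
- by rewrite mulrDr !PhiD mulrDr split4; apply: (linclosedD Il).
rewrite [X in Phi X](tmulH _ _ hy hx') PhiZ !Phi_pure.
rewrite [tpair _ _ _]tlift_pure; last exact: tpair_bilin.
rewrite /= (pr_homogE _ hx') (pr_homogE _ hy').
rewrite (pr_homogE _ (homogM hx hx')) (pr_homogE _ (homogM hy hy')).
case: b c e hx hy => [] [] // _ hx hy /=.
  apply: (linclosedB Il); last exact: Ip_triple.
  apply: (linclosedZ Il); case: b' hx' => hx' /=; last by rewrite mul0r; apply: Il.1.
  exact: Ip_triple.
rewrite scale1r; case: b' hx' => hx' /=; first by rewrite !mul0r mulr0 subrr; apply: Il.1.
case: c' hy' => hy' /=; last by rewrite !mulr0 subrr; apply: Il.1.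
by rewrite !mulrA -[x * y * x']mulrA -(even_comm y hx') mulrA subrr; apply: Il.1.
Qed.

(** On b c with b in A_0^+, [Phi_mul] pulls out the product of the two legs of kappa(b), which is
    x^-1 x evaluated on b, that is eps b = 0. *)
Lemma coinv_cot0 a : cot0 a -> Ip 2 (coinv a).
Proof.
move=> h; apply: (h (fun a => Ip 2 (coinv a))).
  exact: (lin_pre coinv_linear (@Ip_lin _ A 2)).
move=> _ [b [c [hb eb hc ->]]]; rewrite /coinv smorM.
have := @Phi_mul (kappa b) (kappa c) (smor_homog kappa hb).
by rewrite mul_kappa eb scale0r mul0r subr0.
Qed.

(** The identity y = x (x^-1 y) recovers a from a_(1) and kappa(a_(2)). Modulo I^2 the odd part of
    the result involves a_(1) only as an even coefficient of [coinv]. *)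
Lemma coinv_span a : a \in homog A true ->
  span_of (fun c => Ip 2 c \/ exists b y, c = b * coinv y) a.
Proof.
move=> ha; set S := (fun c => _ \/ _); have Sl := @span_lin _ A S.
have e : Phi (tensor_lift (fun x y => tinl A A x * kappa y) (comul G a)) = a.
  by rewrite mul_kappa_inl Phi_pure (pr_id (homog1 A)) mul1r pr_id.
rewrite -e (lin_tlift _ _ Phi_linear); apply: (linclosed_sum Sl) => -[x y] _ /=.
have -> : Phi (tinl A A x * kappa y) = pr false x * coinv y +
    (Phi (tinl A A x * kappa y) - pr false x * coinv y) by rewrite addrC subrK.
apply: (linclosedD Sl); first by apply: span_mem; right; exists (pr false x), y.
apply: span_mem; left; rewrite /coinv; move: (kappa y) => t.
have Il := @Ip_lin _ A 2.
elim/tensor_ind: t => [|s t IH IH'|u v].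
- by rewrite mulr0 Phi0 mulr0 subrr; apply: Il.1.
- by rewrite mulrDr !PhiD mulrDr opprD addrACA; apply: (linclosedD Il).
rewrite /= pureM1 !Phi_pure pr0M mulrDl -mulrA addrC addKr.
by apply: Ip_triple; apply: pr_homog.
Qed.

Lemma coinv_gen d (w : 'I_d -> A) a : odd_gen w -> a \in homog A true ->
  exists b : 'I_d -> A, Ip 2 (a - \sum_j b j * coinv (w j)).
Proof.
move=> gw /coinv_span h; have Il := @Ip_lin _ A 2.
apply: (h (fun a => exists b : 'I_d -> A, Ip 2 (a - \sum_j b j * coinv (w j))))
  => [|c [hc|[b [y ->]]]].
- split; first by exists (fun=> 0); rewrite big1 ?subr0 => [|j _]; [exact: Il.1 | rewrite mul0r].
  move=> k u v [b hb] [c hc]; exists (fun j => k *: b j + c j).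
  have := Il.2 k _ _ hb hc; congr (Ip 2); rewrite scalerBr addrACA -opprD.
  congr (_ - _); rewrite scaler_sumr -big_split; apply: eq_bigr => j _.
  by rewrite mulrDl scalerAl.
- by exists (fun=> 0); rewrite big1 ?subr0 // => j _; rewrite mul0r.
have [al hal] := gw.2 _ (pr_homog true y).
exists (fun j => al j *: b); have -> : coinv y = coinv (pr true y).
  have := coinv_linear 1 (pr false y) (pr true y).
  by rewrite !scale1r pr_sum (coinv_even (pr_homog false y)) add0r.
have := Ip_mull b (coinv_cot0 hal); congr (Ip 2).
rewrite coinvB coinv_sum mulrBr.
congr (_ - _); rewrite mulr_sumr; apply: eq_bigr => j _.
by rewrite -scalerAr scalerAl.
Qed.

(** Differentiating x^-1 y by right translation moves y only, so the left tensor factor is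
    untouched. *)
Lemma kappa_D (x : {scalar A}) a :
  kappa (D x a) = tensor_lift (fun u v => pure u (D x v)) (kappa a) :> tensor A A.
Proof.
have pDb : bilin (fun u v : A => pure u (D x v)).
  split=> [v|u] k y z; first by rewrite pureDl pureZl.
  by rewrite D_linear pureDr pureZr.
have Sl : linear antipode by move=> k u v; rewrite smorD smorZ.
apply: tensor_eqP => lam mu.
have fb (mu' : {scalar A}) : bilin (fun v w : A => lam v * mu' w : K^o).
  split=> [w|v] a' u u'; rewrite linearP; first by rewrite mulrDl /= -mulrA.
  by rewrite mulrDr /= mulrCA.
pose lS : {scalar A} := lam \o antipode.
transitivity (lS (D mu (D x a))).
  rewrite kappaE (lin_tlift _ _ (tlift_linear (fb mu))) -tlift_functionals.
  by apply: tlift_eq => u v; rewrite tlift_pure.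
rewrite D_comp -tlift_functionals kappaE (lin_tlift _ _ (tlift_linear pDb)).
rewrite (lin_tlift _ _ (tlift_linear (fb mu))); apply: tlift_eq => u v.
by rewrite !tlift_pure.
Qed.

End Coinvariants.

(** * The even part *)

Lemma hopf_eps (K : fieldType) (G H : supergroup K)
    (f : smor (Defs.coord H) (Defs.coord G)) a : hopf_morphism f -> eps (f a) = eps a.
Proof.
move=> hf; rewrite !epsE /counit.
have <- : smor_comp (gone G _) f = gone H (base_superalg K); last by [].
by apply: (gone_uniq (g := sg_group H)); rewrite -hf gmul1.
Qed.

Section EvenPart.
Variables (K : fieldType) (G E : supergroup K) (pi : closed_subgroup E G).
Local Notation A := (Defs.coord G).
Local Notation B := (Defs.coord E).
Hypotheses (pi_ev : is_even_part pi) (E_ev : affine_group E).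

Lemma pi_odd a : a \in homog A true -> pi a = 0.
Proof. by move=> ha; apply: E_ev; apply: smor_homog. Qed.

Lemma pi_pr1 a : pi (pr true a) = 0.
Proof. exact/pi_odd/pr_homog. Qed.

Lemma pi_pr0 a : pi (pr false a) = pi a.
Proof. by rewrite -[in RHS](pr_sum a) smorD pi_pr1 addr0. Qed.

Lemma pi_sg a : pi (sg a) = pi a.
Proof. by rewrite sgE smorB pi_pr1 pi_pr0 subr0. Qed.

Lemma pi_ker a : pi a = 0 <-> Ip 1 a.
Proof.
split=> [/pi_ev[s [hs ->]]|h]; last first.
  by apply: (purely_even_Ip1 E_ev); apply: smor_Ip.
apply: (linclosed_sum_seq (@Ip_lin _ A 1)) => p /hs hp.
exact: (Ip_mulr _ (Ip_mull _ (Ip_odd hp))).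
Qed.

Lemma pi_comm (x y : B) : x * y = y * x.
Proof. exact: purely_even_comm E_ev. Qed.

Lemma eps_pi a : eps (pi a) = eps a.
Proof. exact/hopf_eps/restr_hopf. Qed.

Lemma comul_pi a : comul E (pi a) =
  tensor_lift (fun x y => pure (pi x) (pi y)) (comul G a) :> tensor B B.
Proof.
have := restr_hopf pi (tinl B B : E _) (tinr B B : E _).
rewrite /comul unlock => /(congr1 (fun f : smor A _ => f a)) /= ->.
rewrite gmulE /comul unlock; apply: tlift_eq => x y.
by rewrite /= pureM1 mulr1.
Qed.

Lemma pi_D (mu : {scalar B}) a : pi (D (mu \o pi) a) = D mu (pi a).
Proof.
rewrite {2}/D comul_pi (lin_tlift _ _ (rgt_linear mu)).
rewrite {1}/D /rgt (lin_tlift (f := pi : A -> B)); last first.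
  by move=> k x y; rewrite smorD smorZ.
by apply: tlift_eq => x y; rewrite smorZ [RHS]rgt_pure.
Qed.

Lemma pi_D_const (mu : {scalar B}) a k :
  pi a = k%:A -> pi (D (mu \o pi) a) = (k * mu 1)%:A.
Proof. by rewrite pi_D => ->; rewrite linearZ /= D1 scalerA. Qed.

(** After [pi] every term that keeps an odd factor vanishes, so the parity projections in [Phi]
    disappear. By [kappa_D] what remains is x^-1 x evaluated on [D x a], a constant. *)
Lemma pi_D_coinv (x : {scalar A}) a : odd_der x -> pi (D x (coinv a)) = (x a)%:A.
Proof.
move=> xd; pose m := tpair (smor_id A) (smor_id A).
have key t : pi (D x (Phi t)) = pi (m (tensor_lift (fun u v => pure u (D x v)) t)).
  have pDb : bilin (fun u v : A => pure u (D x v)).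
    split=> [v|u] k y z; first by rewrite pureDl pureZl.
    by rewrite D_linear pureDr pureZr.
  elim/tensor_ind: t => [|s t IH IH'|u v].
  - by rewrite tlift0 // Phi0 linear0 !smor0.
  - by rewrite tliftD // PhiD raddfD !smorD IH IH'.
  rewrite Phi_pure tlift_pure // [m _]tlift_pure; last exact: tpair_bilin.
  rewrite od_DM // smorD !smorM pi_sg pi_pr1 mulr0 addr0 pi_pr0; congr (_ * _).
  rewrite -{2}[v]pr_sum raddfD smorD [X in _ = X + _]pi_odd ?add0r //.
  exact: (od_D_homog xd (pr_homog false v)).
by rewrite key -kappa_D mul_kappa eps_D smorZ smor1.
Qed.

End EvenPart.

(** * Odd monomials *)

Lemma perm_adjacent (T : eqType) (P : seq T -> Prop) :
  (forall s1 i j s2, P (s1 ++ i :: j :: s2) -> P (s1 ++ j :: i :: s2)) ->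
  forall s t, perm_eq s t -> P s -> P t.
Proof.
move=> sw; have mv i s1 s2 s3 : P (s1 ++ i :: s2 ++ s3) -> P (s1 ++ s2 ++ i :: s3).
  elim: s2 s1 => [//|j s2 IH] s1 /sw; rewrite -cat_rcons => /IH.
  by rewrite cat_rcons.
suff h s t s1 : perm_eq s t -> P (s1 ++ s) -> P (s1 ++ t).
  by move=> s t; exact: (h s t [::]).
elim: s t s1 => [|i s IH] t s1; first by move=> /perm_size/esym/size0nil ->.
move=> pst; have it : i \in t by rewrite -(perm_mem pst) mem_head.
case/splitPr: it pst => t1 t2.
rewrite perm_sym -cat1s perm_catCA cat1s perm_cons perm_sym => /IH h.
by rewrite -cat_rcons => /h; rewrite cat_rcons => /mv.
Qed.

Lemma not_uniq_perm (T : eqType) (s : seq T) : ~~ uniq s ->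
  exists i s', perm_eq s (i :: i :: s').
Proof.
elim: s => //= i s IH; rewrite negb_and negbK; case: (boolP (i \in s)) => [is_ _|_ /=].
  by exists i, (rem i s); rewrite perm_cons perm_to_rem.
move=> /IH[j [s' h]]; exists j, (i :: s'); rewrite -(perm_cons i) in h.
by apply: perm_trans h _; rewrite -![_ :: j :: _]cat1s -![_ :: i :: _]cat1s; apply/permP => p /=; rewrite addnCA; congr (_ + _)%N; rewrite addnCA.
Qed.

(** Reduction to standard words: transposing neighbours brings any word either to one that starts
    with a repeated letter or to the enumeration of a set. It is used for odd monomials and again
    for words of derivations. *)
Lemma perm_adjacent_ind (I : finType) (P : seq I -> Prop) :
  (forall s1 i j s2, P (s1 ++ i :: j :: s2) -> P (s1 ++ j :: i :: s2)) ->
  (forall i s, P (i :: i :: s)) -> (forall S : {set I}, P (enum S)) -> forall s, P s.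
Proof.
move=> sw Pii PS s; have [us|/not_uniq_perm[i [s' h]]] := boolP (uniq s).
  apply: (perm_adjacent sw _ (PS [set i in s])).
  by apply: uniq_perm => //; [exact: enum_uniq | move=> i; rewrite mem_enum inE].
by apply: (perm_adjacent sw _ (Pii i s')); rewrite perm_sym.
Qed.

Section Monomials.
Variables (K : fieldType) (A : superalg K).
Hypothesis two_neq0 : (2%:R : K) != 0.

Lemma addvv_eq0 (V : lmodType K) (v : V) : v + v = 0 -> v = 0.
Proof.
move=> h; apply/eqP; have : (2%:R : K) *: v == 0 by rewrite scaler_nat mulr2n h.
by rewrite scaler_eq0 (negbTE two_neq0).
Qed.

Lemma odd_anti (a b : A) : a \in homog A true -> b \in homog A true -> a * b = - (b * a).
Proof. by move=> ha hb; rewrite (supercomm ha hb) expr1 mulN1r. Qed.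

Lemma odd_sqr (a : A) : a \in homog A true -> a * a = 0.
Proof. by move=> ha; apply: addvv_eq0; rewrite {1}(odd_anti ha ha) addNr. Qed.

Variables (d : nat) (z : 'I_d -> A).
Hypothesis zo : forall j, z j \in homog A true.

Definition zl (t : seq 'I_d) : A := \prod_(j <- t) z j.

Lemma zl_rcons t j : zl (rcons t j) = zl t * z j.
Proof. by rewrite /zl -cats1 big_cat big_seq1. Qed.

Lemma zl_swap s1 i j s2 : zl (s1 ++ i :: j :: s2) = - zl (s1 ++ j :: i :: s2).
Proof.
rewrite /zl !big_cat !big_cons /= -mulrN; congr (_ * _).
by rewrite !mulrA (odd_anti (zo i) (zo j)) mulNr.
Qed.

Lemma zl_double i s : zl (i :: i :: s) = 0.
Proof. by rewrite /zl !big_cons mulrA odd_sqr ?mul0r. Qed.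

Lemma zl_perm s t : perm_eq s t -> zl t = zl s \/ zl t = - zl s.
Proof.
move=> h; apply: (perm_adjacent (P := fun t => zl t = zl s \/ zl t = - zl s) _ h).
  by move=> s1 i j s2; rewrite [zl (_ ++ j :: _)]zl_swap => - [] ->; [right | left; rewrite opprK].
by left.
Qed.

Lemma zl_Ip t : Ip (size t) (zl t).
Proof.
elim/last_ind: t => [//|t j IH]; rewrite zl_rcons size_rcons; exact: Ip_mem.
Qed.

Lemma zl_comm t b : exists b', zl t * b = b' * zl t.
Proof.
elim/last_ind: t b => [|t j IH] b; first by exists b; rewrite /zl big_nil mul1r mulr1.
have [b' e] := IH (sg b); exists b'.
by rewrite zl_rcons -mulrA (odd_sg _ (zo j)) mulrA e mulrA.
Qed.

Variable Er : nat -> A -> Prop.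
Hypotheses (Er_lin : forall m, linclosed (Er m))
  (Er_mull : forall m a e, Er m e -> Er m (a * e))
  (Er_mulr : forall m a e, Er m e -> Er m (e * a))
  (Er_odd : forall m q e, q \in homog A true -> Er m e -> Er m.+1 (e * q))
  (Er_gen : forall m p q, Ip m p -> q \in homog A true ->
     exists b : 'I_d -> A, Er m.+1 (p * q - \sum_j p * b j * z j)).

Let Gen m a := exists b : {set 'I_d} -> A,
  Er m (a - \sum_(S : {set 'I_d} | #|S| == m) b S * zl (enum S)).

Let Gen_lin m : linclosed (Gen m).
Proof.
split=> [|k u v [b hb] [c hc]].
  by exists (fun=> 0); rewrite big1 ?subr0; [exact: (Er_lin m).1 | move=> S _; rewrite mul0r].
exists (fun S => k *: b S + c S); have := (Er_lin m).2 k _ _ hb hc; congr (Er m).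
rewrite scalerBr addrACA -opprD; congr (_ - _).
by rewrite scaler_sumr -big_split; apply: eq_bigr => S _; rewrite mulrDl scalerAl.
Qed.

Let Gen_mull m a e : Gen m e -> Gen m (a * e).
Proof.
move=> [b hb]; exists (fun S => a * b S); have := Er_mull a hb; congr (Er m).
by rewrite mulrBr mulr_sumr; congr (_ - _); apply: eq_bigr => S _; rewrite mulrA.
Qed.

Let Gen_Er m e : Er m e -> Gen m e.
Proof.
by move=> he; exists (fun=> 0); rewrite big1 ?subr0 // => S _; rewrite mul0r.
Qed.

Let Gen_zl m t : size t = m -> Gen m (zl t).
Proof.
apply: (perm_adjacent_ind (P := fun t => size t = m -> Gen m (zl t))).
- move=> s1 i j s2 h e; rewrite zl_swap; apply: (linclosedN (Gen_lin m)).
  by apply: h; rewrite -e !size_cat.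
- by move=> i s _; rewrite zl_double; apply: (Gen_lin m).1.
move=> S eS; exists (fun T => (T == S)%:R); rewrite (bigD1 S) /=; last by rewrite cardE eS.
rewrite eqxx mul1r big1 ?addr0 ?subrr; first exact: (Er_lin m).1.
by move=> T /andP[_ /negbTE ->]; rewrite mul0r.
Qed.

(** Odd factors are replaced one at a time by combinations of the z_j, then sorted. The error [Er]
    is abstract because the argument is needed twice: with error 0 for nilpotency, and with error
    I^(m+1) for the Taylor expansion. *)
Lemma Ip_gen m p : Ip m p -> exists b : {set 'I_d} -> A,
  Er m (p - \sum_(S : {set 'I_d} | #|S| == m) b S * zl (enum S)).
Proof.
suff : Ip m p -> Gen m p by [].
elim: m p => [|m IH] p; first by move=> _; rewrite -[p]mulr1; apply: Gen_mull;
  have := @Gen_zl 0 [::] erefl; rewrite /zl big_nil.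
move=> h; apply: (h (Gen m.+1) (Gen_lin _)) => _ [{h}p [q [hp hq ->]]].
have [b hb] := Er_gen hp hq; have [c hc] := IH _ hp.
rewrite -[_ * _](subrK (\sum_j p * b j * z j)).
apply: (linclosedD (Gen_lin _)); first exact: Gen_Er.
apply: (linclosed_sum (Gen_lin _)) => j _.
rewrite -[p](subrK (\sum_(S : {set 'I_d} | #|S| == m) c S * zl (enum S))).
move: hc; move: (p - _) => e hc; rewrite !mulrDl.
apply: (linclosedD (Gen_lin _)); first exact: Gen_Er (Er_odd (zo j) (Er_mulr (b j) hc)).
rewrite !mulr_suml; apply: (linclosed_sum (Gen_lin _)) => S /eqP cS.
have [b' eb] := zl_comm (enum S) (b j).
rewrite -[c S * _ * _]mulrA eb !mulrA -mulrA -zl_rcons; apply/Gen_mull/Gen_zl.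
by rewrite size_rcons -cardE cS.
Qed.

End Monomials.

(** A product of d + 1 odd elements expands into monomials in d odd generators; one of them repeats,
    and odd squares vanish. Formally, no subset of ['I_d] has d + 1 elements. *)
Lemma Ip_nilpotent (K : fieldType) (A : superalg K) d (y : 'I_d -> A) :
  (2%:R : K) != 0 -> (forall j, y j \in homog A true) ->
  (forall a, a \in homog A true -> exists b : 'I_d -> A, a = \sum_j b j * y j) ->
  forall a : A, Ip d.+1 a -> a = 0.
Proof.
move=> two yo yg a ha.
have [||||| b] := @Ip_gen K A two d y yo (fun _ e => e = 0) _ _ _ _ _ d.+1 a ha.
- by move=> _; split=> // k u v -> ->; rewrite scaler0 addr0.
- by move=> _ b e ->; rewrite mulr0.
- by move=> _ b e ->; rewrite mul0r.
- by move=> _ b e _ ->; rewrite mul0r.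
- move=> m p q _ /yg[b ->]; exists b; rewrite mulr_sumr; apply/eqP; rewrite subr_eq0.
  by apply/eqP/eq_bigr => j _; rewrite mulrA.
rewrite big_pred0 ?subr0 // => S; apply: negbTE; rewrite neq_ltn ltnS.
by rewrite (leq_trans (max_card _)) ?card_ord.
Qed.

(** * Taylor expansion along the odd derivations *)

Section Taylor.
Variables (K : fieldType) (G E : supergroup K) (pi : closed_subgroup E G).
Local Notation A := (Defs.coord G).
Local Notation B := (Defs.coord E).
Hypotheses (two_neq0 : (2%:R : K) != 0)
  (pi_ev : is_even_part pi) (E_ev : affine_group E).
Variables (d : nat) (x : 'I_d -> {scalar A}) (z : 'I_d -> A).
Hypotheses (xd : forall i, odd_der (x i)) (zo : forall j, z j \in homog A true).
Hypothesis Dz : forall i j, pi (D (x i) (z j)) = (i == j)%:R.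

(** The last letter acts first, so that it meets the last factor of a monomial; this is why the
    inductions below run on [rcons]. *)
Definition Dl (s : seq 'I_d) (a : A) : A := foldr (fun i => D (x i)) a s.

Lemma Dl_linear s : linear (Dl s).
Proof.
elim: s => [//|i s IH] k u v.
by rewrite -[LHS]/(D (x i) (Dl s _)) IH D_linear.
Qed.
HB.instance Definition _ s := GRing.isLinear.Build K A A *:%R (Dl s) (Dl_linear s).

Lemma Dl_rcons s i a : Dl (rcons s i) a = Dl s (D (x i) a).
Proof. by rewrite /Dl foldr_rcons. Qed.

Lemma Dl_cat s t a : Dl (s ++ t) a = Dl s (Dl t a).
Proof. exact: foldr_cat. Qed.

Lemma Dl_Ip s m a : Ip (size s + m) a -> Ip m (Dl s a).
Proof.
elim/last_ind: s m a => [//|s i IH] m a; rewrite size_rcons addSn Dl_rcons => h.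
exact/IH/Ip_D.
Qed.

Lemma pi_Dl_Ip s a : Ip (size s).+1 a -> pi (Dl s a) = 0.
Proof. by move=> h; apply/(pi_ker pi_ev E_ev)/Dl_Ip; rewrite addn1. Qed.

Local Notation zl := (zl z).

(** In general [D (x i)] lowers the power of I by one. Here nothing is lost, because the derivative
    of each factor z_j with j different from i lies in I. *)
Lemma D_zl_notin i t b : i \notin t -> Ip (size t) (D (x i) (b * zl t)).
Proof.
have Il := @Ip_lin _ A; elim/last_ind: t => [//|t j IH].
rewrite mem_rcons inE negb_or size_rcons => /andP[ij it].
rewrite zl_rcons mulrA od_DM //; apply: (linclosedD (Il _)).
  rewrite -addn1; apply: IpM; first exact/Ip_mull/zl_Ip.
  by apply/(pi_ker pi_ev E_ev); rewrite Dz (negbTE ij).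
by apply: Ip_mem; [apply: IH | apply: sg_homogP].
Qed.

Lemma D_zl_rcons i t b : i \notin t ->
  Ip (size t).+1 (D (x i) (b * zl (rcons t i)) - b * zl t).
Proof.
have Il := @Ip_lin _ A; move=> it.
rewrite zl_rcons mulrA od_DM // addrAC; apply: (linclosedD (Il _)).
  rewrite -{2}[b * _]mulr1 -mulrBr -addn1; apply: IpM; first exact/Ip_mull/zl_Ip.
  by apply/(pi_ker pi_ev E_ev); rewrite smorB Dz eqxx smor1 subrr.
by apply: Ip_mem; [apply: D_zl_notin | apply: sg_homogP].
Qed.

(** Modulo I, words of derivations and monomials of the same degree are dual (see [Dl_zl_diag]). If
    the last letter of s is not in t, the remaining derivations are too few to leave I; otherwise
    that letter is moved to the end of t, up to a sign, and cancelled. *)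
Lemma Dl_zl_off s t b : size s = size t -> uniq t -> ~~ perm_eq s t ->
  pi (Dl s (b * zl t)) = 0.
Proof.
elim/last_ind: s t b => [|s i IH] t b; first by move=> /esym/size0nil -> _; rewrite perm_refl.
rewrite size_rcons Dl_rcons => st ut npt.
have [it|it] := boolP (i \in t); last first.
  by apply: pi_Dl_Ip; rewrite st; apply: D_zl_notin.
pose t' := rem i t.
have pt : perm_eq t (rcons t' i).
  by rewrite perm_sym perm_rcons perm_sym perm_to_rem.
have it' : i \notin t' by rewrite mem_rem_uniqF.
have st' : size s = size t'.
  by apply: succn_inj; rewrite st (perm_size pt) size_rcons.
have key : pi (Dl s (D (x i) (b * zl (rcons t' i)))) = 0.
  rewrite -[D _ _](subrK (b * zl t')) raddfD smorD pi_Dl_Ip ?add0r.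
    apply: IH => //; first exact: rem_uniq.
    apply: contra npt => pst; apply: (@perm_trans _ (rcons t' i)); last by rewrite perm_sym.
    by rewrite perm_rcons perm_sym perm_rcons perm_cons perm_sym.
  by rewrite st'; apply: D_zl_rcons.
have [e|e] := zl_perm zo pt; first by rewrite -e.
by apply/eqP; rewrite -oppr_eq0 -smorN -!raddfN /= -mulrN -e key.
Qed.

Lemma Dl_zl_diag t b : uniq t -> pi (Dl t (b * zl t)) = pi b.
Proof.
elim/last_ind: t b => [|t i IH] b; first by rewrite /zl big_nil mulr1.
rewrite rcons_uniq => /andP[it ut]; rewrite Dl_rcons.
rewrite -[D _ _](subrK (b * zl t)) raddfD smorD pi_Dl_Ip ?add0r ?IH //.
exact: D_zl_rcons.
Qed.

(** The coefficients are corrected by increasing cardinality: adding monomials of degree m changes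
    no coefficient of lower order, and on sets of size m duality allows any prescribed values. *)
Lemma Taylor_surj (phi : {set 'I_d} -> B) : exists a, forall S : {set 'I_d}, pi (Dl (enum S) a) = phi S.
Proof.
suff [a ha] : exists a, forall S : {set 'I_d}, (#|S| < d.+1)%N -> pi (Dl (enum S) a) = phi S.
  by exists a => S; apply: ha; rewrite ltnS (leq_trans (max_card _)) ?card_ord.
elim: d.+1 => [|m [a ha]]; first by exists 0.
have [c hc] := choice (fun b => restr_surj pi b).
pose b (T : {set 'I_d}) := c (phi T - pi (Dl (enum T) a)).
exists (a + \sum_(T : {set 'I_d} | #|T| == m) b T * zl (enum T)) => S.
have zero (T : {set 'I_d}) : (#|S| < #|T|)%N -> pi (Dl (enum S) (b T * zl (enum T))) = 0.
  move=> lt; apply: pi_Dl_Ip; apply: (@Ip_le _ _ _ #|T|); first by rewrite -cardE.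
  by rewrite cardE; apply/Ip_mull/zl_Ip.
rewrite ltnS leq_eqVlt raddfD smorD raddf_sum smor_sum /= => /orP[cS|lt]; last first.
  by rewrite ha // big1 ?addr0 // => T /eqP cT; apply: zero; rewrite cT.
rewrite (bigD1 S) //= Dl_zl_diag ?enum_uniq // big1 ?addr0.
  by rewrite hc addrC subrK.
move=> T /andP[cT neTS]; apply: Dl_zl_off; rewrite ?enum_uniq -?cardE ?(eqP cS) ?(eqP cT) //.
apply: contra neTS => /perm_mem h; apply/eqP/setP => i.
by have := h i; rewrite !mem_enum.
Qed.

Hypothesis zgen : forall a, a \in homog A true ->
  exists b : 'I_d -> A, Ip 2 (a - \sum_j b j * z j).
Variable N : nat.
Hypothesis IpN : forall a : A, Ip N a -> a = 0.

(** If all coefficients vanish, a lies in every power of I: written modulo I^(m+1) in monomials of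
    degree m, its coefficients are read off by duality and lie in I. Nilpotency concludes. *)
Lemma Taylor_inj a : (forall S : {set 'I_d}, pi (Dl (enum S) a) = 0) -> a = 0.
Proof.
have Il := @Ip_lin _ A; move=> h; apply: IpN; elim: N => [//|m IH].
have [||||| b hb] := @Ip_gen K A two_neq0 d z zo (fun m => Ip m.+1) _ _ _ _ _ m a IH.
- by move=> n; apply: Il.
- by move=> n c e; apply: Ip_mull.
- by move=> n c e; apply: Ip_mulr.
- by move=> n q e hq he; apply: Ip_mem.
- move=> n p q hp /zgen[b hb]; exists b; have := IpM hp hb; rewrite addn2; congr (Ip n.+2).
  by rewrite mulrBr mulr_sumr; congr (_ - _); apply: eq_bigr => j _; rewrite mulrA.
rewrite -[a](subrK (\sum_(S : {set 'I_d} | #|S| == m) b S * zl (enum S))).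
apply: (linclosedD (Il _)) => //; apply: (linclosed_sum (Il _)) => S cS.
suff : Ip 1 (b S) by move=> /IpM/(_ (zl_Ip zo (enum S))); rewrite -cardE (eqP cS) add1n.
apply/(pi_ker pi_ev E_ev); rewrite -(Dl_zl_diag (b S) (enum_uniq S)).
have := h S; rewrite -{1}[a](subrK (\sum_(S : {set 'I_d} | #|S| == m) b S * zl (enum S))).
rewrite raddfD smorD [X in X + _]pi_Dl_Ip ?add0r; last by rewrite -cardE (eqP cS).
rewrite raddf_sum smor_sum /= (bigD1 S) //= big1 ?addr0 // => T /andP[cT neTS].
apply: Dl_zl_off; rewrite ?enum_uniq -?cardE ?(eqP cS) ?(eqP cT) //.
apply: contra neTS => /perm_mem hm; apply/eqP/setP => i.
by have := hm i; rewrite !mem_enum.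
Qed.

End Taylor.

(** * The twisted primitive element *)

Definition comodule_matrix (K : fieldType) (E : supergroup K) d
    (c : 'I_d -> 'I_d -> Defs.coord E) :=
  (forall i j, comul E (c i j) = \sum_k pure (c i k) (c k j) :> tensor _ _) /\
  forall i j, eps (c i j) = (i == j)%:R.

Lemma comodule_matrixP (K : fieldType) (E : supergroup K) d
    (c : 'I_d -> 'I_d -> Defs.coord E) :
  (forall (lam nu : {scalar Defs.coord E}) i j,
     lam (D nu (c i j)) = \sum_k lam (c i k) * nu (c k j)) ->
  (forall i j, eps (c i j) = (i == j)%:R) -> comodule_matrix c.
Proof.
move=> cD ce; split=> // i j; apply: tensor_eqP => lam nu.
have fb := functionals_bilin lam nu.
rewrite tlift_functionals cD tlift_sum //.
by apply: eq_bigr => k _; rewrite tlift_pure.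
Qed.

(* A matrix form of trigonalizability: every nonzero finite-dimensional comodule
   contains a line stable under the coaction.  Unlike the formulation with
   modules [V (x) R], it only involves elements of the coordinate algebra. *)
Definition pointed (K : fieldType) (E : supergroup K) :=
  forall d (c : 'I_d -> 'I_d -> Defs.coord E), (0 < d)%N -> comodule_matrix c ->
  exists f : 'I_d -> K, (exists i, f i != 0) /\
    exists chi, forall i, \sum_j f j *: c i j = f i *: chi.

Lemma brk_cancel (V : zmodType) (p q r s p' s' : V) :
  p - q + (r + s) + (p' - r + (q + s')) = p + p' + (s + s').
Proof.
rewrite [LHS](AC (2*2*(2*2)) ((1*5)*(4*8)*((2*7)*(3*6)))) /=.
by rewrite addNr subrr !addr0.
Qed.

Lemma jacobi_cancel (V : zmodType) (ijk ikj jki kji jik kij : V) :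
  (ijk + ikj - (jki + kji)) + (jki + jik - (kij + ikj)) + (kij + kji - (ijk + jik)) = 0.
Proof.
rewrite !opprD (AC (2*2*(2*2)*(2*2)) ((1*11)*(2*8)*(3*5)*(4*10)*(6*12)*(7*9))) /=.
by rewrite !(subrr, addNr) !addr0.
Qed.

(** * Brackets of odd derivations *)

Section Brackets.
Variables (K : fieldType) (G : supergroup K).
Local Notation A := (Defs.coord G).

Lemma sg_D (x : {scalar A}) a : odd_der x -> sg (D x a) = - D x (sg a).
Proof.
move=> xd; rewrite -[a]pr_sum !raddfD /= !(sg_homog (od_D_homog xd (pr_homog _ _))).
rewrite !(sg_homog (pr_homog _ _)) !expr0 !expr1 !scale1r !scaleN1r.
by rewrite (raddfN (D x)) /= opprK.
Qed.

Variables x y : {scalar A}.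
Hypotheses (xd : odd_der x) (yd : odd_der y).

Definition brk a := D x (D y a) + D y (D x a).

Lemma brk_linear : linear brk.
Proof. by move=> k u v; rewrite /brk !(D_linear, linearP) /= scalerDr addrACA. Qed.
HB.instance Definition _ := GRing.isLinear.Build K A A *:%R brk brk_linear.

(** The mixed terms cancel, so the bracket of two odd derivations is an ordinary, even
    derivation. *)
Lemma brkM a b : brk (a * b) = a * brk b + brk a * b.
Proof.
rewrite /brk !od_DM // !raddfD /= !od_DM // !sgK !sg_D // !mulrN.
by rewrite brk_cancel mulrDr mulrDl.
Qed.

Lemma brk1 : brk 1 = 0.
Proof. by rewrite /brk !D1 !(od_1 xd, od_1 yd) !scale0r !linear0 addr0. Qed.

Lemma brk_homog b a : a \in homog A b -> brk a \in homog A b.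
Proof.
by move=> ha; rewrite -[b]negbK; apply: homogD; do 2!apply: od_D_homog => //.
Qed.

Lemma brk_sg a : sg (brk a) = brk (sg a).
Proof. by rewrite /brk raddfD /= !sg_D // !raddfN /= !opprK. Qed.

(** Unlike a single odd derivation, the bracket preserves I, being even; it thus induces a
    derivation of K[G_ev]. *)
Lemma brk_Ip1 a : Ip 1 a -> Ip 1 (brk a).
Proof.
move=> h; apply: (h (fun a => Ip 1 (brk a))); first exact: (lin_pre brk_linear (@Ip_lin _ A 1)).
move=> _ [p [q [_ hq ->]]]; rewrite brkM; apply: (linclosedD (@Ip_lin _ A 1)).
  exact: (Ip_mull _ (Ip_odd (brk_homog hq))).
exact: (Ip_mull _ (Ip_odd hq)).
Qed.

Lemma brk_linv : linv brk.
Proof. by move=> v a; rewrite /brk !DL_comm raddfD. Qed.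

Variable u : {scalar A}.
Hypothesis ud : odd_der u.

Definition brk2 a := D u (brk a) - brk (D u a).

Lemma brk2_linear : linear brk2.
Proof.
move=> k a b; rewrite /brk2 brk_linear !D_linear brk_linear scalerBr.
by rewrite opprD addrACA.
Qed.
HB.instance Definition _ := GRing.isLinear.Build K A A *:%R brk2 brk2_linear.

Lemma brk2_linv : linv brk2.
Proof. by move=> v a; rewrite /brk2 brk_linv !DL_comm brk_linv raddfB. Qed.

(** The triple bracket is again an odd tangent vector, so it can be expanded in the dual basis
    x_i. *)
Lemma brk2_od : odd_der (@eps K G \o brk2).
Proof.
split=> [a ha|a b] /=.
  apply/eps_odd/homogB; first exact: (od_D_homog ud (brk_homog ha)).
  exact: (brk_homog (od_D_homog ud ha)).
have -> : brk2 (a * b) = a * brk2 b + brk2 a * sg b.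
  rewrite /brk2 brkM [D u (_ + _)]raddfD /= !od_DM // [brk (_ + _)]raddfD /= !brkM // brk_sg mulrBr mulrBl.
  set p := a * D u _; set q := D u a * _; set r := brk a * _; set t := _ * sg b.
  rewrite !opprD (AC (2*2*(2*2)) ((1*5)*(4*8)*((2*7)*(3*6)))) /=.
  by rewrite !subrr !addr0.
by rewrite raddfD /= !rmorphM /= eps_sg [eps (brk2 a) * _]mulrC addrC [eps b * _]mulrC.
Qed.

Lemma brk2E a : brk2 a = D (@eps K G \o brk2) a.
Proof. exact: (linvE brk2_linv). Qed.

End Brackets.

(** * From an eigenvector to an exact odd coordinate *)

Section TwistedPrimitive.
Variables (K : fieldType) (G E : supergroup K) (pi : closed_subgroup E G).
Local Notation A := (Defs.coord G).
Local Notation B := (Defs.coord E).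
Hypotheses (two_neq0 : (2%:R : K) != 0)
  (pi_ev : is_even_part pi) (E_ev : affine_group E).
Variables (d : nat) (w : 'I_d -> A) (x : 'I_d -> {scalar A}).
Hypotheses (gw : odd_gen w) (xd : forall i, odd_der (x i)).
Hypothesis xw : forall i j, x i (w j) = (i == j)%:R.
Variable N : nat.
Hypothesis IpN : forall a : A, Ip N a -> a = 0.

Let z j := coinv (w j).

Let zo j : z j \in homog A true. Proof. exact: coinv_odd. Qed.

Let Dz i j : pi (D (x i) (z j)) = (i == j)%:R.
Proof. by rewrite (pi_D_coinv pi E_ev) // xw; case: eqP => _; rewrite ?scale1r ?scale0r. Qed.

Let zgen a : a \in homog A true -> exists b : 'I_d -> A, Ip 2 (a - \sum_j b j * z j).
Proof. exact: coinv_gen. Qed.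

Let eps_piE a : eps (pi a) = eps a. Proof. exact: eps_pi. Qed.

Let piI a : Ip 1 a -> pi a = 0. Proof. by move/(pi_ker pi_ev E_ev). Qed.

Let xz i j : x i (z j) = (i == j)%:R.
Proof. by rewrite -eps_D -eps_piE Dz; case: eqP => _; rewrite ?rmorph1 ?raddf0. Qed.

(** The matrix of the conjugation action of G_ev on the odd cotangent space. *)
Let cf i j : B := pi (L (x i) (z j)).

Lemma pi_L_Ip2 (y : {scalar A}) a : odd_der y -> Ip 2 a -> pi (L y a) = 0.
Proof.
move=> yd h; apply: (h (fun a => pi (L y a) = 0)).
  split; first by rewrite raddf0 smor0.
  by move=> k u v eu ev; rewrite L_linear smorD smorZ eu ev scaler0 addr0.
move=> _ [p [q [hp hq ->]]]; rewrite od_LM // smorD !smorM.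
by rewrite (pi_odd pi E_ev hq) mulr0 (pi_sg pi E_ev) (piI hp) mul0r addr0.
Qed.

(** Along G_ev, left and right odd derivatives differ by conjugation, and [cf] is the change of
    basis. The difference of the two sides vanishes on even elements, on I^2 and on every b z_j,
    which together span everything. *)
Lemma pi_L_expand i a : pi (L (x i) a) = \sum_j cf i j * pi (D (x j) a).
Proof.
pose f a := pi (L (x i) a) - \sum_j cf i j * pi (D (x j) a).
suff : f a = 0 by move/subr0_eq.
have fl : linear f.
  move=> k u v; rewrite /f L_linear smorD smorZ scalerBr addrACA -opprD.
  congr (_ - _); rewrite scaler_sumr -big_split; apply: eq_bigr => j _ /=.
  by rewrite D_linear smorD smorZ mulrDr scalerAr.
have fD u v : f (u + v) = f u + f v by have := fl 1 u v; rewrite !scale1r.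
rewrite -[a]pr_sum fD [X in X + _](_ : _ = 0) ?add0r; last first.
  rewrite /f (pi_odd pi E_ev (od_L_homog (xd i) (pr_homog false a))) big1 ?subr0 // => j _.
  by rewrite (pi_odd pi E_ev (od_D_homog (xd j) (pr_homog false a))) mulr0.
have [b hb] := zgen (pr_homog true a); move: (pr true a) hb => {}a hb.
rewrite -[a](subrK (\sum_j b j * z j)) fD [X in X + _](_ : _ = 0) ?add0r; last first.
  rewrite /f pi_L_Ip2 // big1 ?subr0 // => j _.
  by rewrite (piI (Ip_D (xd j) hb)) mulr0.
elim/big_ind: _ => [|u v hu hv|j _]; first by have := fl (-1) 0 0; rewrite scaler0 addr0 scaleN1r addNr.
  by rewrite fD hu hv addr0.
rewrite /f od_LM // smorD !smorM (pi_odd pi E_ev (zo j)) mulr0 add0r (pi_sg pi E_ev).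
rewrite (bigD1 j) //= big1 => [|k nkj].
  rewrite od_DM // smorD !smorM Dz eqxx mulr1 (pi_sg pi E_ev) (pi_odd pi E_ev (zo j)) mulr0.
  by rewrite !addr0 (pi_comm E_ev) subrr.
rewrite od_DM // smorD !smorM Dz (negbTE nkj) (pi_sg pi E_ev) (pi_odd pi E_ev (zo j)).
by rewrite !mulr0 addr0 mulr0.
Qed.

Definition mulf (c : B) (mu : {scalar B}) : B -> K := fun b => mu (c * b).

Lemma mulf_linear c mu : linear_for *%R (mulf c mu).
Proof. by move=> k u v; rewrite /mulf mulrDr -scalerAr linearP. Qed.
HB.instance Definition _ c mu := GRing.isLinear.Build K B K *%R (mulf c mu) (mulf_linear c mu).

(** The rule for moving an odd derivation past a translation along G_ev. Pairing with a functional v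
    turns the odd right derivative into a left one, to which [pi_L_expand] applies. *)
Lemma D_conj i (mu : {scalar B}) a :
  D (x i) (D (mu \o pi) a) = \sum_j D (mulf (cf i j) mu \o pi) (D (x j) a).
Proof.
apply: functional_eq => v; rewrite D_L -DL_comm (D_L (mu \o pi)) /=.
rewrite pi_L_expand !raddf_sum; apply: eq_bigr => j _.
by rewrite /= (D_L (mulf (cf i j) mu \o pi)) /= -DL_comm.
Qed.

Lemma pi_D_conj k (mu : {scalar B}) j : pi (D (x k) (D (mu \o pi) (z j))) = (mu (cf k j))%:A.
Proof.
rewrite D_conj smor_sum (bigD1 j) //= big1 => [|l nlj].
  rewrite (@pi_D_const _ _ _ pi _ _ 1); last by rewrite Dz eqxx scale1r.
  by rewrite addr0 mul1r /= /mulf mulr1.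
rewrite (@pi_D_const _ _ _ pi _ _ 0) ?mul0r ?scale0r //.
by rewrite Dz (negbTE nlj).
Qed.

Lemma cf_comodule : comodule_matrix cf.
Proof.
apply: comodule_matrixP => [mu nu i j|i j]; last by rewrite /cf eps_piE eps_L xz.
rewrite /cf -pi_D DL_comm pi_L_expand raddf_sum; apply: eq_bigr => k _ /=.
by rewrite pi_D_conj -scalerAr mulr1 linearZ mulrC.
Qed.

Variables (f : 'I_d -> K) (chi : B).
Hypothesis eig : forall i, \sum_j f j *: cf i j = f i *: chi.
Variable i0 : 'I_d.
Hypothesis f0 : f i0 != 0.

(** The first-order approximation: its left derivatives along G_ev are multiples of the character
    [chi], and its right derivatives are constants. *)
Let z0 := \sum_j f j *: z j.

Let pi_Lz0 i : pi (L (x i) z0) = f i *: chi.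
Proof.
by rewrite /z0 (raddf_sum (L (x i))) /= smor_sum -eig; apply: eq_bigr => j _; rewrite linearZ smorZ.
Qed.

Let pi_Dz0 i : pi (D (x i) z0) = (f i)%:A.
Proof.
rewrite /z0 (raddf_sum (D (x i))) /= smor_sum (bigD1 i) //= big1 => [|j nji].
  by rewrite linearZ smorZ Dz eqxx addr0.
by rewrite linearZ smorZ Dz eq_sym (negbTE nji) scaler0.
Qed.

Let h i j := brk (x i) (x j).

Let pi_h_const i j a k : pi a = k%:A -> pi (h i j a) = 0.
Proof.
move=> e; have : Ip 1 (a - k%:A).
  by apply/(pi_ker pi_ev E_ev); rewrite smorB e smorZ smor1 subrr.
move=> /(brk_Ip1 (xd i) (xd j))/piI.
by rewrite raddfB /= linearZ /= brk1 // scaler0 subr0.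
Qed.

Let chi_lift : exists c, pi c = chi. Proof. exact: restr_surj. Qed.

(* [q] is the obstruction to [D (x i) z] being exactly [f i]. *)
Let q i j := eps (h i j (sval (cid chi_lift))).

(** The bracket kills D_i z0, which is constant along G_ev. In the other term D_i is turned at the
    identity into a left derivative, which commutes with the bracket and gives f_i [chi] along
    G_ev. *)
Let key3 i j k : eps (brk2 (x j) (x k) (x i) z0) = f i * q j k.
Proof.
rewrite /brk2 raddfB /= -[eps (brk _ _ _)]eps_piE -/(h _ _ _).
rewrite (pi_h_const _ _ (pi_Dz0 i)) raddf0 subr0.
rewrite eps_D -eps_L -(brk_linv _ _).
rewrite /q; case: cid => c /= pc.
have : Ip 1 (L (x i) z0 - f i *: c).
  by apply/(pi_ker pi_ev E_ev); rewrite smorB pi_Lz0 smorZ pc subrr.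
move=> /(brk_Ip1 (xd j) (xd k))/piI/(congr1 (@eps K E)).
rewrite eps_piE raddf0 raddfB /= linearZ /= raddfB /= linearZ /=.
by move/subr0_eq.
Qed.

Let qC i j : q i j = q j i. Proof. by rewrite /q /h /brk addrC. Qed.

(* On the diagonal the Jacobi identity below only gives this up to a factor 3. *)
Let q_diag i : f i * q i i = 0.
Proof. by rewrite -key3 /brk2 /brk [D _ (_ + _)]raddfD /= subrr raddf0. Qed.

Let q_jacobi i j k : f i * q j k + f j * q k i + f k * q i j = 0.
Proof.
rewrite -!key3 -!raddfD /brk2 /brk ![D _ (_ + _)]raddfD /=.
by rewrite jacobi_cancel raddf0.
Qed.

Let q00 : q i0 i0 = 0.
Proof. by have /eqP := q_diag i0; rewrite mulf_eq0 (negbTE f0) => /eqP. Qed.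

(** Jacobi on (i0, i0, k) gives 2 f_i0 q(i0, k) = 0 because q(i0, i0) = 0. Jacobi on (i0, i, j) then
    kills every other entry. *)
Let q0 k : q i0 k = 0.
Proof.
have := q_jacobi i0 i0 k; rewrite q00 mulr0 addr0 [q k i0]qC => /(addvv_eq0 (V := K^o) two_neq0).
by move/eqP; rewrite mulf_eq0 (negbTE f0) => /eqP.
Qed.

Let qE i j : q i j = 0.
Proof.
have := q_jacobi i0 i j; rewrite [q j i0]qC !q0 !mulr0 !addr0 => /eqP.
by rewrite mulf_eq0 (negbTE f0) => /eqP.
Qed.

Let brk2_z0 i j k : eps (brk2 (x j) (x k) (x i) z0) = 0.
Proof. by rewrite key3 qE mulr0. Qed.

Let phi (S : {set 'I_d}) : B := \sum_i (S == [set i])%:R * (f i)%:A.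

(** The prescribed coefficients live on singletons. Coefficients of odd order see only the odd part
    of an element, and those of even order vanish on it, so passing to the odd part changes
    nothing. *)
Lemma ex_zz : exists zz : A, zz \in homog A true /\
  forall S : {set 'I_d}, pi (Dl x (enum S) zz) = phi S.
Proof.
have [a ha] := Taylor_surj pi_ev E_ev xd zo Dz phi.
exists (pr true a); split=> [|S]; first exact: pr_homog.
have par s b c : c \in homog A b -> Dl x s c \in homog A (odd (size s) (+) b).
  by move=> hc; elim: s => //= i s IH; rewrite addNb; apply: od_D_homog.
have [o|e] := boolP (odd #|S|).
  rewrite -ha -[in RHS](pr_sum a) raddfD smorD [X in X + _](pi_odd pi E_ev) ?add0r //.
  by have := par (enum S) false _ (pr_homog false a); rewrite -cardE o.
rewrite (pi_odd pi E_ev); last by have := par (enum S) true _ (pr_homog true a); rewrite -cardE (negbTE e).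
rewrite /phi big1 // => i _; case: eqP => [eS|_]; last by rewrite mul0r.
by move: e; rewrite eS cards1.
Qed.

Section Solution.
Variable zz : A.
Hypotheses (zzo : zz \in homog A true) (zzE : forall S : {set 'I_d}, pi (Dl x (enum S) zz) = phi S).

Let T s := pi (Dl x s zz).

Let T0 : T [::] = 0.
Proof. exact: (pi_odd pi E_ev). Qed.

Let T1 i : T [:: i] = (f i)%:A.
Proof.
rewrite /T -enum_set1 zzE /phi (bigD1 i) //= eqxx mul1r big1 ?addr0 // => j nji.
by rewrite (inj_eq set1_inj) eq_sym (negbTE nji) mul0r.
Qed.

Let T_const n s : (forall s', (1 < size s' < n)%N -> T s' = 0) -> (size s < n)%N ->
  exists k : K, T s = k%:A.
Proof.
move=> IH sn; case: s sn => [|i [|j s]] sn.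
- by exists 0; rewrite T0 scale0r.
- by exists (f i).
by exists 0; rewrite scale0r IH.
Qed.

(** The bracket is moved to the front of the word. There it acts on a coefficient that is constant
    along G_ev and gives 0. Each move past a letter costs a triple bracket, that is a combination of
    words with n - 2 letters. *)
Let T_brk n s1 i j s2 : (forall s', (1 < size s' < n)%N -> T s' = 0) ->
  (size s1 + size s2).+2 = n -> pi (Dl x s1 (h i j (Dl x s2 zz))) = 0.
Proof.
move=> IH; elim/last_ind: s1 s2 => [|s1 k IHs] s2 e.
  have [k hk] : exists k : K, T s2 = k%:A.
    by apply: (@T_const n) => //; rewrite -e /= ltnS leqW.
  exact: pi_h_const hk.
rewrite Dl_rcons -[D _ _](subrK (h i j (D (x k) (Dl x s2 zz)))) raddfD smorD /=.
rewrite [X in _ + X](IHs (k :: s2)) ?addr0; last by rewrite -e size_rcons addSnnS.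
rewrite -[X in Dl x s1 X]/(brk2 (x i) (x j) (x k) (Dl x s2 zz)) brk2E //.
pose y : {scalar A} := @eps K G \o brk2 (x i) (x j) (x k).
have yd : odd_der y by apply: brk2_od.
have yE a : D y a = \sum_l y (w l) *: D (x l) a.
  transitivity (rgt (fun b => \sum_l y (w l) * x l b) (comul G a)).
    by apply: tlift_eq => b c; rewrite -(od_expand gw xd xw).
  rewrite /rgt /tensor_lift /tsum.
  under eq_bigr do rewrite scaler_suml.
  rewrite exchange_big; apply: eq_bigr => l _.
  rewrite /D /rgt /tensor_lift /tsum scaler_sumr; apply: eq_bigr => p _.
  by rewrite scalerA.
rewrite -[D _ _]/(D y _) yE raddf_sum smor_sum /=.
have cat_T l : pi (Dl x s1 (D (x l) (Dl x s2 zz))) = T (s1 ++ l :: s2).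
  by rewrite /T Dl_cat.
under eq_bigr do rewrite linearZ smorZ cat_T.
(* Words of length at least 2 vanish by the induction hypothesis. When a single letter is left, the
   sum is the triple bracket evaluated on [z0], and this is where the vanishing of q enters. *)
have [es|] := eqVneq (size s1 + size s2)%N 0%N; last first.
  rewrite -lt0n => ps; rewrite big1 // => l _; rewrite IH ?scaler0 //.
  by rewrite size_cat /= addnS ltnS ps -e size_rcons addSn !ltnS leqW.
case: s1 s2 es {IHs e cat_T} => [|//] [|//] _.
have := brk2_z0 k i j; rewrite -[LHS]/(y z0) => ez.
under eq_bigr do rewrite T1 scalerA; rewrite -scaler_suml.
suff -> : \sum_l y (w l) * f l = y z0 by rewrite ez scale0r.
have yz l : y (z l) = y (w l).
  rewrite (od_expand gw xd xw _ yd) (bigD1 l) //= xz eqxx mulr1 big1 ?addr0 // => m nml.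
  by rewrite xz (negbTE nml) mulr0.
have -> : y z0 = \sum_l f l * y (z l).
  by rewrite [LHS](raddf_sum y); apply: eq_bigr => l _; exact: scalarZ.
by apply: eq_bigr => l _; rewrite yz mulrC.
Qed.

(** By [T_brk] transposing two neighbours changes the sign. A repeated letter gives T + T = 0, and a
    word without repetition reduces to an [enum S], whose coefficient was prescribed to be 0. *)
Let T_big n s : size s = n -> (1 < n)%N -> T s = 0.
Proof.
elim/ltn_ind: n s => n IH s es n1.
have IH' s' : (1 < size s' < n)%N -> T s' = 0 by move=> /andP[? lt]; apply: IH lt _ _ _.
have brkE s1 i j s2 : (size s1 + size s2).+2 = n ->
    T (s1 ++ i :: j :: s2) + T (s1 ++ j :: i :: s2) = 0.
  move=> e; rewrite -(T_brk i j IH' e) /T !Dl_cat -smorD -raddfD.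
  by [].
apply: (perm_adjacent_ind (P := fun s => size s = n -> T s = 0)) es => {s}.
- move=> s1 i j s2 P0; rewrite size_cat /= => e.
  have e' : (size s1 + size s2).+2 = n by rewrite -e !addnS.
  by have := brkE s1 i j s2 e'; rewrite P0 ?add0r // size_cat /= !addnS.
- by move=> i s /= e; have := brkE [::] i i s e; apply: addvv_eq0.
move=> S eS; rewrite /T zzE /phi big1 // => i _; case: eqP => [e|_]; last by rewrite mul0r.
by move: n1; rewrite -eS e enum_set1.
Qed.

Let inj0 a : pi a = 0 -> (forall i, D (x i) a = 0) -> a = 0.
Proof.
move=> pa Da; apply: (Taylor_inj two_neq0 pi_ev E_ev xd zo Dz zgen IpN) => S.
case/lastP: (enum S) => [|s i]; first exact: pa.
by rewrite Dl_rcons Da raddf0 smor0.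
Qed.

Let Dl_1 s i : Dl x (rcons s i) 1 = 0.
Proof. by rewrite Dl_rcons D1 od_1 // scale0r raddf0. Qed.

(** The Taylor coefficients of the derivative are those of [zz] along words ending in i: the
    constant f_i for the empty word, and 0 by [T_big] for all longer ones. *)
Lemma D_zz i : D (x i) zz = (f i)%:A.
Proof.
apply/eqP; rewrite -subr_eq0; apply/eqP.
apply: (Taylor_inj two_neq0 pi_ev E_ev xd zo Dz zgen IpN) => S.
rewrite raddfB /= smorB linearZ /= -Dl_rcons.
case/lastP: (enum S) => [|s j].
  by rewrite -[pi (Dl _ _ _)]/(T [:: i]) T1 smorZ smor1 subrr.
rewrite Dl_1 scaler0 smor0 subr0; apply: (T_big erefl).
by rewrite !size_rcons.
Qed.

Lemma D_mu_zz (mu : {scalar B}) : D (mu \o pi) zz = mu chi *: zz.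
Proof.
apply/eqP; rewrite -subr_eq0; apply/eqP; apply: inj0 => [|i].
  rewrite smorB smorZ (pi_odd pi E_ev zzo) scaler0 subr0 pi_D (pi_odd pi E_ev zzo).
  exact: raddf0.
rewrite raddfB /= linearZ /= D_conj D_zz.
under eq_bigr do rewrite D_zz linearZ /= D1 scalerA /= smor1 /mulf mulr1.
rewrite -scaler_suml scalerA -scalerBl.
suff -> : \sum_j f j * mu (cf i j) = mu chi * f i by rewrite subrr scale0r.
rewrite mulrC -[RHS]scalarZ -eig (raddf_sum mu); apply: eq_bigr => j _.
by rewrite [RHS]scalarZ.
Qed.

(** Forced by [L_zz] at v = x_i0, where v 1 = 0 and v zz = f_i0. It lifts the character [chi]. *)
Let g := (f i0)^-1 *: L (x i0) zz.

(** This is the coproduct formula contracted with v on the left. Both sides have the same image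
    under [pi] and, since [L v] commutes with the D_i, the same odd derivatives; by Taylor
    injectivity they agree. *)
Lemma L_zz (v : {scalar A}) : L v zz = v 1 *: zz + v zz *: g.
Proof.
have pi_Lzz (u : {scalar A}) : pi (L u zz) = u zz *: chi.
  apply: functional_eq => mu; rewrite -[LHS]/((mu \o pi) _) -D_L D_mu_zz !linearZ /=.
  exact: mulrC.
have x0zz : x i0 zz = f i0.
  by rewrite -eps_D D_zz linearZ rmorph1 /= mulr1.
apply/eqP; rewrite -subr_eq0 opprD addrA; apply/eqP; apply: inj0 => [|i].
  rewrite !smorB !smorZ !pi_Lzz (pi_odd pi E_ev zzo) scaler0 subr0 x0zz.
  by rewrite (scalerA (f i0)^-1) mulVf // scale1r subrr.
rewrite !raddfB /= !linearZ /= !DL_comm !D_zz ![L _ _]linearZ /= !L1 (od_1 (xd i0)).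
by rewrite scale0r !(scaler0, oppr0) addr0 scalerN !scalerA mulrC subrr.
Qed.

Lemma twisted_primitive_aux : exists z g : A,
  [/\ z \in homog A true, g \in homog A false,
     comul G z = pure 1 z + pure z g :> tensor A A
   & exists y : {scalar A}, odd_der y /\ y z != 0].
Proof.
exists zz, g; split=> //.
- exact: (homogZ _ (od_L_homog (xd i0) zzo)).
- apply/eqP; rewrite -subr_eq0; apply/eqP/tensor_sepl => v.
  rewrite -/(lft v _) raddfB raddfD /= !lft_pure -/(L v zz) L_zz.
  exact: subrr.
by exists (x i0); split=> //; rewrite -eps_D D_zz linearZ rmorph1 /= mulr1.
Qed.

End Solution.
End TwistedPrimitive.

Lemma twisted_primitive (K : fieldType) (G E : supergroup K) (pi : closed_subgroup E G) d N :
  (2%:R : K) != 0 -> is_even_part pi -> affine_group E -> pointed E ->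
  (0 < d)%N -> odd_rank G d -> (forall e, (e < d)%N -> ~ odd_rank G e) ->
  (forall a : Defs.coord G, Ip N a -> a = 0) ->
  exists z g : Defs.coord G,
  [/\ z \in homog (Defs.coord G) true, g \in homog (Defs.coord G) false,
     comul G z = pure 1 z + pure z g :> tensor _ _
   & exists y : {scalar (Defs.coord G)}, odd_der y /\ y z != 0].
Proof.
move=> two pi_ev E_ev ptE d0 [w gw] dmin IpN.
have [x [xd xw]] := dual_odd_ders gw dmin.
have [f [[i0 fi0] [chi eig]]] := ptE _ _ d0 (cf_comodule pi_ev E_ev gw xd xw).
have [zz [zzo zzE]] := ex_zz pi_ev E_ev xd xw f.
exact: (twisted_primitive_aux two pi_ev E_ev gw xd xw IpN eig fi0 zzo zzE).
Qed.

(** * Pointed affine groups *)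

Section FiniteFamilies.
Variables (K : fieldType) (V : lmodType K).

Definition ispan m (e : 'I_m -> V) (v : V) := exists al : 'I_m -> K, v = \sum_k al k *: e k.

Lemma ispan_lin m (e : 'I_m -> V) : linclosed (ispan e).
Proof.
split=> [|k _ _ [a ->] [b ->]]; first by exists (fun=> 0); rewrite big1 // => i _; rewrite scale0r.
exists (fun i => k * a i + b i); rewrite scaler_sumr -big_split; apply: eq_bigr => i _.
by rewrite scalerDl scalerA.
Qed.

Lemma ispan_mem m (e : 'I_m -> V) k : ispan e (e k).
Proof.
exists (fun j => (j == k)%:R); rewrite (bigD1 k) //= eqxx scale1r big1 ?addr0 // => j /negbTE ->.
by rewrite scale0r.
Qed.

Lemma ispan_sub m (e : 'I_m -> V) U v : linclosed U -> (forall k, U (e k)) -> ispan e v -> U v.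
Proof.
by move=> lU hU [al ->]; apply: (linclosed_sum lU) => k _; apply: (linclosedZ lU).
Qed.

Lemma scalar_dual m (mu : {scalar V}) (e : 'I_m -> V) al i :
  (forall j, mu (e j) = (i == j)%:R) -> mu (\sum_k al k *: e k) = al i.
Proof.
move=> h; rewrite raddf_sum (bigD1 i) //= linearZ /= h eqxx mulr1 big1 ?addr0 // => k nki.
by rewrite linearZ /= h eq_sym (negbTE nki) mulr0.
Qed.

Definition dual_family m (mu : 'I_m -> {scalar V}) (e : 'I_m -> V) :=
  forall i j, mu i (e j) = (i == j)%:R.

Lemma dual_or_dependent m (e : 'I_m.+1 -> V) :
  (exists mu, dual_family mu e) \/ exists l, ispan (e \o lift l) (e l).
Proof.
have [[l hl]|nl] := pselect (exists l, ispan (e \o lift l) (e l)); first by right; exists l.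
left; have ex l : exists mu : {scalar V}, forall j, mu (e j) = (l == j)%:R.
  have [||mu [m1 m0]] := @functional_sep K V (ispan (e \o lift l)) (e l).
  - exact: ispan_lin.
  - by move=> h; apply: nl; exists l.
  exists mu => j; case: (unliftP l j) => [k ->|->]; last by rewrite eqxx.
  by rewrite (negbTE (neq_lift l k)); apply: m0; apply: (ispan_mem (e \o lift l)).
exists (fun l => sval (cid (ex l))) => i j; by case: cid.
Qed.

Lemma ispan_lift m (e : 'I_m.+1 -> V) l v : ispan (e \o lift l) (e l) ->
  ispan e v -> ispan (e \o lift l) v.
Proof.
move=> hl; apply: ispan_sub => [|k]; first exact: ispan_lin.
by case: (unliftP l k) => [j ->|-> //]; apply: (ispan_mem (e \o lift l)).
Qed.

Lemma spanning_basis m (e : 'I_m -> V) : exists n (b : 'I_n -> V) (mu : 'I_n -> {scalar V}),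
  dual_family mu b /\ (forall v, ispan e v -> ispan b v) /\ (forall k, ispan e (b k)).
Proof.
elim: m e => [|m IH] e.
  by exists 0, e, (fun=> \0 : {scalar V}); split=> [[]//|]; split=> // -[].
have [[mu h]|[l hl]] := dual_or_dependent e.
  by exists m.+1, e, mu; do 2!split=> //; apply: ispan_mem.
have [n [b [mu [h [h1 h2]]]]] := IH (e \o lift l).
exists n, b, mu; split=> //; split=> [v hv|k]; first exact/h1/ispan_lift.
by apply: (@ispan_sub _ (e \o lift l)) (h2 k) => [|j]; [apply: ispan_lin | apply: ispan_mem].
Qed.

End FiniteFamilies.

(** As long as one right factor depends on the others it can be absorbed; what is left has
    independent right factors, hence dual functionals. *)
Lemma tensor_rep (K : fieldType) (V W : lmodType K) (t : tensor V W) :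
  exists n (v : 'I_n -> V) (w : 'I_n -> W) (mu : 'I_n -> {scalar W}),
    dual_family mu w /\ t = \sum_k pure (v k) (w k).
Proof.
have [n [v [w ->]]] : exists n (v : 'I_n -> V) (w : 'I_n -> W), t = \sum_k pure (v k) (w k).
  exists (size (repr t)), (fun k => (nth (0, 0) (repr t) k).1), (fun k => (nth (0, 0) (repr t) k).2).
  by rewrite {1}[t]tensorE (big_nth (0, 0)) big_mkord.
elim: n v w => [|n IH] v w; first by exists 0, v, w, (fun=> \0 : {scalar W}); split=> // -[].
have [[mu h]|[l [be hl]]] := dual_or_dependent w; first by exists n.+1, v, w, mu.
have [m [v' [w' [mu [h e]]]]] := IH (fun k => v (lift l k) + be k *: v l) (w \o lift l).
exists m, v', w', mu; split=> //; rewrite -e (bigD1_ord l) //= hl addrC.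
under [RHS]eq_bigr do rewrite pureDl pureZl -pureZr.
rewrite big_split /=; congr (_ + _).
by elim/big_ind2: _ => //; [rewrite pure0r | move=> ? ? ? ? <- <-; rewrite pureDr].
Qed.

(** * Comodule matrices as modules *)

Section MatrixModule.
Variables (K : fieldType) (E : supergroup K) (d : nat).
Local Notation B := (Defs.coord E).
Variable c : 'I_d -> 'I_d -> B.
Hypothesis cc : comodule_matrix c.
Local Notation V := ('rV[K]_d : lmodType K).

Definition ct (R : lmodType K) j (t : tensor V R) : R :=
  tensor_lift (fun (v : V) r => v 0 j *: r) t.

Lemma ct_bilin (R : lmodType K) j : bilin (fun (v : V) (r : R) => v 0 j *: r).
Proof.
split=> [r|v] k x y; first by rewrite !mxE scalerDl scalerA.
by rewrite scalerDr !scalerA mulrC.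
Qed.

Lemma ct_linear (R : lmodType K) j : linear (@ct R j).
Proof. exact/tlift_linear/ct_bilin. Qed.
HB.instance Definition _ (R : lmodType K) j :=
  GRing.isLinear.Build K (tensor V R) R *:%R (@ct R j) (@ct_linear R j).

Lemma ct_pure (R : lmodType K) j v (r : R) : ct j (pure v r) = v 0 j *: r.
Proof. exact/tlift_pure/ct_bilin. Qed.

Lemma ct_sum (R : lmodType K) (t : tensor V R) : t = \sum_j pure (delta_mx 0 j) (ct j t).
Proof.
elim/tensor_ind: t => [|s t hs ht|v r].
- by rewrite big1 // => j _; rewrite linear0 pure0r.
- rewrite {1}hs {1}ht -big_split; apply: eq_bigr => j _ /=.
  by rewrite linearD pureDr.
under eq_bigr do rewrite ct_pure pureZr -pureZl.
rewrite {1}[v]row_sum_delta; elim/big_ind2: _ => //; first by rewrite pure0l.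
by move=> ? ? ? ? <- <-; rewrite pureDl.
Qed.

Lemma ct_inj (R : lmodType K) (s t : tensor V R) : (forall j, ct j s = ct j t) -> s = t.
Proof. by move=> h; rewrite [s]ct_sum [t]ct_sum; apply: eq_bigr => j _; rewrite h. Qed.

Lemma ct_map (R S : lmodType K) (f : R -> S) j (t : tensor V R) : linear f ->
  ct j (tensor_mapr f t) = f (ct j t).
Proof.
move=> fl; rewrite /tensor_mapr (lin_tlift _ _ (@ct_linear S j)) (lin_tlift _ _ fl).
apply: tlift_eq => v r; rewrite ct_pure.
have f0 : f 0 = 0 by have := fl (-1) 0 0; rewrite scaler0 addr0 scaleN1r addNr.
by have := fl (v 0 j) r 0; rewrite f0 !addr0.
Qed.

Definition mact (R : superalg K) (g : E R) (t : tensor V R) : tensor V R :=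
  \sum_i pure (delta_mx 0 i) (\sum_j (g : smor B R) (c i j) * ct j t).

Lemma ct_mact (R : superalg K) (g : E R) t i :
  ct i (mact g t) = \sum_j (g : smor B R) (c i j) * ct j t.
Proof.
rewrite /mact linear_sum (bigD1 i) //= ct_pure mxE !eqxx scale1r [X in _ + X]big1 ?addr0 // => k nki.
by rewrite ct_pure mxE eq_sym (negbTE nki) andbF scale0r.
Qed.

Lemma mact_linear (R : superalg K) (g : E R) : linear (mact g).
Proof.
move=> k s t; apply: ct_inj => i; rewrite linearP /= !ct_mact scaler_sumr -big_split.
by apply: eq_bigr => j _; rewrite linearP /= mulrDr scalerAr.
Qed.
HB.instance Definition _ (R : superalg K) (g : E R) :=
  GRing.isLinear.Build K (tensor V R) (tensor V R) *:%R (mact g) (mact_linear g).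

Lemma mactZ (R : superalg K) (g : E R) (r : R) t :
  mact g (tensor_mapr ( *%R^~ r) t) = tensor_mapr ( *%R^~ r) (mact g t).
Proof.
apply: ct_inj => i; rewrite ct_mact !ct_map; try exact: mulrr_linear.
rewrite ct_mact mulr_suml; apply: eq_bigr => j _.
by rewrite ct_map ?mulrA //; exact: mulrr_linear.
Qed.

Lemma mact1 (R : superalg K) t : mact (gone E R) t = t.
Proof.
apply: ct_inj => i; rewrite ct_mact (bigD1 i) //= big1 => [|j nji].
  by rewrite goneE cc.2 eqxx scale1r mul1r addr0.
by rewrite goneE cc.2 eq_sym (negbTE nji) scale0r mul0r.
Qed.

Lemma comodule_gmul (R : superalg K) (g h : smor B R) i j :
  (gmul E (g : E R) (h : E R) : smor B R) (c i j) = \sum_k g (c i k) * h (c k j).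
Proof.
rewrite gmulE cc.1 tlift_sum; last exact: tpair_bilin.
by apply: eq_bigr => k _; apply/tlift_pure/tpair_bilin.
Qed.

Lemma mactM (R : superalg K) (g h : E R) t : mact (gmul E g h) t = mact g (mact h t).
Proof.
apply: ct_inj => i; rewrite !ct_mact; under eq_bigr do rewrite comodule_gmul mulr_suml.
rewrite exchange_big; apply: eq_bigr => k _ /=; rewrite ct_mact mulr_sumr.
by apply: eq_bigr => j _; rewrite mulrA.
Qed.

Lemma mact_nat (R S : superalg K) (f : smor R S) (g : E R) t :
  mact (fmap f g) (tensor_mapr f t) = tensor_mapr f (mact g t).
Proof.
have fl : linear f by move=> k x y; rewrite smorD smorZ.
apply: ct_inj => i; rewrite ct_mact ct_map // ct_mact smor_sum; apply: eq_bigr => j _.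
by rewrite ct_map // smorM.
Qed.

Definition matrix_module : gmodule E := GModule mactZ mact1 mactM mact_nat.

End MatrixModule.

(** A matrix of maximal rank among those with all rows in U spans U, since adjoining a missing
    vector would raise the rank. *)
Lemma rowspaceP (K : fieldType) d (U : 'rV[K]_d -> Prop) : linclosed U ->
  exists u : 'M[K]_d, forall v, U v <-> (v <= u)%MS.
Proof.
move=> lU; pose P n := `[< exists u : 'M[K]_d, (forall i, U (row i u)) /\ \rank u = n >].
have P0 : exists n, P n.
  exists 0%N; apply/asboolP; exists 0; rewrite mxrank0; split=> // i.
  by rewrite row0; apply: lU.1.
have Pd n : P n -> (n <= d)%N by move=> /asboolP[u [_ <-]]; apply: rank_leq_row.
have Ucomb m (a : 'M[K]_m.+1) (u : 'M[K]_(m.+1, d)) : True by [].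
have Umul (u : 'M[K]_d) (a : 'rV_d) : (forall i, U (row i u)) -> U (a *m u).
  by move=> hu; rewrite mulmx_sum_row; apply: (linclosed_sum lU) => i _; apply: linclosedZ.
case: (ex_maxnP P0 Pd) => n /asboolP[u [hu ru]] nmax; exists u => v; split=> [hv|]; last first.
  by case/submxP => a ->; apply: Umul.
apply: contraT => nvu; have : P (\rank (u + v)%MS).
  apply/asboolP; exists (u + v)%MS; split=> // i.
  have /sub_addsmxP[[a b] /= ->] := row_sub i (u + v)%MS.
  apply: linclosedD => //; first exact: Umul.
  by rewrite [b]mx11_scalar mul_scalar_mx; apply: linclosedZ.
move=> /nmax; rewrite -ru leqNgt => /negP[]; apply: rank_ltmx.
by rewrite ltmxE addsmxSl /= addsmx_sub submx_refl.
Qed.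

(** Induction on the size. A module of dimension at least 2 is not simple, hence has a proper
    nonzero submodule; an eigenvector for the matrix of the submodule is pushed forward to the whole
    space. *)
Lemma trig_pointed (K : fieldType) (E : supergroup K) :
  trigonalizable_group E -> pointed E.
Proof.
move=> [_ _ trig]; elim/ltn_ind => d IH c d0 cc.
have [d1|nd1] := eqVneq d 1%N.
  subst d; exists (fun=> 1); split; first by exists 0; rewrite oner_eq0.
  by exists (c 0 0) => i; rewrite big_ord1 [i]ord1.
pose V := matrix_module cc.
have nV : ~ simple_module V.
  move=> /trig[v nv hv].
  have d2 : (1 < d)%N by case: d d0 nd1 {IH c cc V v nv hv} => [|[]].
  pose i : 'I_d := Ordinal d0; pose j : 'I_d := Ordinal d2.
  have [k ek] := hv (delta_mx 0 i : 'rV_d); have [l el] := hv (delta_mx 0 j : 'rV_d).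
  have /rowP ei := ek; have /rowP ej := el.
  have := ei i; have := ei j; have := ej j; rewrite !mxE !eqxx /=.
  move=> hl hk hi; have k0 : k != 0.
    by apply/eqP => k0; move: hi; rewrite k0 mul0r => /eqP; rewrite oner_eq0.
  move/esym/eqP: hk; rewrite mulf_eq0 (negbTE k0) /= => /eqP vj.
  by move/eqP: hl; rewrite vj mulr0 oner_eq0.
have [U [[lU sU] [Unz Unf]]] : exists U : {pred V}, submodule U /\
    ~ (forall v, v \in U -> v = 0) /\ ~ (forall v, v \in U).
  apply: contrapT => nex; apply: nV; split.
    exists (delta_mx 0 (Ordinal d0) : 'rV_d); apply/eqP => /rowP/(_ (Ordinal d0)).
    by rewrite !mxE !eqxx => /eqP; rewrite oner_eq0.
  move=> U sU; have [h|h] := pselect (forall v, v \in U -> v = 0); first by left.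
  right; apply: contrapT => h'; apply: nex; by exists U.
have [u hu] := rowspaceP (U := fun v : 'rV_d => v \in U) lU.
set r := \rank u; pose m := row_base u; pose p := pinvmx m.
have mp : m *m p = 1%:M by apply: mulmxVp; apply: row_base_free.
have mU i : row i m \in U.
  by apply/hu; apply: submx_trans (row_sub _ _) _; rewrite eq_row_base.
have Um v : v \in U -> v *m p *m m = v.
  by move=> /hu; rewrite -(eq_row_base u) => h; apply: mulmxKpV.
have r0 : (0 < r)%N.
  rewrite lt0n; apply/eqP => r0; apply: Unz => v /hu.
  by move/eqP: r0; rewrite mxrank_eq0 => /eqP ->; rewrite submx0 => /eqP.
have rd : (r < d)%N.
  rewrite ltn_neqAle rank_leq_row andbT; apply/negP => rd; apply: Unf => v; apply/hu.
  by apply: submx_full; rewrite /row_full -/r.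
(* The coaction on the submodule in the basis given by the rows of [m], whose right inverse [p]
   reads off coordinates. *)
pose c' i j := \sum_a \sum_b (p a i * m j b) *: c a b.
have stab j k : \sum_l m l k *: c' l j = \sum_b m j b *: c k b.
  (* Stability is applied to the universal point, which makes it an identity in the coordinate
     algebra. *)
  have [s [hs e]] : in_tensor_sub U (mact c (smor_id _ : E _) (pure (row j m) 1)).
    apply: sU; exists [:: (row j m, 1)]; rewrite big_seq1; split=> // q.
    by rewrite inE => /eqP -> /=; apply: mU.
  have cE a : \sum_b m j b *: c a b = \sum_(q <- s) q.1 0 a *: q.2.
    have := congr1 (ct a) e; rewrite ct_mact.
    under eq_bigr do rewrite /= ct_pure mxE -scalerAr mulr1.
    move=> ->; rewrite linear_sum; apply: eq_bigr => q _; exact: ct_pure.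
  have c'E l : c' l j = \sum_(q <- s) (q.1 *m p) 0 l *: q.2.
    rewrite /c'; under eq_bigr => a _.
      under eq_bigr do rewrite -scalerA.
      rewrite -scaler_sumr cE scaler_sumr; over.
    rewrite exchange_big; apply: eq_bigr => q _; rewrite mxE scaler_suml.
    by apply: eq_bigr => a _; rewrite scalerA mulrC.
  rewrite cE; under eq_bigr do rewrite c'E scaler_sumr.
  rewrite exchange_big [LHS]big_seq [RHS]big_seq; apply: eq_bigr => q qs.
  rewrite -{2}(Um _ (hs _ qs)) mxE scaler_suml; apply: eq_bigr => l _.
  by rewrite scalerA mulrC.
have cc' : comodule_matrix c'.
  split=> i j; last first.
    transitivity ((m *m p) j i); last by rewrite mp mxE eq_sym.
    rewrite mxE raddf_sum; apply: eq_bigr => a _ /=.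
    by rewrite (scalar_dual _ (cc.2 a)) mulrC.
  transitivity (\sum_a \sum_b \sum_k (p a i * m j b) *: pure (c a k) (c k b)).
    rewrite /c' smor_sum; apply: eq_bigr => a _; rewrite smor_sum; apply: eq_bigr => b _.
    by rewrite smorZ cc.1 scaler_sumr.
  transitivity (\sum_a \sum_k p a i *: pure (c a k) (\sum_l m l k *: c' l j)).
    apply: eq_bigr => a _; rewrite exchange_big; apply: eq_bigr => k _ /=.
    rewrite stab (big_morph _ (pureDr _) (pure0r _ _)) scaler_sumr.
    by apply: eq_bigr => b _; rewrite pureZr scalerA.
  under eq_bigr => a _.
    under eq_bigr => k _.
      rewrite (big_morph _ (pureDr _) (pure0r _ _)) scaler_sumr.
      under eq_bigr do rewrite pureZr -pureZl -pureZl scalerA.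
      over.
    rewrite exchange_big; over.
  rewrite exchange_big; apply: eq_bigr => l _ /=.
  have pureDlm (w : Defs.coord E) : {morph (fun v : Defs.coord E => pure v w) : v v' / v + v'}.
    by move=> v v'; apply: pureDl.
  under eq_bigr do rewrite -(big_morph _ (pureDlm _) (pure0l _ _)).
  by rewrite -(big_morph _ (pureDlm _) (pure0l _ _)).
have [f' [[i fi] [chi hf]]] := IH _ rd _ r0 cc'.
pose f b := \sum_j f' j * m j b.
exists f; split.
  apply: contrapT => nf; have f0 b : f b = 0.
    by apply/eqP; apply: contraT => fb; case: nf; exists b.
  move/eqP: fi; apply; have -> : f' i = ((\row_j f' j) *m (m *m p)) 0 i.
    by rewrite mp mulmx1 mxE.
  rewrite mulmxA mxE big1 // => b _; rewrite mxE.
  by under eq_bigr do rewrite mxE; rewrite -/(f b) f0 mul0r.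
exists chi => a; transitivity (\sum_j f' j *: \sum_b m j b *: c a b).
  rewrite /f; under eq_bigr do rewrite scaler_suml.
  rewrite exchange_big; apply: eq_bigr => j _; rewrite scaler_sumr.
  by apply: eq_bigr => b _; rewrite scalerA.
under eq_bigr do rewrite -stab scaler_sumr.
rewrite exchange_big /f scaler_suml; apply: eq_bigr => l _ /=.
rewrite [f' l * _]mulrC -scalerA -hf scaler_sumr; apply: eq_bigr => j _.
by rewrite !scalerA mulrC.
Qed.

(** * The antipode and left eigenvectors *)

Section Antipode.
Variables (K : fieldType) (E : supergroup K).
Local Notation B := (Defs.coord E).

Lemma antipode_point (R : superalg K) (p : smor B R) :
  smor_comp p (antipode E) = ginv E (p : E R).
Proof.
have := ginv_nat E p (smor_id B : E B); rewrite /= => ->.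
by rewrite (_ : smor_comp p (smor_id B) = p) //; apply: smorP.
Qed.

Lemma eps_antipode a : eps (antipode E a) = eps a.
Proof.
rewrite !epsE /counit.
have e : smor_comp (gone E (base_superalg K)) (antipode E) = gone E (base_superalg K).
  by rewrite antipode_point -[LHS](gmul1 E) gmulgV.
by rewrite -[in RHS]e.
Qed.

Lemma comul_antipode a : affine_group E ->
  comul E (antipode E a) =
  tensor_lift (fun x y => pure (antipode E y) (antipode E x)) (comul E a) :> tensor B B.
Proof.
move=> E_ev; have e : smor_comp (comul E) (antipode E) =
    gmul E (ginv E (tinr B B : E _)) (ginv E (tinl B B : E _)).
  by rewrite antipode_point /comul unlock ginvM.
rewrite -[LHS]/(smor_comp (comul E) (antipode E) a) e gmulE -!antipode_point.
apply: tlift_eq => x y /=.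
have ev b : b \in homog B false by rewrite -[b]pr_sum (E_ev _ (pr_homog true b)) addr0 pr_homog.
rewrite [LHS](tmulH _ _ (ev _) (ev _)) scale1r.
by rewrite mul1r mulr1.
Qed.

Lemma antipode_mull a :
  tensor_lift (fun x y => antipode E x * y) (comul E a) = (eps a)%:A.
Proof.
have := congr1 (fun f : smor B B => f a) (gmulV E (smor_id B : E B)).
by rewrite gmulE goneE.
Qed.

(** The antipode of the transposed matrix is again a comodule matrix; let f and chi be its
    eigenvector and character, and y_k = sum_i f_i M_ik. Multiplying by M gives chi y_k = f_k, and
    commutativity gives f_k y_l = f_l y_k. So y is proportional to f. *)
Lemma left_eigen m (M : 'I_m -> 'I_m -> B) : pointed E -> affine_group E ->
  (0 < m)%N -> comodule_matrix M ->
  exists f : 'I_m -> K, (exists i, f i != 0) /\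
    exists chi, forall k, \sum_i f i *: M i k = f k *: chi.
Proof.
move=> ptE E_ev m0 cM.
have cS : comodule_matrix (fun i j => antipode E (M j i)).
  split=> i j; last by rewrite eps_antipode cM.2 eq_sym.
  have Sb : bilin (fun x y => pure (antipode E y) (antipode E x)).
    split=> [y|x] k u v; rewrite smorD smorZ.
      by rewrite pureDr pureZr.
    by rewrite pureDl pureZl.
  rewrite comul_antipode // cM.1 tlift_sum //; apply: eq_bigr => k _.
  exact: tlift_pure.
have [f [[l fl] [chi hf]]] := ptE _ _ m0 cS; exists f; split; first by exists l.
pose y k := \sum_i f i *: M i k.
have yE k : chi * y k = (f k)%:A.
  have aE j : \sum_i antipode E (M j i) * M i k = ((j == k)%:R)%:A.
    rewrite -cM.2 -antipode_mull cM.1.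
    have ab : bilin (fun x y => antipode E x * y).
      split=> [v|u] c a b; first by rewrite smorD smorZ mulrDl scalerAl.
      by rewrite mulrDr scalerAr.
    by rewrite tlift_sum //; apply: eq_bigr => i _; rewrite tlift_pure.
  rewrite /y mulr_sumr; transitivity (\sum_i \sum_j f j *: (antipode E (M j i) * M i k)).
    apply: eq_bigr => i _; rewrite -scalerAr scalerAl -hf mulr_suml.
    by apply: eq_bigr => j _; rewrite scalerAl.
  rewrite exchange_big (bigD1 k) //= -scaler_sumr aE eqxx scale1r big1 ?addr0 // => j njk.
  by rewrite -scaler_sumr aE (negbTE njk) scale0r scaler0.
exists ((f l)^-1 *: y l) => k; rewrite -/(y k) scalerA mulrC -scalerA.
suff -> : f k *: y l = f l *: y k by rewrite scalerA mulVf // scale1r.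
rewrite -[y l]mul1r -[y k]mul1r !scalerAl -!yE -!mulrA; congr (_ * _).
exact: purely_even_comm.
Qed.

End Antipode.

(** * Closed subgroups of pointed groups *)

Section ClosedSubgroups.
Variables (K : fieldType) (E N : supergroup K) (r : closed_subgroup N E).
Local Notation B := (Defs.coord E).
Local Notation C := (Defs.coord N).

(** The span of the family is a subcomodule of K[E] under right translations; the family itself may
    be dependent. *)
Definition stable m (e : 'I_m -> B) := forall (nu : {scalar B}) j, ispan e (D nu (e j)).

(** Local finiteness. If the coproduct of b is the sum of v_k (x) w_k with the w_k independent, each
    v_k is a translate of b, so the v_k span the smallest stable subspace containing b. *)
Lemma local_finite1 (b : B) : exists m (e : 'I_m -> B), stable e /\ ispan e b.
Proof.
have [m [v [w [mu [h e]]]]] := tensor_rep (comul E b).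
have DE (nu : {scalar B}) : D nu b = \sum_k nu (w k) *: v k.
  by rewrite /D e linear_sum; apply: eq_bigr => k _; apply: rgt_pure.
exists m, v; split; last by exists (fun k => eps (w k)); rewrite -DE D_eps.
move=> nu j; have -> : v j = D (mu j) b.
  rewrite DE (bigD1 j) //= h eqxx scale1r big1 ?addr0 // => k nkj.
  by rewrite h eq_sym (negbTE nkj) scale0r.
by rewrite D_comp; exists (fun k => nu (D (mu j) (w k))); rewrite DE.
Qed.

Lemma stable_join m n (e : 'I_m -> B) (e' : 'I_n -> B) : stable e -> stable e' ->
  exists g : 'I_(m + n) -> B, [/\ stable g, forall v, ispan e v -> ispan g v
    & forall v, ispan e' v -> ispan g v].
Proof.
move=> se se'; pose g k := match split k with inl i => e i | inr j => e' j end.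
have ge v : ispan e v -> ispan g v.
  apply: ispan_sub => [|i]; first exact: ispan_lin.
  by have := ispan_mem g (lshift n i); rewrite {2}/g (_ : split (lshift n i) = inl i) //; apply: (unsplitK (inl i)).
have ge' v : ispan e' v -> ispan g v.
  apply: ispan_sub => [|i]; first exact: ispan_lin.
  by have := ispan_mem g (rshift m i); rewrite {2}/g (_ : split (rshift m i) = inr i) //; apply: (unsplitK (inr i)).
exists g; split=> // nu k; rewrite [g k]/g; case: (split k) => i; [exact/ge/se | exact/ge'/se'].
Qed.

Lemma local_finite n (b : 'I_n -> B) :
  exists m (e : 'I_m -> B), stable e /\ forall i, ispan e (b i).
Proof.
elim: n b => [|n IH] b.
  by exists 0%N, (fun=> 0); split=> [nu|] [].
have [m [e [se he]]] := IH (b \o lift ord0); have [m' [e' [se' he']]] := local_finite1 (b ord0).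
have [g [sg ge ge']] := stable_join se se'.
exists (m + m')%N, g; split=> // i; case: (unliftP ord0 i) => [j|] ->; last exact: ge'.
exact/ge/he.
Qed.

(* Shrink a subcomodule of K[E] as long as its image in K[N] still contains the
   entries of a nontrivial combination of the columns of [c]; when an invariant
   hyperplane of it no longer does, that combination is the eigenvector. *)
Lemma pointed_sub : affine_group E -> pointed E -> pointed N.
Proof.
move=> E_ev ptE d c d0 cc.
pose goal := exists f : 'I_d -> K, (exists i, f i != 0) /\
    exists chi, forall i, \sum_j f j *: c i j = f i *: chi.
pose good m (e : 'I_m -> B) := exists be : 'I_d -> K, (exists i, be i != 0) /\
  forall i, exists v, ispan e v /\ r v = \sum_j be j *: c i j.
have cD (mu : {scalar C}) i j : D mu (c i j) = \sum_k mu (c k j) *: c i k.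
  by rewrite /D cc.1 linear_sum; apply: eq_bigr => k _; apply: rgt_pure.
suff main m (e : 'I_m -> B) : stable e -> good m e -> goal.
  have [b hb] := choice (fun i => restr_surj r (c i (Ordinal d0))).
  have [m [e [se he]]] := local_finite b.
  apply: (main m e se); exists (fun j => (j == Ordinal d0)%:R); split.
    by exists (Ordinal d0); rewrite eqxx oner_eq0.
  move=> i; exists (b i); split=> //; rewrite hb (bigD1 (Ordinal d0)) // eqxx scale1r.
  by rewrite big1 /= ?addr0 // => j /negbTE ->; rewrite scale0r.
elim: m e => [|m IH] e se [be [[i0 bi0] hbe]].
  have [v [[al ->] rv]] := hbe i0; move: rv; rewrite big_ord0 smor0 => /(congr1 (@eps K N)).
  by rewrite raddf0 (scalar_dual _ (cc.2 i0)) => h; rewrite -h eqxx in bi0.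
have [[mu hmu]|[l hl]] := dual_or_dependent e; last first.
  apply: (IH (e \o lift l)) => [nu j|]; first exact/(ispan_lift hl)/se.
  exists be; split; first by exists i0.
  by move=> i; have [v [hv rv]] := hbe i; exists v; split=> //; apply: ispan_lift.
pose M k j := L (mu k) (e j).
have De (nu : {scalar B}) j : D nu (e j) = \sum_k nu (M k j) *: e k.
  have [al eal] := se nu j; rewrite eal; apply: eq_bigr => k _; congr (_ *: _).
  by rewrite /M -D_L eal (scalar_dual _ (hmu k)).
have cM : comodule_matrix M.
  apply: comodule_matrixP => [lam nu i j|i j]; last by rewrite eps_L hmu.
  rewrite /M DL_comm De (raddf_sum (L (mu i))) /= (raddf_sum lam) /=; apply: eq_bigr => k _ /=.
  by rewrite !linearZ /= mulrC.
have [f [[l fl] [chi hf]]] := left_eigen ptE E_ev (ltn0Sn m) cM.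
(* A basis of the hyperplane on which the coordinate form f vanishes. Since f is a left eigenvector,
   the hyperplane is stable and translations act on the quotient line through [chi]. *)
pose e' k := e (lift l k) - (f (lift l k) / f l) *: e l.
have e'P (ga : 'I_m.+1 -> K) : \sum_k f k * ga k = 0 -> ispan e' (\sum_k ga k *: e k).
  move=> h; exists (fun k => ga (lift l k)).
  rewrite /e'; under [RHS]eq_bigr do rewrite scalerBr.
  rewrite (bigD1_ord l) //= [LHS]addrC big_split /=; congr (_ + _).
  under eq_bigr do rewrite scalerA -scaleNr; rewrite -scaler_suml; congr (_ *: _).
  rewrite sumrN; apply: (mulfI fl); rewrite mulrN mulr_sumr; apply/eqP.
  rewrite -addr_eq0 -[X in _ == X]h (bigD1_ord l) //=; apply/eqP; congr (_ + _).
  by apply: eq_bigr => k _; rewrite mulrCA [f l * _]mulrCA divff // mulr1 mulrC.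
have key (nu : {scalar B}) v : ispan e v -> ispan e' (D nu v - nu chi *: v).
  move=> [al ->]; rewrite raddf_sum /=.
  have -> : \sum_k D nu (al k *: e k) - nu chi *: (\sum_k al k *: e k) =
      \sum_k (\sum_j al j * nu (M k j) - nu chi * al k) *: e k.
    under [RHS]eq_bigr do rewrite scalerBl -scalerA scaler_suml.
    rewrite sumrB scaler_sumr; congr (_ - _); rewrite exchange_big; apply: eq_bigr => j _ /=.
    by rewrite linearZ /= De scaler_sumr; apply: eq_bigr => k _; rewrite scalerA.
  apply: e'P; under eq_bigr do rewrite mulrBr mulr_sumr.
  rewrite sumrB exchange_big /= -sumrB big1 // => j _.
  rewrite (_ : \sum_i _ = al j * nu (\sum_i f i *: M i j)).
    by rewrite hf linearZ /= mulrCA [nu chi * _]mulrC mulrCA subrr.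
  rewrite raddf_sum mulr_sumr; apply: eq_bigr => i _ /=.
  by rewrite linearZ /= mulrCA.
have se' : stable e'.
  move=> nu j; rewrite -[D _ _](subrK (nu chi *: e' j)).
  apply: (linclosedD (ispan_lin e')); last exact/(linclosedZ (ispan_lin e'))/ispan_mem.
  apply: key; apply: (linclosedB (ispan_lin e)); first exact: ispan_mem.
  exact/(linclosedZ (ispan_lin e))/ispan_mem.
have [ge'|nge'] := pselect (good m e'); first exact: IH ge'.
exists be; split; first by exists i0.
exists (r chi) => k; apply: functional_eq => nu; apply: contrapT => ne.
(* Suppose the eigenvector equation fails at row k under [nu]. Translating the combination by [nu]
   and subtracting its expected multiple moves the lifts into the hyperplane, and the resulting
   combination of columns has a nonzero k-th coefficient. *)
apply: nge'; exists (fun k => \sum_j be j * nu (c k j) - nu (r chi) * be k); split.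
  exists k; apply/eqP => h; apply: ne; move/subr0_eq: h => h.
  rewrite linearZ /= mulrC -h raddf_sum; apply: eq_bigr => j _; exact: scalarZ.
move=> i; have [v [hv rv]] := hbe i.
exists (D (nu \o r) v - nu (r chi) *: v); split; first exact: (key (nu \o r)).
rewrite smorB smorZ pi_D rv raddf_sum scaler_sumr -sumrB /=.
under [RHS]eq_bigr do rewrite scalerBl scaler_suml.
rewrite !sumrB; congr (_ - _); last by apply: eq_bigr => j _; rewrite scalerA.
rewrite exchange_big; apply: eq_bigr => j _ /=; rewrite linearZ /= cD scaler_sumr.
by apply: eq_bigr => k' _; rewrite scalerA.
Qed.

End ClosedSubgroups.

(** * Simple modules of pointed groups *)

Section PointedModules.
Variables (K : fieldType) (N : supergroup K).
Local Notation C := (Defs.coord N).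
Hypotheses (N_ev : affine_group N) (ptN : pointed N).
Variable V : gmodule N.

(** The coaction, that is the action of the universal point. By naturality it determines the action
    of all points ([act_rho]). *)
Definition rho (v : V) : tensor V C := gm_act V (smor_id C : N C) (pure v 1).

Lemma rho_linear : linear rho.
Proof. by move=> k x y; rewrite /rho pureDl pureZl linearP. Qed.

Lemma mapr_bilin (U W W' : lmodType K) (g : W -> W') : linear g ->
  bilin (fun (v : U) w => pure v (g w)).
Proof.
move=> gl; split=> [w|v] k x y; first by rewrite pureDl pureZl.
by rewrite gl pureDr pureZr.
Qed.

Lemma mapr_pure (U W W' : lmodType K) (g : W -> W') (v : U) w : linear g ->
  tensor_mapr g (pure v w) = pure v (g w).
Proof. by move=> gl; apply/tlift_pure/mapr_bilin. Qed.

Lemma act_rho (R : superalg K) (g : smor C R) v r :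
  gm_act V (g : N R) (pure v r) = tensor_mapr ( *%R^~ r) (tensor_mapr g (rho v)).
Proof.
have gl : linear g by move=> k x y; rewrite smorD smorZ.
have rl : linear ( *%R^~ r : R -> R) by exact: mulrr_linear.
have := @gm_act_nat K N V _ _ g (smor_id C : N C) (pure v 1).
rewrite mapr_pure // smor1 => <-; rewrite -gm_actZ mapr_pure // mul1r.
by congr (gm_act _ _ _); apply: smorP.
Qed.

Definition Rho (lam : C -> K) (v : V) : V := tensor_lift (fun w y => lam y *: w) (rho v).

Lemma mapr_linear (U W W' : lmodType K) (g : W -> W') : linear g ->
  linear (tensor_mapr (V := U) g).
Proof. by move=> gl; apply/tlift_linear/mapr_bilin. Qed.

Lemma mapr0 (U W W' : lmodType K) (g : W -> W') : linear g ->
  tensor_mapr (V := U) g 0 = 0.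
Proof. by move=> gl; apply/tlift0/mapr_bilin. Qed.

Lemma maprD (U W W' : lmodType K) (g : W -> W') (s t : tensor U W) : linear g ->
  tensor_mapr g (s + t) = tensor_mapr g s + tensor_mapr g t.
Proof. by move=> gl; apply/tliftD/mapr_bilin. Qed.

Lemma mapr_mulr1 (R : superalg K) (t : tensor V R) : tensor_mapr ( *%R^~ 1) t = t.
Proof.
rewrite [RHS]tensorE /tensor_mapr /tensor_lift /tsum; apply: eq_bigr => p _.
by rewrite mulr1.
Qed.

Lemma act_rho1 (R : superalg K) (g : smor C R) v :
  gm_act V (g : N R) (pure v 1) = tensor_mapr g (rho v).
Proof. by rewrite act_rho mapr_mulr1. Qed.

(** The comodule law contracted with [lam] in the last factor. It comes from [gm_actM] for the two
    universal points over C (x) C, whose product is [comul]. *)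
Lemma rho_Rho (lam : {scalar C}) v : rho (Rho lam v) = tensor_mapr (D lam) (rho v).
Proof.
have sl (A R : superalg K) (g : smor A R) : linear g by move=> k x y; rewrite smorD smorZ.
have ml (R : superalg K) (r : R) : linear ( *%R^~ r : R -> R) by exact: mulrr_linear.
pose T (t : tensor V (tsuper C C)) : tensor V C := tensor_mapr (rgt lam) t.
have Tl : linear T := mapr_linear (rgt_linear lam).
have key t y : T (tensor_mapr ( *%R^~ (tinr C C y)) (tensor_mapr (tinl C C) t)) = lam y *: t.
  elim/tensor_ind: t => [|s t hs ht|w x].
  - rewrite (mapr0 _ (sl _ _ (tinl C C))) (mapr0 _ (ml _ _)) /T.
    by rewrite (mapr0 _ (rgt_linear lam)) scaler0.
  - rewrite (maprD _ _ (sl _ _ (tinl C C))) (maprD _ _ (ml _ _)) /T.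
    by rewrite (maprD _ _ (rgt_linear lam)) -/(T _) -/(T (tensor_mapr _ (tensor_mapr _ t))) hs ht scalerDr.
  have xy : tinl C C x * tinr C C y = pure x y by rewrite [LHS]pureM1 mulr1.
  rewrite (mapr_pure _ _ (sl _ _ (tinl C C))) (mapr_pure _ _ (ml _ _)) xy.
  by rewrite /T (mapr_pure _ _ (rgt_linear lam)) rgt_pure pureZr.
have := @gm_actM K N V _ (tinl C C : N _) (tinr C C : N _) (pure v 1).
have -> : gmul N (tinl C C : N _) (tinr C C : N _) = comul N by rewrite /comul unlock.
rewrite !act_rho1 => /(congr1 T).
rewrite {2}/tensor_mapr (lin_tlift _ _ (@linearP _ _ _ _ (gm_act V (tinl C C : N (tsuper C C))))).
rewrite (lin_tlift _ _ Tl) => e.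
transitivity (T (tensor_mapr (comul N) (rho v))).
  rewrite e /Rho (lin_tlift _ _ rho_linear); apply: tlift_eq => w y.
  rewrite act_rho key; have := rho_linear (lam y) w 0.
  by have -> : rho 0 = 0; [rewrite /rho pure0l linear0 | rewrite !addr0].
rewrite /tensor_mapr (lin_tlift _ _ Tl); apply: tlift_eq => w y.
by rewrite /T mapr_pure //; apply: rgt_linear.
Qed.

Lemma Rho_eps v : Rho (@eps K N) v = v.
Proof.
have := @gm_act1 K N V C (pure v 1); rewrite act_rho1.
have e : tensor_mapr (gone N C : smor C C) (rho v) = pure (Rho (@eps K N) v) 1.
  rewrite /Rho (lin_tlift (f := fun w : V => pure w (1 : C))); last exact: (pure_bilin V C).1.
  by apply: tlift_eq => w y; rewrite goneE pureZr pureZl.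
rewrite e => /(congr1 (tensor_lift (fun w c => eps c *: w))).
have eb : bilin (fun (w : V) (c : C) => eps c *: w) by exact: (scaleW_bilin _ (@eps K N)).
by rewrite !tlift_pure // rmorph1 !scale1r.
Qed.

(** The left factors of rho(v0) span a finite-dimensional submodule containing v0, hence everything.
    In a basis the coaction is a comodule matrix; an eigenvector of it spans an invariant line,
    which by simplicity is the whole module. *)
Lemma pointed_simple : simple_module V -> one_dimensional V.
Proof.
move=> [[v0 nv0] simple].
have DC (lam : {scalar C}) := rgt_linear lam.
have sub_of n (u : 'I_n -> V) (M : 'I_n -> 'I_n -> C) :
    (forall j, rho (u j) = \sum_k pure (u k) (M k j)) ->
    submodule (V := V) (fun w => `[< ispan u w >]).
  move=> hu; have lin : submod_closed (fun w => `[< ispan u w >]).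
    split; first exact/asboolP/(ispan_lin u).1.
    by move=> k x y /asboolP hx /asboolP hy; apply/asboolP/(ispan_lin u).2.
  split=> // R g t [s [hs ->]].
  pose P (t : tensor V R) := in_tensor_sub (fun w => `[< ispan u w >]) t.
  have P0 : P 0 by exists [::]; rewrite big_nil.
  have PD x y : P x -> P y -> P (x + y).
    move=> [a [ha ->]] [b [hb ->]]; exists (a ++ b); rewrite big_cat; split=> // p.
    by rewrite mem_cat => /orP[/ha|/hb].
  have Psum (I : eqType) (l : seq I) (F : I -> tensor V R) :
      (forall i, i \in l -> P (F i)) -> P (\sum_(i <- l) F i).
    elim: l => [|i l IH] h; first by rewrite big_nil.
    rewrite big_cons; apply: PD; first by apply: h; rewrite mem_head.
    by apply: IH => j jl; apply: h; rewrite inE jl orbT.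
  rewrite linear_sum; apply: Psum => -[w r] /hs /asboolP /= [al ->].
  have gl : linear (g : smor C R) by move=> k x y; rewrite smorD smorZ.
  have rl : linear ( *%R^~ r : R -> R) by exact: mulrr_linear.
  have := act_rho (g : smor C R); rewrite /= => ->.
  have rl2 := rho_linear.
  have r0 : rho 0 = 0 by rewrite /rho pure0l linear0.
  have rD x y : rho (x + y) = rho x + rho y by have := rho_linear 1 x y; rewrite !scale1r.
  rewrite (big_morph _ rD r0); elim/big_rec: _ => [|j t1 _ ht]; first by rewrite !mapr0.
  rewrite !maprD //; apply: (PD) => //.
  have -> : rho (al j *: u j) = al j *: rho (u j).
    by have := rho_linear (al j) (u j) 0; rewrite r0 !addr0.
  rewrite hu scaler_sumr; elim/big_rec: _ => [|k t' _ ht']; first by rewrite !mapr0.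
  rewrite !maprD //; apply: (PD) => //; rewrite -pureZl !mapr_pure //.
  exists [:: (al j *: u k, (g : smor C R) (M k j) * r)]; rewrite big_seq1; split=> // p.
  rewrite inE => /eqP -> /=; apply/asboolP; apply: (linclosedZ (ispan_lin u)).
  exact: ispan_mem.
have full n (u : 'I_n -> V) (M : 'I_n -> 'I_n -> C) :
    (forall j, rho (u j) = \sum_k pure (u k) (M k j)) ->
    (exists2 w, ispan u w & w != 0) -> forall w, ispan u w.
  move=> /sub_of/simple[h [w hw nw]|h _ w]; last exact/asboolP/h.
  by move/eqP: nw; case; apply: h; apply/asboolP.
have [n [v [c [lam [hl e]]]]] := tensor_rep (rho v0).
have RE (mu : {scalar C}) : Rho mu v0 = \sum_k mu (c k) *: v k.
  rewrite /Rho e tlift_sum; last exact: scaleW_bilin.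
  by apply: eq_bigr => k _; apply/tlift_pure/scaleW_bilin.
have vE j : v j = Rho (lam j) v0.
  rewrite RE (bigD1 j) //= hl eqxx scale1r big1 ?addr0 // => k nkj.
  by rewrite hl eq_sym (negbTE nkj) scale0r.
have Vspan : forall w, ispan v w.
  apply: (full _ _ (fun k j => D (lam j) (c k))) => [j|].
    rewrite {1}vE rho_Rho e (big_morph _ (fun s t => maprD s t (D_linear (lam j)))
      (mapr0 _ (D_linear (lam j)))).
    by apply: eq_bigr => k _; rewrite mapr_pure //; apply: D_linear.
  by exists v0 => //; exists (fun k => eps (c k)); rewrite -RE Rho_eps.
have [m [b [mu [hmu [hb _]]]]] := spanning_basis v.
have {Vspan}Bspan w : ispan b w by apply: hb.
have wE w : w = \sum_k mu k w *: b k.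
  have [al ew] := Bspan w; rewrite {1}ew; apply: eq_bigr => k _; congr (_ *: _).
  by rewrite ew (scalar_dual _ (hmu k)).
pose cl k (t : tensor V C) : C := tensor_lift (fun w y => mu k w *: y) t.
have clb k : bilin (fun (w : V) (y : C) => mu k w *: y) := scaleV_bilin C (mu k).
have cll k : linear (cl k) := tlift_linear (clb k).
have tE t : t = \sum_k pure (b k) (cl k t).
  elim/tensor_ind: t => [|s t hs ht|w y].
  - by rewrite big1 // => k _; rewrite /cl tlift0 // pure0r.
  - rewrite {1}hs {1}ht -big_split; apply: eq_bigr => k _ /=.
    by rewrite /cl tliftD // pureDr.
  under eq_bigr do rewrite /cl tlift_pure // pureZr -pureZl.
  rewrite {1}[w]wE; elim/big_ind2: _ => //; first by rewrite pure0l.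
  by move=> ? ? ? ? <- <-; rewrite pureDl.
pose M k j := cl k (rho (b j)).
have rb j : rho (b j) = \sum_k pure (b k) (M k j) by apply: tE.
have Rb (nu : {scalar C}) j : Rho nu (b j) = \sum_k nu (M k j) *: b k.
  rewrite /Rho rb tlift_sum; last exact: scaleW_bilin.
  by apply: eq_bigr => k _; apply/tlift_pure/scaleW_bilin.
have rho0 : rho 0 = 0 by rewrite /rho pure0l linear0.
have rhoD x y : rho (x + y) = rho x + rho y by have := rho_linear 1 x y; rewrite !scale1r.
have rhoZ k x : rho (k *: x) = k *: rho x.
  by have := rho_linear k x 0; rewrite rho0 !addr0.
have DM (nu : {scalar C}) l j : D nu (M l j) = \sum_k nu (M k j) *: M l k.
  have := congr1 (cl l) (rho_Rho nu (b j)); rewrite Rb.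
  rewrite [tensor_mapr _ _]/tensor_mapr (lin_tlift _ _ (cll l)) => eM.
  transitivity (cl l (rho (\sum_k nu (M k j) *: b k))).
    rewrite eM /M {1}/cl (lin_tlift _ _ (D_linear nu)); apply: tlift_eq => w y.
    by rewrite /cl tlift_pure // linearZ.
  rewrite (big_morph _ rhoD rho0) (big_morph (cl l) (fun s t => tliftD s t (clb l)) (tlift0 (clb l))).
  by apply: eq_bigr => k _; rewrite rhoZ /cl tliftZ.
have cM : comodule_matrix M.
  apply: comodule_matrixP => [la nu i j|i j]; last first.
    have := congr1 (mu i) (Rho_eps (b j)); rewrite hmu => <-.
    by rewrite (Rb (@eps K N)) (scalar_dual _ (hmu i)).
  by rewrite DM raddf_sum; apply: eq_bigr => k _ /=; rewrite linearZ /= mulrC.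
have m0 : (0 < m)%N.
  rewrite lt0n; apply/eqP => m0; move/eqP: nv0; apply; rewrite [v0]wE big1 // => k _.
  by have := ltn_ord k; rewrite [X in (_ < X)%N]m0.
have [f [[i fi] [chi hf]]] := ptN m0 cM.
pose u := \sum_j f j *: b j.
have mu_u : mu i u = f i := scalar_dual f (hmu i).
have nu0 : u != 0 by apply/eqP => u0; move: fi; rewrite -mu_u u0 linear0 eqxx.
exists u => // w; have [||al ->] := full 1%N (fun=> u) (fun _ _ => chi) _ _ w.
- move=> _; rewrite big_ord1 /u (big_morph _ rhoD rho0).
  have pl : {morph (fun v : V => pure v chi) : v v' / v + v'} by move=> x y; apply: pureDl.
  rewrite (big_morph _ pl (pure0l _ _)).
  under eq_bigr do rewrite rhoZ rb scaler_sumr.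
  rewrite exchange_big; apply: eq_bigr => k _ /=.
  rewrite pureZl -pureZr -hf.
  have pr : {morph (fun y : C => pure (b k) y) : v v' / v + v'} by move=> x y; apply: pureDr.
  by rewrite (big_morph _ pr (pure0r _ _)); apply: eq_bigr => j _; rewrite pureZr.
- by exists u => //; exists (fun=> 1); rewrite big_ord1 scale1r.
by exists (al ord0); rewrite big_ord1.
Qed.

End PointedModules.

Lemma pointed_trig (K : fieldType) (N : supergroup K) :
  affine_group N -> algebraic N -> pointed N -> trigonalizable_group N.
Proof. by move=> N_ev N_alg ptN; split=> // V; apply: pointed_simple. Qed.

(** * Closed subgroups cut out by ideals *)

Lemma smor_epi (K : fieldType) (A B C : superalg K) (r : smor A B) (f g : smor B C) :
  (forall b, exists a, r a = b) -> smor_comp f r = smor_comp g r -> f = g.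
Proof.
move=> rs e; apply: smorP => b; have [a <-] := rs b.
exact: (congr1 (fun h : smor A C => h a) e).
Qed.

Lemma smor_compA (K : fieldType) (A B C S : superalg K)
    (h : smor C S) (g : smor B C) (f : smor A B) :
  smor_comp h (smor_comp g f) = smor_comp (smor_comp h g) f.
Proof. exact: smorP. Qed.

Definition kills (K : fieldType) (A R : superalg K) (J : A -> Prop) (x : smor A R) :=
  forall a, J a -> x a = 0.

Section CutOut.
Variables (K : fieldType) (G : supergroup K).
Local Notation A := (Defs.coord G).

(** The Hopf ideal condition expressed on points: the zeros of J are closed under the group
    operations. No coproduct of an element of J has to be computed. *)
Lemma subgroup_of_sideal (J : sideal A) :
  (forall R (x y : smor A R), kills J x -> kills J y -> kills J (gmul G (x : G R) y : smor A R)) ->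
  (forall R, kills J (gone G R : smor A R)) ->
  (forall R (x : smor A R), kills J x -> kills J (ginv G (x : G R) : smor A R)) ->
  exists (N : supergroup K) (j : closed_subgroup N G),
    (forall a, j a = 0 <-> J a) /\
    (forall R (x : smor A R), sub_pts j (x : G R) <-> kills J x).
Proof.
move=> JM J1 JV; pose C := qsuper J.
have rs : forall c : C, exists a, qmor J a = c by apply: qmor_surj.
pose theta R (x : smor C R) : G R := smor_comp x (qmor J).
have lift R (x : smor A R) : kills J x -> exists x', theta R x' = x.
  by move=> hx; apply: smor_factor => // a /qmor_ker; apply: hx.
have kq R (x : smor C R) : kills J (theta R x : smor A R).
  by move=> a /qmor_ker e; rewrite -[LHS]/(x (qmor J a)) e; exact: (smor0 x).
have [g gE] := @pullback_group K C G theta (fun R S f x => esym (smor_compA f x (qmor J)))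
  (fun R x y e => smor_epi rs e) (fun R x y => lift _ _ (JM _ _ _ (kq _ x) (kq _ y)))
  (fun R => lift _ _ (J1 R)) (fun R x => lift _ _ (JV _ _ (kq _ x))).
pose N := Supergroup g.
have jh : hopf_morphism (G := N) (H := G) (qmor J) by move=> R x y; apply: gE.
exists N, (@ClosedSubgroup K N G (qmor J) jh rs); split; first exact: qmor_ker.
move=> R x; split=> [[n ->]|/lift[x' e]]; first exact: kq.
by exists x'; rewrite -e.
Qed.

Section Principal.
Variables (b : bool) (e : A).
Hypotheses (eb : e \in homog A b) (ee : eps e = 0).

Let twist (a : A) : A := if b then sg a else a.

Let e_comm a : a * e = e * twist a.
Proof.
rewrite /twist; case: b eb => he; last by rewrite (even_comm a he).
by rewrite (odd_sg _ he) sgK.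
Qed.

(** Multiples on one side suffice: a homogeneous e commutes with everything up to the parity twist,
    so this is a two-sided ideal. *)
Definition principal (a : A) := exists c, a = e * c.

Lemma principal_sideal : exists J : sideal A, forall a, J a <-> principal a.
Proof.
have lin : linclosed principal.
  split; first by exists 0; rewrite mulr0.
  by move=> k _ _ [u ->] [v ->]; exists (k *: u + v); rewrite mulrDr scalerAr.
have ml a x : principal x -> principal (a * x).
  by move=> [c ->]; exists (twist a * c); rewrite mulrA e_comm mulrA.
have mr a x : principal x -> principal (x * a).
  by move=> [c ->]; exists (c * a); rewrite mulrA.
have pp d x : principal x -> principal (pr d x).
  move=> [c ->]; exists (pr (b (+) d) c).
  case: d; rewrite ?pr0M ?pr1M !(pr_homogE _ eb); case: b => /=;
    by rewrite mul0r ?addr0 ?add0r.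
have pr1 : ~ principal 1.
  by move=> [c /(congr1 (@eps K G))/eqP]; rewrite rmorph1 rmorphM /= ee mul0r oner_eq0.
by exists (@Sideal K A principal lin ml mr pp pr1).
Qed.

Lemma kills_principal R (x : smor A R) : kills principal x <-> x e = 0.
Proof.
split=> [h|h a [c ->]]; first by apply: h; exists 1; rewrite mulr1.
by rewrite smorM h mul0r.
Qed.

Hypotheses
  (eM : forall R (x y : smor A R), x e = 0 -> y e = 0 -> (gmul G (x : G R) y : smor A R) e = 0)
  (eV : forall R (x : smor A R), x e = 0 -> (ginv G (x : G R) : smor A R) e = 0)
  (eN : forall R (h x : smor A R), x e = 0 ->
     (gmul G (gmul G (h : G R) x) (ginv G (h : G R)) : smor A R) e = 0).

Lemma principal_subgroup : exists (N : supergroup K) (j : closed_subgroup N G),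
  (forall a, j a = 0 <-> principal a) /\ normal_subgroup j.
Proof.
have [J hJ] := principal_sideal.
have kJ R (x : smor A R) : kills J x <-> x e = 0.
  split=> [h|h a /hJ]; last by apply: (kills_principal x).2.
  by apply: (kills_principal x).1 => a /hJ; apply: h.
have [||| N [j [jk js]]] := @subgroup_of_sideal J.
- by move=> R x y /kJ hx /kJ hy; apply/kJ/eM.
- by move=> R; apply/kJ; rewrite goneE ee scale0r.
- by move=> R x /kJ hx; apply/kJ/eV.
exists N, j; split=> [a|R h x]; first by rewrite jk hJ.
by move=> /js/kJ hx; apply/js/kJ/eN.
Qed.

End Principal.

Lemma grouplike_point (g : A) R (x y : smor A R) : comul G g = pure g g :> tensor A A ->
  (gmul G (x : G R) y : smor A R) g = x g * y g.
Proof. by move=> hg; rewrite gmulE hg; apply/tlift_pure/tpair_bilin. Qed.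

Lemma primitive_point (z : A) R (x y : smor A R) :
  comul G z = pure 1 z + pure z 1 :> tensor A A ->
  (gmul G (x : G R) y : smor A R) z = x z + y z.
Proof.
move=> hz; rewrite gmulE hz tliftD; last exact: tpair_bilin.
by rewrite !tlift_pure ?smor1 ?mul1r ?mulr1 1?addrC //; apply: tpair_bilin.
Qed.

Lemma grouplike_subgroup (g : A) : g \in homog A false -> eps g = 1 ->
  comul G g = pure g g :> tensor A A ->
  exists (N : supergroup K) (j : closed_subgroup N G),
    (forall a, j a = 0 <-> principal (g - 1) a) /\ normal_subgroup j.
Proof.
move=> g0 eg hg.
have gV R (x : smor A R) : (ginv G (x : G R) : smor A R) g * x g = 1.
  by rewrite -(grouplike_point _ _ hg) gmulV goneE eg scale1r.
have gV' R (x : smor A R) : x g * (ginv G (x : G R) : smor A R) g = 1.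
  by rewrite -(grouplike_point _ _ hg) gmulgV goneE eg scale1r.
have iff R (x : smor A R) : x (g - 1) = 0 <-> x g = 1.
  by rewrite smorB smor1; split=> [/subr0_eq|->] //; rewrite subrr.
apply: (@principal_subgroup false).
- by apply: homogB => //; apply: homog1.
- by rewrite raddfB /= eg rmorph1 subrr.
- by move=> R x y /iff hx /iff hy; apply/iff; rewrite (grouplike_point _ _ hg) hx hy mulr1.
- by move=> R x /iff hx; apply/iff; have := gV R x; rewrite hx mulr1.
- move=> R h x /iff hx; apply/iff; rewrite !(grouplike_point _ _ hg) hx mulr1.
  exact: gV'.
Qed.

Lemma primitive_subgroup (z : A) : z \in homog A true ->
  comul G z = pure 1 z + pure z 1 :> tensor A A ->
  exists (N : supergroup K) (j : closed_subgroup N G),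
    (forall a, j a = 0 <-> principal z a) /\ normal_subgroup j.
Proof.
move=> z1 hz; have ez := eps_odd z1.
have zV R (x : smor A R) : x z + (ginv G (x : G R) : smor A R) z = 0.
  by rewrite -(primitive_point _ _ hz) gmulgV goneE ez scale0r.
apply: (@principal_subgroup true) => //.
- by move=> R x y hx hy; rewrite (primitive_point _ _ hz) hx hy addr0.
- by move=> R x hx; have := zV R x; rewrite hx add0r.
- by move=> R h x hx; rewrite !(primitive_point _ _ hz) hx addr0; apply: zV.
Qed.

End CutOut.

(** * Passing to a closed subgroup *)

Section Restriction.
Variables (K : fieldType) (G N : supergroup K) (j : closed_subgroup N G).
Local Notation A := (Defs.coord G).
Local Notation AN := (Defs.coord N).

Lemma algebraic_restr : algebraic G -> algebraic N.
Proof.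
move=> [s hs]; exists [seq j a | a <- s] => P [P1 Plin PM] sP c.
have [a <-] := restr_surj j c.
apply: (hs [pred a | j a \in P]) => [|b bs].
  split=> [|k u v|u v]; rewrite !inE ?smor1 //.
    by move=> hu hv; rewrite smorD smorZ; apply: Plin.
  by move=> hu hv; rewrite smorM; apply: PM.
by rewrite inE; apply: sP; apply: map_f.
Qed.

Lemma eps_restr a : eps (j a) = eps a.
Proof. exact/hopf_eps/restr_hopf. Qed.

Lemma cot0_restr a : cot0 a -> cot0 (j a).
Proof.
move=> h; apply: (h (fun a => cot0 (j a))).
  by apply: (lin_pre _ (@cot0_lin K N)) => k x y; rewrite smorD smorZ.
move=> _ [b [c [hb eb hc ->]]]; rewrite smorM; apply: span_mem; exists (j b), (j c).
by split=> //; rewrite ?smor_homog // eps_restr.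
Qed.

Lemma odd_gen_restr d (w : 'I_d -> A) : odd_gen w -> odd_gen (j \o w).
Proof.
move=> [wo wg]; split=> [i|c c1]; first exact/smor_homog/wo.
have [a ea] := restr_surj j c; have [al hal] := wg _ (pr_homog true a).
exists al; have := cot0_restr hal; rewrite smorB smor_pr ea (pr_id c1) smor_sum.
by congr (cot0 (_ - _)); apply: eq_bigr => i _; rewrite smorZ.
Qed.

Lemma odd_rank_drop d (w : 'I_d.+1 -> A) z (al : 'I_d.+1 -> K) i : odd_gen w ->
  cot0 (z - \sum_k al k *: w k) -> al i != 0 -> j z = 0 -> odd_rank N d.
Proof.
move=> gw hz ali jz; exists ((j \o w) \o lift i); apply: odd_gen_minimal (odd_gen_restr gw) _.
exists (fun k => - (al (lift i k) / al i)).
have := linclosedZ (@cot0_lin K N) (- (al i)^-1) (cot0_restr hz).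
rewrite smorB jz sub0r smor_sum scalerN scaleNr opprK scaler_sumr (bigD1_ord i) //=.
congr cot0; rewrite smorZ scalerA mulVf // scale1r; congr (_ + _).
rewrite -sumrN; apply: eq_bigr => k _.
by rewrite smorZ scalerA scaleNr opprK mulrC.
Qed.

Lemma restr_pure_bilin : bilin (fun x y => pure (j x) (j y)).
Proof. by split=> [u|u] k x y; rewrite smorD smorZ ?pureDl ?pureZl ?pureDr ?pureZr. Qed.

Lemma comul_restr a : comul N (j a) =
  tensor_lift (fun x y => pure (j x) (j y)) (comul G a) :> tensor AN AN.
Proof. exact: comul_pi. Qed.

Lemma Ip1_list (B : superalg K) (a : B) : Ip 1 a -> exists s : seq (B * B * B),
  (forall p, p \in s -> p.1.2 \in homog B true) /\ a = \sum_(p <- s) p.1.1 * p.1.2 * p.2.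
Proof.
move=> h; apply: (h (fun a => exists s : seq (B * B * B),
  (forall p, p \in s -> p.1.2 \in homog B true) /\ a = \sum_(p <- s) p.1.1 * p.1.2 * p.2)).
  split=> [|k _ _ [s [hs ->]] [t [ht ->]]]; first by exists [::]; rewrite big_nil.
  exists ([seq (k *: p.1.1, p.1.2, p.2) | p <- s] ++ t); split=> [p|].
    by rewrite mem_cat => /orP[/mapP[q /hs hq ->]|/ht].
  rewrite big_cat big_map scaler_sumr; congr (_ + _); apply: eq_bigr => p _ /=.
  by rewrite -!scalerAl.
move=> _ [p [q [_ hq ->]]]; exists [:: (p, q, 1)]; rewrite big_seq1 mulr1; split=> // r.
by rewrite inE => /eqP ->.
Qed.

(** The even part of N is the intersection of N and E inside G. It is a closed subgroup of E, so
    [pointed] passes to it. *)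
Lemma even_part_restr (E : supergroup K) (pi : closed_subgroup E G) :
  is_even_part pi -> affine_group E -> pointed E ->
  exists (E' : supergroup K) (pi' : closed_subgroup E' N),
    [/\ is_even_part pi', affine_group E' & pointed E'].
Proof.
move=> pi_ev E_ev ptE; have piker := pi_ker pi_ev E_ev.
(* The ideal of the intersection in K[E]: the image under [pi] of the kernel of [j]. *)
pose J (b : Defs.coord E) := exists a, j a = 0 /\ pi a = b.
have J_eps b : J b -> eps b = 0.
  by move=> [a [ja <-]]; rewrite eps_pi -eps_restr ja raddf0.
have J_lin : linclosed J.
  split; first by exists 0; rewrite !smor0.
  move=> k _ _ [a [ja <-]] [b [jb <-]]; exists (k *: a + b).
  by rewrite !smorD !smorZ ja jb scaler0 addr0.
have Jml a x : J x -> J (a * x).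
  have [a' <-] := restr_surj pi a; move=> [y [jy <-]]; exists (a' * y).
  by rewrite !smorM jy mulr0.
have Jmr a x : J x -> J (x * a).
  have [a' <-] := restr_surj pi a; move=> [y [jy <-]]; exists (y * a').
  by rewrite !smorM jy mul0r.
have Jpr d x : J x -> J (pr d x).
  by move=> [y [jy <-]]; exists (pr d y); rewrite !smor_pr jy raddf0.
have J1 : ~ J 1 by move/J_eps/eqP; rewrite rmorph1 oner_eq0.
pose JJ := @Sideal K (Defs.coord E) J J_lin Jml Jmr Jpr J1.
have kJ R (x : smor (Defs.coord E) R) : kills JJ x <-> sub_pts j (smor_comp x pi : G R).
  split=> [h|[n e] b [a [ja <-]]].
    have [|n e] := @smor_factor K _ _ _ j (smor_comp x pi) (restr_surj j).
      by move=> a ja; apply: h; exists a.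
    by exists n.
  have := congr1 (fun f : smor A R => f a) e; rewrite /= ja smor0; exact.
have pts_M R (x y : G R) : sub_pts j x -> sub_pts j y -> sub_pts j (gmul G x y).
  by move=> [n ->] [m ->]; exists (gmul N n m); rewrite (restr_hopf j).
have pts_1 R : sub_pts j (gone G R).
  exists (gone N R); apply/esym/(gone_uniq (g := sg_group G)).
  by rewrite -(restr_hopf j) gmul1.
have pts_V R (x : G R) : sub_pts j x -> sub_pts j (ginv G x).
  move=> [n ->]; exists (ginv N n); apply/esym/ginv_uniq.
  by rewrite -(restr_hopf j) gmulgV; apply: (gone_uniq (g := sg_group G));
    rewrite -(restr_hopf j) gmul1.
have pi1 R : smor_comp (gone E R) pi = gone G R.
  by apply: (gone_uniq (g := sg_group G)); rewrite -(restr_hopf pi) gmul1.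
have [R x y|R|R x|E' [k [kk ks]]] := @subgroup_of_sideal K E JJ.
- by move=> /kJ hx /kJ hy; apply/kJ; rewrite (restr_hopf pi); apply: pts_M.
- by apply/kJ; rewrite pi1; apply: pts_1.
- move=> /kJ hx; apply/kJ; have -> : smor_comp (ginv E (x : E R)) pi = ginv G (smor_comp x pi : G R).
    by apply: (ginv_uniq (g := sg_group G)); rewrite -(restr_hopf pi) gmulgV pi1.
  exact: pts_V.
have E'_ev : affine_group E'.
  move=> c c1; have [b eb] := restr_surj k c.
  by rewrite -(pr_id c1) -eb -smor_pr (E_ev (pr true b)) ?smor0 //; apply: pr_homog.
have [|rho erho] := @smor_factor K _ _ _ j (smor_comp k pi) (restr_surj j).
  by move=> a ja; apply/kk; exists a.
have rhoE a : rho (j a) = k (pi a).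
  exact: (congr1 (fun f : smor A (Defs.coord E') => f a) erho).
have rho_surj c : exists a, rho a = c.
  have [b <-] := restr_surj k c; have [a <-] := restr_surj pi b.
  by exists (j a).
have rho_hopf : hopf_morphism (G := E') (H := N) rho.
  move=> R x y; apply: (smor_epi (restr_surj j)).
  rewrite (restr_hopf j) -!smor_compA erho !smor_compA (restr_hopf k).
  exact: (restr_hopf pi).
exists E', (ClosedSubgroup rho_hopf rho_surj); split=> //; last exact: pointed_sub k E_ev ptE.
move=> c; split=> [|[s [hs ->]]]; last first.
  rewrite /= smor_sum big_seq big1 // => p ps; rewrite !smorM (E'_ev (rho p.1.2)) ?mulr0 ?mul0r //.
  exact/smor_homog/hs.
have [a <-] := restr_surj j c; rewrite /= rhoE => /kk[a' [ja' e]].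
apply: Ip1_list; have /piker : pi (a - a') = 0 by rewrite smorB e subrr.
by move=> /(smor_Ip j); rewrite smorB ja' subr0.
Qed.

End Restriction.

(** * Sub-superalgebras and quotient groups *)

Section SubSuper.
Variables (K : fieldType) (A : superalg K).

Record subsuper := SubSuper {
  subsuper_mem : {pred A};
  subsuper_closed : subalg_closed subsuper_mem;
  subsuper_pr : forall b a, a \in subsuper_mem -> pr b a \in subsuper_mem
}.

Variable S : subsuper.

Definition salg : Type := {a : A | a \in subsuper_mem S}.
HB.instance Definition _ := SubType.on salg.
HB.instance Definition _ := SubChoice.on salg.
HB.instance Definition _ := GRing.SubChoice_isSubAlgebra.Build K A
  (mem (subsuper_mem S)) salg (subsuper_closed S).

Definition shomog b : {pred salg} := [pred u | (val u : A) \in homog A b].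

Lemma shomog_submod b : submod_closed (shomog b).
Proof.
split=> [|k u v]; rewrite !inE ?raddf0 ?homog0 // => hu hv.
by rewrite raddfD /=; apply: homogD => //; apply: homogZ.
Qed.

Lemma shomog_decomp (u : salg) : exists a0 a1,
  [/\ a0 \in shomog false, a1 \in shomog true & u = a0 + a1].
Proof.
have h b : pr b (val u) \in subsuper_mem S by apply/subsuper_pr/(valP u).
pose mk b : salg := exist (fun a => a \in subsuper_mem S) (pr b (val u)) (h b).
exists (mk false), (mk true); split; rewrite ?inE ?pr_homog //.
by apply: val_inj; rewrite raddfD /= pr_sum.
Qed.

Lemma shomog_direct u : u \in shomog false -> u \in shomog true -> u = 0.
Proof.
by rewrite !inE => h0 h1; apply: val_inj; rewrite raddf0; apply: homog_direct h0 h1.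
Qed.

Lemma shomog1 : 1 \in shomog false.
Proof. by rewrite inE rmorph1 homog1. Qed.

Lemma shomogM b c (x y : salg) :
  x \in shomog b -> y \in shomog c -> x * y \in shomog (b (+) c).
Proof. by rewrite !inE rmorphM; apply: homogM. Qed.

Lemma ssupercomm b c (x y : salg) : x \in shomog b -> y \in shomog c ->
  x * y = (-1) ^+ (b && c) * (y * x).
Proof.
rewrite !inE => hx hy; apply: val_inj; rewrite !rmorphM rmorphXn rmorphN1.
exact: supercomm.
Qed.

Definition ssuper : superalg K := Superalg shomog_submod shomog_decomp
  shomog_direct shomog1 shomogM ssupercomm.

Lemma sval_linear : linear (val : ssuper -> A).
Proof. by move=> k x y; rewrite raddfD. Qed.

Definition smor_val : smor ssuper A :=
  mk_smor sval_linear (rmorph1 _) (rmorphM _) (fun b x (hx : x \in shomog b) => hx).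

End SubSuper.

Lemma sub_superalg (K : fieldType) (A : superalg K) (S : A -> Prop) :
  linclosed S -> S 1 -> (forall x y, S x -> S y -> S (x * y)) ->
  (forall b x, S x -> S (pr b x)) ->
  exists (C : superalg K) (i : smor C A),
    [/\ injective i, forall c, S (i c) & forall a, S a -> exists c, i c = a].
Proof.
move=> Sl S1 SM Spr; pose P : {pred A} := [pred a | `[< S a >]].
have Pc : subalg_closed P.
  by split=> [|k u v|u v]; rewrite !inE //; [exact: Sl.2 | exact: SM].
have Pp b a : a \in P -> pr b a \in P by rewrite !inE; exact: Spr.
pose T := SubSuper Pc Pp; exists (ssuper T), (smor_val T); split.
- exact: val_inj.
- by move=> c; apply/asboolP; have := valP (c : salg T).
move=> a Sa; have Pa : a \in P by apply/asboolP.
by exists (exist (fun a => a \in subsuper_mem T) a Pa).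
Qed.

Section QuotientByGenerator.
Variables (K : fieldType) (G N : supergroup K) (j : closed_subgroup N G).
Local Notation A := (Defs.coord G).
Variables (C : superalg K) (i : smor C A) (t : C) (k : K).
Variables (F : group_functor K) (theta : forall R, smor C R -> F R).
Hypotheses (i_inj : injective i)
  (theta_nat : forall R S (f : smor R S) x, theta (smor_comp f x) = fmap f (theta x))
  (theta_inj : forall R, injective (@theta R))
  (theta_surj : forall R y, exists x, @theta R x = y)
  (t_gen : forall R (x y : smor C R), x t = y t -> x = y)
  (thetaM : forall R (x y : smor A R),
     theta (smor_comp (gmul G (x : G R) y) i) =
     gmul F (theta (smor_comp x i)) (theta (smor_comp y i)))
  (jker : forall a, j a = 0 <-> principal (i t - k%:A) a)
  (epst : eps (i t) = k).

(** The coordinate algebra of the quotient is generated by one element t, up to what morphisms can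
    see. The restriction of [i] to N agrees with the trivial point at t, hence everywhere, so
    elements with counit 0 restrict to 0; conversely, t minus its value k generates the kernel of
    [j]. *)
Lemma quotient_by_generator : exists Q : supergroup K,
  is_quotient j Q /\ group_functor_iso Q F.
Proof.
have [g gE] := @pullback_group K C F theta theta_nat theta_inj
  (fun R x y => theta_surj _) (fun R => theta_surj _) (fun R x => theta_surj _).
pose Q := Supergroup g; exists Q; split; last first.
  exists theta; split=> // R.
  pose inv y := sval (cid (theta_surj (R := R) y)).
  have invE y : theta (inv y) = y by rewrite /inv; case: cid.
  by exists inv => // x; apply: theta_inj.
have ih : hopf_morphism (G := G) (H := Q) i.
  by move=> R x y; apply: theta_inj; rewrite thetaM gE.
have epsQ c : counit Q c = eps (i c) by rewrite (hopf_eps _ ih) epsE.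
exists i; split=> // a; split=> [/jker[c ->]|[s [hs ->]]].
  exists [:: (t - k%:A, c)]; split=> [p|].
    by rewrite inE => /eqP -> /=; rewrite epsQ smorB smorZ smor1 raddfB /= epst linearZ rmorph1 /= mulr1 subrr.
  by rewrite big_seq1 /= smorB smorZ smor1.
rewrite smor_sum big_seq big1 // => p ps; rewrite smorM.
pose psi := smor_comp (gone G (Defs.coord N) : smor A _) i.
have -> : j (i p.1) = psi p.1.
  apply: (congr1 (fun f : smor C (Defs.coord N) => f p.1) (_ : smor_comp j i = psi)).
  apply: t_gen; rewrite /= goneE epst; apply/eqP; rewrite -subr_eq0; apply/eqP.
  have : j (i t - k%:A) = 0 by apply/jker; exists 1; rewrite mulr1.
  by rewrite smorB smorZ smor1.
by rewrite /psi /= goneE -epsQ (hs _ ps) scale0r mul0r.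
Qed.

End QuotientByGenerator.

(** * The quotients [Ga_minus], [Gm] and [mu n] *)

Section PrimitiveQuotient.
Variables (K : fieldType) (G N : supergroup K) (j : closed_subgroup N G).
Local Notation A := (Defs.coord G).
Variable z : A.
Hypotheses (two_neq0 : (2%:R : K) != 0) (z_odd : z \in homog A true) (z0 : z != 0)
  (hz : comul G z = pure 1 z + pure z 1 :> tensor A A)
  (jker : forall a, j a = 0 <-> principal z a).

Let lin_z a b : a%:A + b *: z = 0 -> a = 0 /\ b = 0.
Proof.
move=> e; have a0 : a = 0.
  have := congr1 (@eps K G) e; rewrite raddf0 raddfD /= !linearZ /= rmorph1 mulr1.
  by rewrite (eps_odd z_odd) mulr0 addr0.
split=> //; move/eqP: e; rewrite a0 scale0r add0r scaler_eq0 (negbTE z0) orbF.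
by move/eqP.
Qed.

(** The subalgebra is K + K z with z^2 = 0. Every odd element of a superalgebra also squares to zero
    because 2 is invertible, so z may be sent to any odd element. *)
Lemma Ga_quotient : exists Q : supergroup K,
  is_quotient j Q /\ group_functor_iso Q (Ga_minus K).
Proof.
pose S (a : A) := exists al be, a = al%:A + be *: z.
have zz := odd_sqr two_neq0 z_odd.
have [||||C [i [i_inj iS Si]]] := @sub_superalg K A S.
- split; first by exists 0, 0; rewrite !scale0r addr0.
  move=> k _ _ [a [b ->]] [c [d ->]]; exists (k * a + c), (k * b + d).
  by rewrite scalerDr !scalerDl !scalerA addrACA.
- by exists 1, 0; rewrite scale1r scale0r addr0.
- move=> _ _ [a [b ->]] [c [d ->]]; exists (a * c), (a * d + b * c).
  rewrite mulrDl !mulrDr -!scalerAl !mul1r -!scalerAr mulr1 zz !scaler0 addr0 !scalerA.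
  by rewrite scalerDl addrA.
- move=> b _ [a [c ->]]; case: b.
    exists 0, c; rewrite prD !(prZ true) (pr_off (b := true) (homog1 A)) (pr_id z_odd).
    by rewrite scaler0 scale0r.
  exists a, 0; rewrite prD !(prZ false) (pr_id (homog1 A)) (pr_off (b := false) z_odd).
  by rewrite scaler0 scale0r.
have [t it] : exists t, i t = z by apply: Si; exists 0, 1; rewrite scale0r add0r scale1r.
have Cspan c : exists al be, c = al%:A + be *: t.
  have [a [b e]] := iS c; exists a, b; apply: i_inj.
  by rewrite smorD !smorZ smor1 it e.
have hom_inj R (x y : smor C R) : x t = y t -> x = y.
  move=> e; apply: smorP => c; have [a [b ->]] := Cspan c.
  by rewrite !smorD !smorZ !smor1 e.
have i_homog b c : i c \in homog A b -> c \in homog C b.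
  move=> h; have -> : c = pr b c by apply: i_inj; rewrite smor_pr pr_id.
  exact: pr_homog.
have t_odd : t \in homog C true by apply: i_homog; rewrite it.
have hom_ex (R : superalg K) (u : R) : u \in homog R true -> exists x : smor C R, x t = u.
  move=> u1; have uu := odd_sqr two_neq0 u1.
  pose Gam (c : C) (y : R) := exists al be, i c = al%:A + be *: z /\ y = al%:A + be *: u.
  have [||||||x hx] := @smor_graph K C R Gam.
  - by move=> c; have [a [b e]] := iS c; exists (a%:A + b *: u), a, b.
  - move=> y [a [b [/esym e ->]]]; move: e; rewrite smor0 => /lin_z[-> ->].
    by rewrite !scale0r addr0.
  - move=> k c c' _ _ [a [b [e ->]]] [a' [b' [e' ->]]]; exists (k * a + a'), (k * b + b').
    by rewrite smorD smorZ e e' !scalerDr !scalerDl !scalerA; split; rewrite addrACA.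
  - by exists 1, 0; rewrite smor1 scale1r !scale0r !addr0 scale1r.
  - move=> c c' _ _ [a [b [e ->]]] [a' [b' [e' ->]]]; exists (a * a'), (a * b' + b * a').
    rewrite smorM e e' !mulrDl !mulrDr -!scalerAl !mul1r -!scalerAr !mulr1 zz uu !scaler0 !addr0.
    by rewrite !scalerA !scalerDl !addrA.
  - move=> b c y hc [a [b' [e ->]]]; have := smor_homog i hc; rewrite e => h.
    case: b h {hc} => h.
      have : pr false (a%:A + b' *: z) = 0 by rewrite (pr_off (b := false) h).
      rewrite prD !(prZ false) (pr_id (homog1 A)) (pr_off (b := false) z_odd).
      rewrite scaler0 addr0 => ea; have [|-> _] := @lin_z a 0; first by rewrite scale0r addr0.
      by rewrite scale0r add0r homogZ.
    have : pr true (a%:A + b' *: z) = 0 by rewrite (pr_off (b := true) h).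
    rewrite prD !(prZ true) (pr_off (b := true) (homog1 A)) (pr_id z_odd).
    rewrite scaler0 add0r => eb; have [|_ ->] := @lin_z 0 b'; first by rewrite scale0r add0r.
    by rewrite scale0r addr0; apply: homogZ; apply: homog1.
  by exists x; apply: hx; exists 0, 1; rewrite it !scale0r !add0r !scale1r.
pose gt : Ga_minus K C := exist _ t t_odd.
pose theta R (x : smor C R) : Ga_minus K R := ga_map x gt.
apply: (@quotient_by_generator K G N j C i t 0 (Ga_minus K) theta) => //.
- by move=> R R' f x; apply: val_inj.
- by move=> R x y e; apply: hom_inj; exact: (congr1 val e).
- move=> R [u hu]; have [x hx] := hom_ex R u hu; exists x; exact: val_inj.
- move=> R x y; apply: val_inj; rewrite /= it; exact: primitive_point.
- by move=> a; rewrite jker it scale0r subr0.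
- by rewrite it (eps_odd z_odd).
Qed.

End PrimitiveQuotient.

(** * Group-like elements and Laurent polynomials *)

Section GrouplikeQuotient.
Variables (K : fieldType) (G : supergroup K).
Local Notation A := (Defs.coord G).

Definition grouplike (a : A) := comul G a = pure a a :> tensor A A /\ eps a = 1.

Lemma grouplike_L a (u : {scalar A}) : grouplike a -> L u a = u a *: a.
Proof. by move=> [ha _]; rewrite /L ha lft_pure. Qed.

Lemma grouplikeM a b : a \in homog A false -> grouplike a -> grouplike b -> grouplike (a * b).
Proof.
move=> a0 [ha ea] [hb eb]; split; last by rewrite rmorphM /= ea eb mulr1.
rewrite smorM ha hb [LHS]tmulE /tmul_pure (sg_homog a0) expr0 scale1r -pureDl.
by rewrite -mulrDr pr_sum.
Qed.

Lemma grouplike1 : grouplike 1.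
Proof. by split; [rewrite smor1 | exact: rmorph1]. Qed.

Lemma evenX (R : superalg K) (x : R) n : x \in homog R false -> x ^+ n \in homog R false.
Proof.
by move=> x0; elim: n => [|n IH]; [exact: homog1 | rewrite exprS; exact: (homogM x0 IH)].
Qed.

Lemma grouplikeX a n : a \in homog A false -> grouplike a -> grouplike (a ^+ n).
Proof.
move=> a0 ha; elim: n => [|n IH]; first exact: grouplike1.
by rewrite exprS; apply: grouplikeM.
Qed.

(** Dedekind's argument: group-like elements are common eigenvectors of all [L u], with eigenvalue
    u(a). Applying [L u] to a shortest relation and subtracting a multiple of it forces two of the
    elements to agree under every functional. *)
Lemma grouplike_free (s : seq A) (al : A -> K) : uniq s ->
  (forall a, a \in s -> grouplike a) -> \sum_(a <- s) al a *: a = 0 ->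
  forall a, a \in s -> al a = 0.
Proof.
elim: s al => [//|a0 s IH] al /= /andP[a0s us] gl e.
have gs a : a \in s -> grouplike a by move=> h; apply: gl; rewrite inE h orbT.
have g0 : grouplike a0 by apply: gl; rewrite mem_head.
have al0 : al a0 = 0.
  apply: contrapT => /eqP n0; pose be a := - (al a / al a0).
  have ea0 : a0 = \sum_(a <- s) be a *: a.
    move/eqP: e; rewrite big_cons addr_eq0 => /eqP/(congr1 ( *:%R (al a0)^-1)).
    rewrite scalerA mulVf // scale1r => ->; rewrite scalerN scaler_sumr -sumrN.
    by apply: eq_bigr => a _; rewrite scalerA scaleNr mulrC.
  have be0 a : a \in s -> be a = 0.
    move=> ains; apply: contrapT => /eqP nb.
    have : a0 = a.
      apply: functional_eq => u; apply/eqP; rewrite -subr_eq0; apply/eqP.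
      apply: (mulfI nb); rewrite mulr0.
      apply: (IH (fun a => be a * (u a0 - u a)) us gs _ a ains).
      under eq_bigr do rewrite mulrBr scalerBl (mulrC _ (u a0)) -!scalerA.
      rewrite sumrB -scaler_sumr -ea0 -(grouplike_L u g0) {1}ea0 raddf_sum /=.
      rewrite big_seq [X in _ - X]big_seq -sumrB big1 // => b bs.
      by rewrite linearZ /= (grouplike_L u (gs _ bs)) scalerA subrr.
    by move=> ea; rewrite ea ains in a0s.
  have a00 : a0 = 0 by rewrite ea0 big_seq big1 // => a /be0 ->; rewrite scale0r.
  by have := g0.2; rewrite a00 raddf0 => /esym/eqP; rewrite oner_eq0.
move=> a; rewrite inE => /orP[/eqP -> //|]; apply: IH us gs _ a.
by move: e; rewrite big_cons al0 scale0r add0r.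
Qed.

(* Laurent polynomials, evaluated at a unit [u] with inverse [u']: a term
   [(c, (m, n))] stands for [c * u ^ (m - n)]. *)
Definition lmon (B : nzRingType) (u u' : B) (p : nat * nat) : B := u ^+ p.1 * u' ^+ p.2.

Definition lev (B : algType K) (u u' : B) (l : seq (K * (nat * nat))) : B :=
  \sum_(p <- l) p.1 *: lmon u u' p.2.

Section Units.
Variables g g' : A.
Hypotheses (g_even : g \in homog A false) (g'_even : g' \in homog A false)
  (gg' : g * g' = 1) (hg : grouplike g) (hg' : grouplike g').

Lemma lmon_transfer (R : superalg K) (u u' : R) p q :
  (forall k, g ^+ k = 1 -> u ^+ k = 1) -> u * u' = 1 -> u' * u = 1 ->
  lmon g g' p = lmon g g' q -> lmon u u' p = lmon u u' q.
Proof.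
move=> h uu u'u.
have g'g : g' * g = 1 by rewrite -(even_comm g' g_even).
have key (B : nzRingType) (a a' : B) (aa : a * a' = 1) (a'a : a' * a = 1) :
    (lmon a a' p = lmon a a' q) <-> a ^+ (p.1 + q.2) = a ^+ (q.1 + p.2).
  have inv n : a ^+ n * a' ^+ n = 1 by rewrite -exprMn_comm ?aa ?expr1n // /GRing.comm aa a'a.
  have inv' n : a' ^+ n * a ^+ n = 1 by rewrite -exprMn_comm ?a'a ?expr1n // /GRing.comm aa a'a.
  rewrite /lmon; split=> e.
    have := congr1 (fun b => b * (a ^+ p.2 * a ^+ q.2)) e.
    rewrite -[in X in X = _]mulrA [a' ^+ p.2 * _]mulrA inv' mul1r -exprD => ->.
    by rewrite -!exprD [(p.2 + _)%N]addnC exprD mulrA -[X in X * _]mulrA inv' mulr1 -exprD.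
  have := congr1 (fun b => b * (a' ^+ p.2 * a' ^+ q.2)) e.
  rewrite {1}[(p.1 + _)%N]addnC.
  rewrite [X in X = _](_ : _ = a ^+ p.1 * a' ^+ p.2); last first.
    by rewrite [(q.2 + _)%N]addnC exprD -mulrA -!exprD [(p.2 + _)%N]addnC exprD (mulrA (a ^+ q.2)) inv mul1r.
  move=> ->; by rewrite exprD -mulrA (mulrA (a ^+ p.2)) inv mul1r.
move/(key _ g g' gg' g'g) => e; apply/(key _ u u' uu u'u); move: e.
have inj m n : (m <= n)%N -> g ^+ m = g ^+ n -> u ^+ m = u ^+ n.
  move=> le e; have : g ^+ (n - m) = 1.
    have im : g' ^+ m * g ^+ m = 1 by rewrite -exprMn_comm ?g'g ?expr1n // /GRing.comm gg' g'g.
    by rewrite -[LHS]mul1r -im -mulrA -exprD subnKC // -e.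
  by move/h => ek; rewrite -(subnKC le) exprD ek mulr1.
by case/orP: (leq_total (p.1 + q.2) (q.1 + p.2)) => le e; [apply: inj | apply/esym/inj].
Qed.

(** The distinct values of monomials in g are group-like, hence independent, so a relation only says
    that the coefficients of equal monomials sum to 0. Equal monomials in g remain equal in u by the
    condition on orders. *)
Lemma lev_transfer (R : superalg K) (u u' : R) l :
  (forall k, g ^+ k = 1 -> u ^+ k = 1) -> u * u' = 1 -> u' * u = 1 ->
  lev g g' l = 0 -> lev u u' l = 0.
Proof.
move=> h uu u'u e; pose m (p : K * (nat * nat)) := lmon g g' p.2.
pose us := undup (map m l).
have part (V : zmodType) (F : K * (nat * nat) -> V) :
    \sum_(p <- l) F p = \sum_(a <- us) \sum_(p <- l | m p == a) F p.
  rewrite (exchange_big_dep xpredT) //= big_seq [RHS]big_seq; apply: eq_bigr => p pl.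
  rewrite (eq_bigl (fun a => a == m p)) => [|a]; last by rewrite eq_sym.
  rewrite -big_filter filter_pred1_uniq ?undup_uniq ?mem_undup ?map_f //.
  by rewrite big_seq1.
pose al a : K := \sum_(p <- l | m p == a) p.1.
have al0 a : a \in us -> al a = 0.
  apply: grouplike_free (undup_uniq _) _ _ a => [b|].
    by rewrite mem_undup => /mapP[p _ ->]; apply: grouplikeM; [exact: evenX | exact: grouplikeX..].
  rewrite -[RHS]e /lev part; apply: eq_bigr => a _; rewrite scaler_suml.
  by apply: eq_bigr => p /eqP <-.
rewrite /lev part big_seq big1 // => a /[dup] /al0 ala; rewrite mem_undup => /mapP[p pl ea].
rewrite (eq_bigr (fun q => q.1 *: lmon u u' p.2)) => [|q /eqP eq]; last first.
  by rewrite (@lmon_transfer R u u' q.2 p.2) //; exact: (etrans eq ea).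
by rewrite -scaler_suml -/(al a) ala scale0r.
Qed.

End Units.
End GrouplikeQuotient.

Section GmMuQuotient.
Variables (K : fieldType) (G N : supergroup K) (j : closed_subgroup N G).
Local Notation A := (Defs.coord G).

Lemma gm_eq (R : superalg K) (x y : gm_pts R) : (val x).1 = (val y).1 -> x = y.
Proof.
case: x => -[a a'] /= ha; case: y => -[b b'] /= hb e; subst b.
apply: val_inj => /=; case/and4P: ha => /= _ _ _ /eqP a'a; case/and4P: hb => /= _ _ /eqP ab _.
by rewrite -[a']mulr1 -ab mulrA a'a mul1r.
Qed.

Lemma lev_smor (B R : superalg K) (x : smor B R) (u u' : B) l :
  x (lev u u' l) = lev (x u) (x u') l.
Proof.
rewrite /lev smor_sum; apply: eq_bigr => p _.
by rewrite smorZ smorM !smorX.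
Qed.


Definition llin (k : K) (l l' : seq (K * (nat * nat))) := [seq (k * p.1, p.2) | p <- l] ++ l'.

Lemma lev_lin (B : algType K) (u u' : B) k l l' :
  lev u u' (llin k l l') = k *: lev u u' l + lev u u' l'.
Proof.
rewrite /lev big_cat big_map scaler_sumr; congr (_ + _).
by apply: eq_bigr => p _; rewrite scalerA.
Qed.

Definition lmul (l l' : seq (K * (nat * nat))) :=
  [seq (p.1 * q.1, (p.2.1 + q.2.1, p.2.2 + q.2.2)%N) | p <- l, q <- l'].

Lemma lev_mul (B : superalg K) (u u' : B) l l' :
  u \in homog B false -> u' \in homog B false ->
  lev u u' (lmul l l') = lev u u' l * lev u u' l'.
Proof.
move=> u0 u'0; rewrite /lev big_distrlr /= big_allpairs_dep /=.
apply: eq_bigr => p _; apply: eq_bigr => q _.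
rewrite -scalerAl -scalerAr scalerA /lmon; congr (_ *: _) => /=.
rewrite !exprD !mulrA; congr (_ * _); rewrite -!mulrA; congr (_ * _).
by apply: even_comm; apply: evenX.
Qed.

Lemma lev_even (B : superalg K) (u u' : B) l :
  u \in homog B false -> u' \in homog B false -> lev u u' l \in homog B false.
Proof.
move=> u0 u'0; rewrite /lev; apply: (big_ind (fun x => x \in homog B false)) => [|x y|p _]; [exact: homog0|exact: homogD|].
by apply: homogZ; exact: (homogM (evenX _ u0) (evenX _ u'0)).
Qed.

Lemma lev1 (B : algType K) (u u' : B) : lev u u' [:: (1, (0, 0)%N)] = 1.
Proof. by rewrite /lev big_seq1 /= scale1r /lmon !expr0 mulr1. Qed.

Lemma lev_l (B : algType K) (u u' : B) : lev u u' [:: (1, (1, 0)%N)] = u.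
Proof. by rewrite /lev big_seq1 /= scale1r /lmon expr0 mulr1. Qed.

Lemma lev_r (B : algType K) (u u' : B) : lev u u' [:: (1, (0, 1)%N)] = u'.
Proof. by rewrite /lev big_seq1 /= scale1r /lmon expr0 mul1r. Qed.

Lemma grouplike_inv (g : A) : g \in homog A false -> grouplike g ->
  exists g' : A, [/\ g' \in homog A false, g * g' = 1 & grouplike g'].
Proof.
move=> g0 hg; pose g' := antipode G g; have g'0 : g' \in homog A false by apply: smor_homog.
have g'g : g' * g = 1.
  have := antipode_mull g; rewrite hg.1 hg.2 scale1r tlift_pure //.
  split=> [v|u] c a b; first by rewrite smorD smorZ mulrDl scalerAl.
  by rewrite mulrDr scalerAr.
have gg' : g * g' = 1 by rewrite -g'g; apply: even_comm.
have eg' : eps g' = 1 by have := congr1 (@eps K G) gg'; rewrite rmorphM /= hg.2 mul1r rmorph1.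
exists g'; split=> //; split=> //.
have pM : (pure g' g' : tsuper A A) * (pure g g : tsuper A A) = 1.
  rewrite [LHS]tmulE /tmul_pure (sg_homog g'0) expr0 scale1r -pureDl -mulrDr pr_sum.
  by rewrite g'g.
have cc : (comul G g) * (comul G g') = 1 by rewrite -smorM gg' smor1.
by rewrite -[LHS]mul1r -pM -mulrA -[X in _ * (X * _)]hg.1 cc mulr1.
Qed.


(** The algebra K[g, g^-1] represents the even units u satisfying u^k = 1 whenever g^k = 1. This
    treats infinite and finite order of g at once. *)
Lemma grouplike_subalg (g g' : A) : g \in homog A false -> g' \in homog A false ->
  g * g' = 1 -> grouplike g -> grouplike g' ->
  exists (C : superalg K) (i : smor C A) (t t' : C),
    [/\ injective i, i t = g, i t' = g',
        forall (R : superalg K) (x y : smor C R), x t = y t -> x = y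
      & forall (R : superalg K) (u u' : R), gm_pred (u, u') ->
          (forall k, g ^+ k = 1 -> u ^+ k = 1) -> exists x : smor C R, x t = u].
Proof.
move=> g0 g'0 gg' hg hg'; pose S a := exists l, a = lev g g' l.
have [||||C [i [i_inj iS Si]]] := @sub_superalg K A S.
- split; first by exists [::]; rewrite /lev big_nil.
  by move=> k _ _ [l ->] [l' ->]; exists (llin k l l'); rewrite lev_lin.
- by exists [:: (1, (0, 0)%N)]; rewrite lev1.
- by move=> _ _ [l ->] [l' ->]; exists (lmul l l'); rewrite lev_mul.
- move=> b _ [l ->]; have h := lev_even l g0 g'0; case: b.
    by exists [::]; rewrite (pr_off (b := true) h) /lev big_nil.
  by exists l; rewrite pr_id.
have [t it] : exists t, i t = g by apply: Si; exists [:: (1, (1, 0)%N)]; rewrite lev_l.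
have [t' it'] : exists t', i t' = g' by apply: Si; exists [:: (1, (0, 1)%N)]; rewrite lev_r.
have tt' : t * t' = 1 by apply: i_inj; rewrite smorM it it' smor1.
have t't : t' * t = 1 by apply: i_inj; rewrite smorM it it' smor1 -gg'; apply: even_comm.
exists C, i, t, t'; split=> // [R x y e|R u u' /and4P[/= u0 u'0 /eqP uu' /eqP u'u] hu].
  have e' : x t' = y t'.
    rewrite -[LHS]mulr1 -(smor1 y) -tt' smorM -e mulrA -smorM t't.
    by rewrite smor1 mul1r.
  apply: smorP => c; have [l hl] := iS c.
  have -> : c = lev t t' l by apply: i_inj; rewrite lev_smor it it'.
  by rewrite !lev_smor e e'.
pose Gam (c : C) (y : R) := exists l, i c = lev g g' l /\ y = lev u u' l.
have [||||||x hx] := @smor_graph K C R Gam.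
- by move=> c; have [l e] := iS c; exists (lev u u' l), l.
- move=> y [l [/esym e ->]]; move: e; rewrite smor0.
  exact: (lev_transfer g0 g'0 gg' hg hg' hu uu' u'u).
- move=> k c c' _ _ [l [e ->]] [l' [e' ->]]; exists (llin k l l').
  by rewrite smorD smorZ e e' !lev_lin.
- by exists [:: (1, (0, 0)%N)]; rewrite smor1 !lev1.
- move=> c c' _ _ [l [e ->]] [l' [e' ->]]; exists (lmul l l').
  by rewrite smorM e e' !lev_mul.
- move=> b c y hc [l [e ->]]; case: b hc => hc; last exact: lev_even.
  have c0 : lev g g' l = 0.
    by apply: homog_direct (lev_even l g0 g'0) _; rewrite -e; apply: smor_homog.
  by rewrite (lev_transfer g0 g'0 gg' hg hg' hu uu' u'u c0) homog0.
by exists x; apply: hx; exists [:: (1, (1, 0)%N)]; rewrite !lev_l.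
Qed.

(** If no positive power of g is 1, the condition on u is void and the quotient is [Gm]. Otherwise
    it is [mu m] with m the exact order, and m > 1 because g is not 1. *)
Lemma Gm_mu_quotient (g : A) : g \in homog A false -> grouplike g -> g != 1 ->
  (forall a, j a = 0 <-> principal (g - 1) a) ->
  exists Q : supergroup K, is_quotient j Q /\
    (group_functor_iso Q (Gm K) \/ exists2 n, (1 < n)%N & group_functor_iso Q (mu K n)).
Proof.
move=> g0 hg g1 jker; have [g' [g'0 gg' hg']] := grouplike_inv g0 hg.
have [C [i [t [t' [i_inj it it' t_gen hex]]]]] := grouplike_subalg g0 g'0 gg' hg hg'.
have i_homog b c : i c \in homog A b -> c \in homog C b.
  move=> h; have -> : c = pr b c by apply: i_inj; rewrite smor_pr pr_id.
  exact: pr_homog.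
have tp : gm_pred (t, t').
  apply/and4P; rewrite /= !i_homog ?it ?it' //; split=> //; apply/eqP/i_inj;
    by rewrite smorM it it' smor1 // -gg'; apply: even_comm.
pose gt : Gm K C := gm_exist tp.
have ptM R (x y : smor A R) : gm_map (smor_comp (gmul G (x : G R) y) i) gt =
    gm_mul (gm_map (smor_comp x i) gt) (gm_map (smor_comp y i) gt).
  by apply: gm_eq; rewrite /= it; apply: (grouplike_point _ _ hg.1).
have jk a : j a = 0 <-> principal (i t - 1%:A) a by rewrite jker it scale1r.
have epst : eps (i t) = 1 by rewrite it hg.2.
have [[n n0 gn]|nog] := pselect (exists2 n, (0 < n)%N & g ^+ n == 1); last first.
  pose theta R (x : smor C R) : Gm K R := gm_map x gt.
  have [||||Q [qQ isoQ]] := @quotient_by_generator K G N j C i t 1 (Gm K) theta i_inj _ _ _ t_gen _ jk epst.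
  - by move=> R R' f x; apply: val_inj.
  - by move=> R x y e; apply: t_gen; exact: (congr1 (fun z => (val z).1) e).
  - move=> R y; have [||x hx] := hex R (val y).1 (val y).2.
      by have := valP y; case: (val y).
    by move=> [|k] gk //; case: nog; exists k.+1 => //; exact/eqP.
    by exists x; apply: gm_eq.
  - exact: ptM.
  by exists Q; split=> //; left.
have ex : exists n, (0 < n)%N && (g ^+ n == 1) by exists n; rewrite n0.
case: (ex_minnP ex) => m /andP[m0 /eqP gm] min_m.
have m1 : (1 < m)%N.
  by case: m m0 gm {min_m} => [//|[|//]] _ /eqP; rewrite expr1 (negbTE g1).
have tm : (val gt).1 ^+ m == 1 by apply/eqP/i_inj; rewrite /= smorX it gm smor1.
pose gmu : mu K m C := mu_exist tm.
pose theta R (x : smor C R) : mu K m R := mu_map x gmu.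
have [||||Q [qQ isoQ]] := @quotient_by_generator K G N j C i t 1 (mu K m) theta i_inj _ _ _ t_gen _ jk epst.
- by move=> R R' f x; apply: val_inj; apply: val_inj.
- by move=> R x y e; apply: t_gen; exact: (congr1 (fun z => (val (val z)).1) e).
- move=> R y; have [||x hx] := hex R (val (val y)).1 (val (val y)).2.
  + by have := valP (val y); case: (val (val y)).
  + move=> k gk; have : (m %| k)%N.
      rewrite /dvdn; case: (posnP (k %% m)) => [//|kp].
      have : (m <= k %% m)%N.
        apply: min_m; rewrite kp /=; apply/eqP; move: gk.
        by rewrite {1}(divn_eq k m) exprD mulnC exprM gm expr1n mul1r.
      by rewrite leqNgt ltn_mod m0.
    by case/dvdnP=> q ->; rewrite mulnC exprM (eqP (valP y)) expr1n.
  by exists x; apply: val_inj; apply: gm_eq.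
- by move=> R x y; apply: val_inj; exact: ptM.
by exists Q; split=> //; right; exists m.
Qed.

End GmMuQuotient.

(** * Finiteness of the odd part and the group-like factor *)

Section OddGenerators.
Variables (K : fieldType) (G : supergroup K).
Local Notation A := (Defs.coord G).

(** The elements whose odd part lies in the A-span of the odd parts of the algebra generators form a
    subalgebra, by [pr1M]. *)
Lemma odd_generators : algebraic G -> exists r (y : 'I_r -> A),
  (forall i, y i \in homog A true) /\
  forall a, a \in homog A true -> exists b : 'I_r -> A, a = \sum_i b i * y i.
Proof.
move=> [s hs]; pose y (i : 'I_(size s)) := pr true (s`_i : A).
exists (size s), y; split=> [i|a a1]; first exact: pr_homog.
pose S (a : A) := exists b : 'I_(size s) -> A, pr true a = \sum_i b i * y i.
have -> : a = pr true a by rewrite pr_id.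
suff : a \in [pred a | `[< S a >]] by rewrite inE.
apply: hs => {a a1} [|a].
  split=> [|k u v|u v]; rewrite !inE.
  - exists (fun=> 0); rewrite (pr_off (b := true) (homog1 A)) big1 // => i _.
    exact: mul0r.
  - move=> [b hb] [c hc]; exists (fun i => k *: b i + c i); rewrite prD prZ hb hc scaler_sumr -big_split.
    by apply: eq_bigr => i _; rewrite mulrDl scalerAl.
  move=> [b hb] [c hc]; exists (fun i => pr false u * c i + pr false v * b i).
  rewrite pr1M -(even_comm _ (pr_homog false v)) hb hc !mulr_sumr -big_split.
  by apply: eq_bigr => i _; rewrite mulrDl !mulrA.
move=> sa; rewrite inE.
have ia : (index a s < size s)%N by rewrite index_mem.
exists (fun i => (i == Ordinal ia)%:R); rewrite (bigD1 (Ordinal ia)) //= eqxx mul1r.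
rewrite big1 => [|i /negbTE ->]; last by rewrite mul0r.
by rewrite addr0 /y nth_index.
Qed.

Lemma odd_generators_rank r (y : 'I_r -> A) : (forall i, y i \in homog A true) ->
  (forall a, a \in homog A true -> exists b : 'I_r -> A, a = \sum_i b i * y i) ->
  odd_rank G r.
Proof.
move=> y1 yg; exists y; split=> // a a1; have [b hb] := yg a a1.
exists (fun i => eps (b i)); rewrite -(pr_id a1) hb (raddf_sum (pr true)) /= -sumrB.
apply: (linclosed_sum (@cot0_lin K G)) => i _.
rewrite pr1M (pr_id (y1 i)) (pr_off (b := false) (y1 i)) mulr0 addr0.
apply: span_mem; exists (pr false (b i) - (eps (b i))%:A), (y i); split=> //.
- by apply: homogB; [exact: pr_homog | apply: homogZ; exact: homog1].
- by rewrite raddfB /= eps_pr0 linearZ rmorph1 /= mulr1 subrr.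
- by rewrite mulrBl -scalerAl mul1r.
Qed.

(** Coassociativity for z: comparing the two computations of [D u (L v z)] at some v with v z
    nonzero gives D_u g = u(g) g for every u. The counit law for z gives eps g = 1. *)
Lemma twisted_grouplike (z g : A) : z \in homog A true ->
  comul G z = pure 1 z + pure z g :> tensor A A -> z != 0 -> grouplike g.
Proof.
move=> z1 hz z0.
have Dz (u : {scalar A}) : D u z = (u z)%:A + u g *: z.
  by rewrite /D hz raddfD /= !rgt_pure.
have Lz (v : {scalar A}) : L v z = v 1 *: z + v z *: g.
  by rewrite /L hz raddfD /= !lft_pure.
have [v vz] : exists v : {scalar A}, v z != 0.
  apply: contrapT => nv; case/eqP: z0; apply: functional_eq => v; rewrite raddf0.
  by apply: contrapT => /eqP vz; apply: nv; exists v.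
have Dg (u : {scalar A}) : D u g = u g *: g.
  apply: (scalerI vz); have := DL_comm u v z.
  rewrite Lz Dz !raddfD /= !linearZ /= Dz Lz L1 !scalerDr !scalerA.
  by rewrite [u z * _]mulrC [u g * v 1]mulrC -!addrA => /addrI/addrI ->; rewrite mulrC.
have eg : eps g = 1.
  have := D_eps z; rewrite Dz /= (eps_odd z1) scale0r add0r => /eqP.
  by rewrite -subr_eq0 -{2}[z]scale1r -scalerBl scaler_eq0 (negbTE z0) orbF subr_eq0 => /eqP.
split=> //; apply: tensor_eqP => u v'; rewrite tlift_functionals Dg linearZ /= mulrC.
rewrite tlift_pure //; split=> [w|w] k x x'; rewrite linearP; first by rewrite mulrDl /= -mulrA.
by rewrite mulrDr /= mulrCA.
Qed.

End OddGenerators.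

(** An injective [pi] identifies G with its even part, so eigenvectors can be found there and their
    characters lifted back. *)
Lemma pointed_of_inj (K : fieldType) (G E : supergroup K) (pi : closed_subgroup E G) :
  injective pi -> pointed E -> pointed G.
Proof.
move=> pi_inj ptE d c d0 [cc ce].
have [|f [f0 [chi hf]]] := ptE d (fun i j => pi (c i j)) d0.
  split=> i j; last by rewrite eps_restr.
  have pb := restr_pure_bilin pi.
  rewrite comul_restr cc tlift_sum //; apply: eq_bigr => k _.
  exact: tlift_pure.
exists f; split=> //; have [chi' e] := restr_surj pi chi; exists chi' => i.
apply: pi_inj; rewrite smorZ e -hf smor_sum; apply: eq_bigr => j _; exact: smorZ.
Qed.

Definition elementary_factor (K : fieldType) (N G : supergroup K) (j : closed_subgroup N G) :=
  exists Q : supergroup K, is_quotient j Q /\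
    [\/ group_functor_iso Q (Ga_minus K), group_functor_iso Q (Gm K)
      | exists2 n, (1 < n)%N & group_functor_iso Q (mu K n)].

(** The chain seen from the top, each group containing the next as a normal subgroup. No embedding
    into the original group is recorded; [tower_flag] restores it. *)
Inductive tower (K : fieldType) : supergroup K -> Prop :=
| tower_base G : trigonalizable_group G -> tower G
| tower_step G N (j : closed_subgroup N G) :
    normal_subgroup j -> elementary_factor j -> tower N -> tower G.

(** * Induction on the odd rank *)

Section Induction.
Variable K : fieldType.
Hypothesis two_neq0 : (2%:R : K) != 0.

(** The step common to both cases, applied to G itself if g = 1 and to the subgroup g = 1 otherwise.
    The nonzero coefficient [al i] makes the rank bound drop. *)
Lemma primitive_step (d : nat) (G E : supergroup K) (pi : closed_subgroup E G)
    (z : Defs.coord G) :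
  (forall (N E' : supergroup K) (pi' : closed_subgroup E' N), is_even_part pi' ->
     affine_group E' -> pointed E' -> algebraic N -> odd_rank N d -> tower N) ->
  is_even_part pi -> affine_group E -> pointed E -> algebraic G ->
  z \in homog (Defs.coord G) true -> comul G z = pure 1 z + pure z 1 :> tensor _ _ ->
  z != 0 -> forall (w : 'I_d.+1 -> Defs.coord G) al i, odd_gen w ->
  cot0 (z - \sum_k al k *: w k) -> al i != 0 -> tower G.
Proof.
move=> IH pi_ev E_ev ptE G_alg z1 hz z0 w al i gw hal ali.
have [N [j [jker jn]]] := primitive_subgroup z1 hz.
have [Q [qQ isoQ]] := Ga_quotient two_neq0 z1 z0 hz jker.
have [E' [pi' [pi'_ev E'_ev ptE']]] := even_part_restr j pi_ev E_ev ptE.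
apply: (tower_step jn); first by exists Q; split=> //; apply: Or31.
apply: (IH N E' pi' pi'_ev E'_ev ptE' (algebraic_restr j G_alg)).
by apply: odd_rank_drop gw hal ali _; apply/jker; exists 1; rewrite mulr1.
Qed.

Lemma tower_exists d (G E : supergroup K) (pi : closed_subgroup E G) :
  is_even_part pi -> affine_group E -> pointed E -> algebraic G -> odd_rank G d -> tower G.
Proof.
elim/ltn_ind: d G E pi => d IH G E pi pi_ev E_ev ptE G_alg G_rk.
(* [odd_rank] is only an upper bound, so d is made minimal before a dual basis is taken. *)
have [[e ed e_rk]|dmin] := pselect (exists2 e, (e < d)%N & odd_rank G e).
  exact: IH ed _ _ _ pi_ev E_ev ptE G_alg e_rk.
have {}dmin e : (e < d)%N -> ~ odd_rank G e by move=> ed h; apply: dmin; exists e.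
have [r [y [y1 yg]]] := odd_generators G_alg.
have IpN := Ip_nilpotent two_neq0 y1 yg.
case: d => [|d] in IH G_rk dmin *.
  have [w gw] := G_rk; pose x (i : 'I_0) : {scalar (Defs.coord G)} := @eps K G.
  have pi0 a : pi a = 0 -> a = 0.
    (* With no odd derivations the only Taylor coefficient of a is [pi a], so [pi] is injective. *)
    move=> pia; apply: (@Taylor_inj K G E pi two_neq0 pi_ev E_ev 0 x (fun i => coinv (w i)) _ _ _ _ _ IpN).
    - by case.
    - by case.
    - by case.
    - by move=> b; apply: coinv_gen.
    by move=> S; have -> : enum S = [::] by case: (enum S) => // -[].
  have pi_inj : injective pi by move=> a b e; apply/subr0_eq/pi0; rewrite smorB e subrr.
  apply: tower_base; apply: pointed_trig G_alg (pointed_of_inj pi_inj ptE).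
  by move=> a a1; apply/pi0/(pi_odd pi E_ev).
have [z [g [z1 g0 hz [v [vd vz]]]]] := twisted_primitive two_neq0 pi_ev E_ev ptE (ltn0Sn d) G_rk dmin IpN.
have z0 : z != 0 by apply: contraNneq vz => ->; rewrite raddf0.
have hg := twisted_grouplike z1 hz z0.
have [w gw] := G_rk; have [al hal] := gw.2 z z1.
have [i ali] : exists i, al i != 0.
  apply: contrapT => nal; case/eqP: vz; move: hal; rewrite big1 ?subr0 => [|i _].
    by apply: (od_cot0 _ vd); exact: linearP.
  by apply/eqP; rewrite scaler_eq0; apply/orP; left; apply: contrapT => /negP h; apply: nal; exists i.
have IHd := IH d (ltnSn d).
have [g1|g1] := eqVneq g 1.
  apply: (primitive_step IHd pi_ev E_ev ptE G_alg z1 _ z0 gw hal ali).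
  by rewrite hz g1.
have [N [j [jker jn]]] := grouplike_subgroup g0 hg.2 hg.1.
have [Q [qQ isoQ]] := Gm_mu_quotient g0 hg g1 jker.
have [E' [pi' [pi'_ev E'_ev ptE']]] := even_part_restr j pi_ev E_ev ptE.
apply: (tower_step jn).
  by exists Q; split=> //; case: isoQ => h; [apply: Or32 | apply: Or33].
have jg : j g = 1.
  by apply/subr0_eq; rewrite -(smor1 j) -smorB; apply/jker; exists 1; rewrite mulr1.
apply: (primitive_step IHd pi'_ev E'_ev ptE' (algebraic_restr j G_alg) (smor_homog j z1) _ _
  (odd_gen_restr j gw) _ ali).
- have pb := restr_pure_bilin j; by rewrite comul_restr hz tliftD // !tlift_pure // smor1 jg.
(* z stays nonzero on the subgroup g = 1: the odd derivation v kills every multiple of g - 1, which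
   is even with counit 0, but not z. *)
- apply/eqP => /jker[c zc]; case/eqP: vz; rewrite zc (od_mul vd).
  rewrite (od_even vd) ?homogB ?homog1 // raddfB /= hg.2 rmorph1 subrr !mul0r addr0.
  by [].
- have := cot0_restr j hal; rewrite smorB smor_sum; congr (cot0 (_ - _)).
  by apply: eq_bigr => k _; rewrite smorZ.
Qed.

End Induction.

(** * From towers to chains inside a fixed group *)

Record subgroup_of (K : fieldType) (G : supergroup K) := SubgroupOf {
  sub_group : supergroup K;
  sub_incl : closed_subgroup sub_group G
}.

Section Flags.
Variable K : fieldType.
Implicit Types G N H : supergroup K.

Lemma id_subgroup_hopf G : hopf_morphism (G := G) (H := G) (smor_id (Defs.coord G)).
Proof.
have id_r R (x : smor (Defs.coord G) R) : smor_comp x (smor_id _) = x by exact: smorP.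
by move=> R x y; rewrite !id_r.
Qed.

Definition id_subgroup G : closed_subgroup G G :=
  @ClosedSubgroup K G G (smor_id _) (@id_subgroup_hopf G) (fun b => ex_intro _ b erefl).

Lemma comp_subgroup_hopf H N G (k : closed_subgroup H N) (j : closed_subgroup N G) :
  hopf_morphism (G := H) (H := G) (smor_comp k j).
Proof. by move=> R x y; rewrite !smor_compA (restr_hopf k) (restr_hopf j). Qed.

Lemma comp_subgroup_surj H N G (k : closed_subgroup H N) (j : closed_subgroup N G) b :
  exists a, smor_comp k j a = b.
Proof.
have [c <-] := restr_surj k b; have [a <-] := restr_surj j c; by exists a.
Qed.

Definition comp_subgroup H N G (k : closed_subgroup H N) (j : closed_subgroup N G) :
  closed_subgroup H G :=
  ClosedSubgroup (comp_subgroup_hopf k j) (comp_subgroup_surj k j).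

Definition flag_step G (p q : subgroup_of G) :=
  exists j : closed_subgroup (sub_group p) (sub_group q),
    [/\ smor_comp j (sub_incl q) = sub_incl p, normal_subgroup j & elementary_factor j].

Lemma tower_flag G : tower G -> exists t (F : nat -> subgroup_of G),
  [/\ trigonalizable_group (sub_group (F 0%N)), F t = SubgroupOf (id_subgroup G)
    & forall i, (i < t)%N -> flag_step (F i) (F i.+1)].
Proof.
elim=> {G} [G trig|G N k kn kf _ [t [F [F0 Ft FS]]]].
  by exists 0%N, (fun=> SubgroupOf (id_subgroup G)).
pose push (p : subgroup_of N) :
  subgroup_of G := SubgroupOf (comp_subgroup (sub_incl p) k).
exists t.+1, (fun i => if (i <= t)%N then push (F i) else SubgroupOf (id_subgroup G)).
split=> // [|i]; first by rewrite ltnn.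
rewrite ltnS => it; rewrite it; case: ltngtP it => // [it _|-> _].
  have [j [hj jn jf]] := FS i it; exists j; split=> //=.
  by rewrite smor_compA hj.
by rewrite Ft; exists k; split=> //; apply: smorP.
Qed.

End Flags.

Local Open Scope nat_scope.

Theorem theorem6p2 (K : fieldType) (G : supergroup K) :
  2 \notin [pchar K]%R -> algebraic G -> even_trigonalizable G ->
  exists (t : nat) (Gs : nat -> supergroup K)
         (inc : forall i, closed_subgroup (Gs i) G),
    [/\ trigonalizable_group (Gs 0),
        injective (inc t)
      & forall i, i < t ->
        exists j : closed_subgroup (Gs i) (Gs i.+1),
          [/\ smor_comp j (inc i.+1) = inc i,
              normal_subgroup j
            & exists Q : supergroup K,
                is_quotient j Q /\
                [\/ group_functor_iso Q (Ga_minus K),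
                    group_functor_iso Q (Gm K)
                  | exists2 n, 1 < n & group_functor_iso Q (mu K n)]]].
Proof.
move=> char2 G_alg [E [pi [pi_ev trigE]]]; have [E_ev _ _] := trigE.
have two_neq0 : (2%:R != 0 :> K)%R by apply: contra char2; rewrite inE.
have [r [y [y1 yg]]] := odd_generators G_alg.
have G_rk := odd_generators_rank y1 yg.
have [t [F [F0 Ft FS]]] := tower_flag
  (tower_exists two_neq0 pi_ev E_ev (trig_pointed trigE) G_alg G_rk).
exists t, (fun i => sub_group (F i)), (fun i => sub_incl (F i)); split=> //.
by rewrite Ft.
Qed.
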